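(* Let $K$ be a field. For $n\ge1$ let $p_n=\dim_K\big(Prim_{tot}((\mathbf{FQSym})_+)_n\big)$ be the dimension of the degree-$n$ component of the space $Prim_{tot}((\mathbf{FQSym})_+)=\{a:\Delta_\prec(a)=\Delta_\succ(a)=0\}$ of totally primitive elements of $(\mathbf{FQSym})_+$. Let $\mathcal D$ be a graded set such that $\mathcal D_0=\emptyset$ and $\mathrm{card}(\mathcal D_n)=p_n$ for all $n\ge1$. Then $(\mathbf{FQSym})_+$ and $\mathcal A^{\mathcal D}$ are isomorphic as graded bidendriform bialgebras. Hence $\mathbf{FQSym}$ and $\mathcal H^{\mathcal D}$ are isomorphic as graded Hopf algebras.
   Context: **Bidendriform bialgebras.** A dendriform algebra is a $K$-vector space $A$ with linear maps $\prec,\succ:A\otimes A\to A$ such that for all $a,b,c$: $(a\prec b)\prec c=a\prec(b\prec c+b\succ c)$, $(a\succ b)\prec c=a\succ(b\prec c)$, $(a\prec b+a\succ b)\succ c=a\succ(b\succ c)$. One writes $ab=a\prec b+a\succ b$. A dendriform coalgebra is a $K$-vector space $C$ with $\Delta_\prec,\Delta_\succ:C\to C\otimes C$ such that, with $\tilde\Delta=\Delta_\prec+\Delta_\succ$: $(\Delta_\prec\otimes Id)\Delta_\prec=(Id\otimes\tilde\Delta)\Delta_\prec$, $(\Delta_\succ\otimes Id)\Delta_\prec=(Id\otimes\Delta_\prec)\Delta_\succ$, $(\tilde\Delta\otimes Id)\Delta_\succ=(Id\otimes\Delta_\succ)\Delta_\succ$. Notation (sums implicit): $\Delta_\prec(a)=a'_\prec\otimes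 a''_\prec$, $\Delta_\succ(a)=a'_\succ\otimes a''_\succ$, $\tilde\Delta(a)=a'\otimes a''$. A bidendriform bialgebra is $(A,\prec,\succ,\Delta_\prec,\Delta_\succ)$, both a dendriform algebra and a dendriform coalgebra, such that for all $a,b$: $\Delta_\succ(a\succ b)=a'b'_\succ\otimes a''\succ b''_\succ+a'\otimes a''\succ b+b'_\succ\otimes a\succ b''_\succ+ab'_\succ\otimes b''_\succ+a\otimes b$; $\Delta_\succ(a\prec b)=a'b'_\succ\otimes a''\prec b''_\succ+a'\otimes a''\prec b+b'_\succ\otimes a\prec b''_\succ$; $\Delta_\prec(a\succ b)=a'b'_\prec\otimes a''\succ b''_\prec+ab'_\prec\otimes b''_\prec+b'_\prec\otimes a\succ b''_\prec$; $\Delta_\prec(a\prec b)=a'b'_\prec\otimes a''\prec b''_\prec+a'b\otimes a''+b'_\prec\otimes a\prec b''_\prec+b\otimes a$. Morphisms are linear maps compatible with the four operations; graded means $\mathbb N$-graded with the four operations homogeneous of degree $0$. **FQSym.** $\mathbf{FQSym}$ has basis $(\mathbf F_u)$, $u\in\bigsqcup_{n\ge0}S_n$, with $\mathbf F_u$ of degree $n$ if $u\in S_n$; permutations are written as words $u=(u_1\ldots u_n)$. Product: $\mathbf F_u\mathbf F_v$ ($u\in S_n$, $v\in S_m$) is the sum of $\mathbf F_w$ over all shuffles $w$ of the words $u_1\ldots u_n$ and $(v_1+n)\ldots(v_m+n)$; coproduct: $\Delta(\mathbf F_u)=\sum_{i=0}^n\mathbf F_{st(u_1\ldots u_i)}\otimes\mathbf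 F_{st(u_{i+1}\ldots u_n)}$, where $st$ is standardization; unit $1=\mathbf F_\emptyset$. $(\mathbf{FQSym})_+$ is spanned by the $\mathbf F_u$, $u\in S_n$, $n\ge1$, with bidendriform structure: for $u\in S_n$, $v\in S_m$, $\mathbf F_u\prec\mathbf F_v$ (resp. $\mathbf F_u\succ\mathbf F_v$) is the sum of $\mathbf F_w$ over all shuffles $w$ of the words $u_1\ldots u_n$ and $(v_1+n)\ldots(v_m+n)$ whose last letter is $u_n$ (resp. $v_m+n$); $\Delta_\prec(\mathbf F_u)=\sum_{i=u^{-1}(n)}^{n-1}\mathbf F_{st(u_1\ldots u_i)}\otimes\mathbf F_{st(u_{i+1}\ldots u_n)}$, $\Delta_\succ(\mathbf F_u)=\sum_{i=1}^{u^{-1}(n)-1}\mathbf F_{st(u_1\ldots u_i)}\otimes\mathbf F_{st(u_{i+1}\ldots u_n)}$. **Trees.** A graded set is a set $\mathcal D$ with a map $|\cdot|:\mathcal D\to\mathbb N$; $\mathcal D_n=\{d:|d|=n\}$. $\mathbb T^{\mathcal D}$ is the set of planar rooted trees with vertices decorated by $\mathcal D$; $\mathbb F^{\mathcal D}$ the set of planar forests (finite, possibly empty, ordered sequences of such trees; empty forest $1$). $\mathcal H^{\mathcal D}$ is the free associative unital $K$-algebra on $\mathbb T^{\mathcal D}$, with basis $\mathbb F^{\mathcal D}$ and product concatenation. A forest $F$ has degree $|F|=\sum_s|\text{decoration of }s|$ over its vertices $s$. $\bullet_d$ is the one-vertex tree decorated by $d$; $B_d^+$ is the linear map grafting the trees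 of a forest (in order) on a common root decorated by $d$. An admissible cut $c$ of a tree $t$ is a nonempty set of edges such that every path from the root to a leaf meets at most one of them; $R^c(t)$ is the component of the root, $P^c(t)$ the planar forest of the other components (in the same order). One adds the empty cut ($P=1,R=t$) and the total cut ($P=t,R=1$), giving $\mathcal Adm_*(t)$. For $F=t_1\cdots t_n$, $\mathcal Adm_*(F)=\prod_i\mathcal Adm_*(t_i)$, $P^c(F)=\prod_iP^{c_i}(t_i)$, $R^c(F)=\prod_iR^{c_i}(t_i)$ (ordered products). The coproduct is $\Delta(F)=\sum_{c\in\mathcal Adm_*(F)}P^c(F)\otimes R^c(F)$, the counit $\varepsilon(F)=\delta_{F,1}$. $\mathcal A^{\mathcal D}=\ker\varepsilon$ and $\tilde\Delta(x)=\Delta(x)-x\otimes1-1\otimes x$ there. $\mathcal A^{\mathcal D}$ carries the unique dendriform algebra structure with $x\prec y+x\succ y=xy$ and $\bullet_d\prec x=B_d^+(x)$ for all $d\in\mathcal D$, $x\in\mathcal A^{\mathcal D}$ (it is then free on the $\bullet_d$), and $\Delta_\prec,\Delta_\succ$ on $\mathcal A^{\mathcal D}$ are the unique maps making it a bidendriform bialgebra with $\Delta_\prec+\Delta_\succ=\tilde\Delta$ and $\Delta_\prec(\bullet_d)=\Delta_\succ(\bullet_d)=0$ for all $d$. *)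

(* Defs.v *)
From HB Require Import structures.
From mathcomp Require Import all_boot all_algebra.
From mathcomp Require Import finmap.
From mathcomp.multinomials Require Import monalg.

Set Implicit Arguments.
Unset Strict Implicit.
Unset Printing Implicit Defensive.

Import GRing.Theory.
Local Open Scope ring_scope.

Reserved Notation "x ⊗ y" (at level 40, left associativity).
Reserved Notation "a ≺ b" (at level 40, left associativity).
Reserved Notation "a ≻ b" (at level 40, left associativity).
Reserved Notation "a ⋅ b" (at level 40, left associativity).
Reserved Notation "\sw_ ( x , y <- t ) E"
  (at level 41, x, y at level 99, t at level 200, E at level 41,
   format "\sw_ ( x ,  y  <-  t )  E").

(* All vector spaces below come with a distinguished basis: the space with    *)
(* basis X is {malg K[X]}, the basis vector of u : X is << u >>, and the      *)
(* tensor product of {malg K[X]} and {malg K[Y]} is {malg K[X * Y]}, where    *)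
(* << (u, v) >> stands for << u >> ⊗ << v >>.                                 *)

Section LinearExtension.

Variables (K : fieldType) (X : choiceType) (W : lmodType K).

Definition linext (f : X -> W) (x : {malg K[X]}) : W :=
  \sum_(u <- msupp x) x@_u *: f u.

Lemma linextEw (f : X -> W) (d : {fset X}) (x : {malg K[X]}) :
  (msupp x `<=` d)%fset -> linext f x = \sum_(u <- d) x@_u *: f u.
Proof.
move=> le; rewrite /linext; apply: (big_fset_incl _ le) => u _ /mcoeff_outdom ->.
by rewrite scale0r.
Qed.

Lemma linext_is_linear (f : X -> W) : linear (linext f).
Proof.
move=> c x y; pose d := (msupp x `|` msupp y `|` msupp (c *: x + y))%fset.
rewrite (@linextEw f d (c *: x + y)) ?fsubsetUr //.
rewrite (@linextEw f d x); last by rewrite /d -fsetUA fsubsetUl.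
rewrite (@linextEw f d y); last first.
  by rewrite /d [(msupp x `|` _)%fset]fsetUC -fsetUA fsubsetUl.
rewrite scaler_sumr -big_split /=; apply: eq_bigr => u _.
by rewrite mcoeffD mcoeffZ scalerDl scalerA.
Qed.

HB.instance Definition _ (f : X -> W) :=
  GRing.isLinear.Build K {malg K[X]} W *:%R (linext f) (linext_is_linear f).

Lemma linextU (f : X -> W) (u : X) : linext f << u >> = f u.
Proof. by rewrite (linextEw f msuppU_le) big_seq_fset1 mcoeffUU scale1r. Qed.

End LinearExtension.

Section Tensor.

Variable K : fieldType.

Definition tens (X Y : choiceType) (x : {malg K[X]}) (y : {malg K[Y]}) :
    {malg K[(X * Y)%type]} :=
  \sum_(u <- msupp x) \sum_(v <- msupp y) << x@_u * y@_v *g (u, v) >>.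

(* Sweedler notation: \sw_(x, y <- t) E is the value at t of the linear map   *)
(* with x ⊗ y |-> E; it is only used with E bilinear in (x, y).               *)
Definition sweedler (X Y : choiceType) (W : lmodType K)
    (t : {malg K[(X * Y)%type]})
    (E : {malg K[X]} -> {malg K[Y]} -> W) : W :=
  linext (fun p : (X * Y)%type => E << p.1 >> << p.2 >>) t.

End Tensor.

Notation "x ⊗ y" := (tens x y) : ring_scope.
Notation "\sw_ ( x , y <- t ) E" := (sweedler t (fun x y => E)) : ring_scope.

Definition tmap (K : fieldType) (X Y X' Y' : choiceType)
    (f : {malg K[X]} -> {malg K[X']}) (g : {malg K[Y]} -> {malg K[Y']})
    (t : {malg K[(X * Y)%type]}) : {malg K[(X' * Y')%type]} :=
  \sw_(x, y <- t) (f x ⊗ g y).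

Definition homogeneous (K : fieldType) (X : choiceType) (deg : X -> nat)
    (n : nat) (x : {malg K[X]}) : Prop :=
  forall u, u \in msupp x -> deg u = n.

Definition has_dim (K : fieldType) (V : lmodType K) (P : V -> Prop)
    (d : nat) : Prop :=
  exists b : 'I_d -> V,
    [/\ forall i, P (b i),
        forall c : 'I_d -> K, \sum_i c i *: b i = 0 -> forall i, c i = 0
      & forall x, P x -> exists c : 'I_d -> K, x = \sum_i c i *: b i].

Definition has_card (T : Type) (P : T -> Prop) (d : nat) : Prop :=
  exists2 e : 'I_d -> T, injective e & forall x, P x <-> exists i, e i = x.

Record bidend_ops (K : fieldType) (X : choiceType) := BidendOps {
  bprec : {linear {malg K[(X * X)%type]} -> {malg K[X]}};
  bsucc : {linear {malg K[(X * X)%type]} -> {malg K[X]}};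
  dprec : {linear {malg K[X]} -> {malg K[(X * X)%type]}};
  dsucc : {linear {malg K[X]} -> {malg K[(X * X)%type]}}
}.

Section Bidendriform.

Variables (K : fieldType) (X : choiceType) (S : bidend_ops K X).

Definition bmul (a b : {malg K[X]}) : {malg K[X]} :=
  bprec S (a ⊗ b) + bsucc S (a ⊗ b).

Definition dred (a : {malg K[X]}) : {malg K[(X * X)%type]} :=
  dprec S a + dsucc S a.

Local Notation "a ≺ b" := (bprec S (a ⊗ b)).
Local Notation "a ≻ b" := (bsucc S (a ⊗ b)).
Local Notation "a ⋅ b" := (bmul a b).
Local Notation Dp := (dprec S).
Local Notation Ds := (dsucc S).
Local Notation Dt := dred.

Definition dendriform_algebra : Prop :=
  forall a b c : {malg K[X]},
    [/\ (a ≺ b) ≺ c = a ≺ (b ≺ c + b ≻ c),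
        (a ≻ b) ≺ c = a ≻ (b ≺ c)
      & (a ≺ b + a ≻ b) ≻ c = a ≻ (b ≻ c)].

(* The triple tensor product is parenthesized to the right.                   *)
Definition dendriform_coalgebra : Prop :=
  forall a : {malg K[X]},
    [/\ \sw_(a1, a2 <- Dp a) \sw_(x, y <- Dp a1) (x ⊗ (y ⊗ a2))
          = \sw_(a1, a2 <- Dp a) (a1 ⊗ Dt a2),
        \sw_(a1, a2 <- Dp a) \sw_(x, y <- Ds a1) (x ⊗ (y ⊗ a2))
          = \sw_(a1, a2 <- Ds a) (a1 ⊗ Dp a2)
      & \sw_(a1, a2 <- Ds a) \sw_(x, y <- Dt a1) (x ⊗ (y ⊗ a2))
          = \sw_(a1, a2 <- Ds a) (a1 ⊗ Ds a2)].

Definition bidendriform_compat : Prop :=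
  forall a b : {malg K[X]},
    [/\ Ds (a ≻ b) =
            \sw_(a1, a2 <- Dt a) \sw_(b1, b2 <- Ds b) ((a1 ⋅ b1) ⊗ (a2 ≻ b2))
          + \sw_(a1, a2 <- Dt a) (a1 ⊗ (a2 ≻ b))
          + \sw_(b1, b2 <- Ds b) (b1 ⊗ (a ≻ b2))
          + \sw_(b1, b2 <- Ds b) ((a ⋅ b1) ⊗ b2)
          + a ⊗ b,
        Ds (a ≺ b) =
            \sw_(a1, a2 <- Dt a) \sw_(b1, b2 <- Ds b) ((a1 ⋅ b1) ⊗ (a2 ≺ b2))
          + \sw_(a1, a2 <- Dt a) (a1 ⊗ (a2 ≺ b))
          + \sw_(b1, b2 <- Ds b) (b1 ⊗ (a ≺ b2)),
        Dp (a ≻ b) =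
            \sw_(a1, a2 <- Dt a) \sw_(b1, b2 <- Dp b) ((a1 ⋅ b1) ⊗ (a2 ≻ b2))
          + \sw_(b1, b2 <- Dp b) ((a ⋅ b1) ⊗ b2)
          + \sw_(b1, b2 <- Dp b) (b1 ⊗ (a ≻ b2))
      & Dp (a ≺ b) =
            \sw_(a1, a2 <- Dt a) \sw_(b1, b2 <- Dp b) ((a1 ⋅ b1) ⊗ (a2 ≺ b2))
          + \sw_(a1, a2 <- Dt a) ((a1 ⋅ b) ⊗ a2)
          + \sw_(b1, b2 <- Dp b) (b1 ⊗ (a ≺ b2))
          + b ⊗ a].

Definition bidendriform_bialgebra : Prop :=
  [/\ dendriform_algebra, dendriform_coalgebra & bidendriform_compat].

Definition prim_tot (a : {malg K[X]}) : Prop := Dp a = 0 /\ Ds a = 0.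

End Bidendriform.

Definition graded_bidend_iso (K : fieldType) (X Y : choiceType)
    (degX : X -> nat) (degY : Y -> nat)
    (S : bidend_ops K X) (T : bidend_ops K Y) : Prop :=
  exists f : {linear {malg K[X]} -> {malg K[Y]}},
    [/\ bijective f,
        forall n x, homogeneous degX n x -> homogeneous degY n (f x),
        (forall a b, f (bprec S (a ⊗ b)) = bprec T (f a ⊗ f b)) /\
        (forall a b, f (bsucc S (a ⊗ b)) = bsucc T (f a ⊗ f b))
      & (forall a, dprec T (f a) = tmap f f (dprec S a)) /\
        (forall a, dsucc T (f a) = tmap f f (dsucc S a))].

Record hopf_ops (K : fieldType) (X : choiceType) := HopfOps {
  hmul : {malg K[X]} -> {malg K[X]} -> {malg K[X]};
  hone : {malg K[X]};
  hcop : {malg K[X]} -> {malg K[(X * X)%type]};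
  hcounit : {malg K[X]} -> K
}.

(* The antipode is determined by the other operations and is automatically    *)
(* preserved by isomorphisms of bialgebras.                                   *)
Definition graded_hopf_iso (K : fieldType) (X Y : choiceType)
    (degX : X -> nat) (degY : Y -> nat)
    (H : hopf_ops K X) (L : hopf_ops K Y) : Prop :=
  exists f : {linear {malg K[X]} -> {malg K[Y]}},
    [/\ bijective f,
        forall n x, homogeneous degX n x -> homogeneous degY n (f x),
        (forall a b, f (hmul H a b) = hmul L (f a) (f b)) /\
        f (hone H) = hone L
      & (forall a, hcop L (f a) = tmap f f (hcop H a)) /\
        (forall a, hcounit L (f a) = hcounit H a)].

Definition is_perm_word (w : seq nat) : bool := perm_eq w (iota 1 (size w)).

(* The disjoint union of the S_n, n >= 0 (resp. n >= 1).                      *)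
Definition perm_word := {w : seq nat | is_perm_word w}.
Definition perm_word_pos := {w : seq nat | is_perm_word w && (w != [::])}.

HB.instance Definition _ := Choice.on perm_word.
HB.instance Definition _ := Choice.on perm_word_pos.

Definition shift (n : nat) (v : seq nat) : seq nat := map (addn n) v.

Fixpoint shuffles (u : seq nat) : seq nat -> seq (seq nat) :=
  fix shuffles_u (v : seq nat) : seq (seq nat) :=
    match u, v with
    | [::], _ => [:: v]
    | _, [::] => [:: u]
    | a :: u', b :: v' =>
        map (cons a) (shuffles u' v) ++ map (cons b) (shuffles_u v')
    end.

(* Only applied to words with pairwise distinct letters.                      *)
Definition std (w : seq nat) : seq nat :=
  [seq count (fun y => y <= x)%N w | x <- w].

Section FQSym.

Variable K : fieldType.

(* F_w, extended by 0 to the words w that are not in the index set; no such   *)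
(* word occurs in the formulas below.                                         *)
Definition F_ (P : pred (seq nat)) (w : seq nat) :
    {malg K[{u : seq nat | P u}]} :=
  if insub w is Some u then << u >> else 0.

Local Notation F0 := (@F_ is_perm_word).
Local Notation Fp := (@F_ (fun w => is_perm_word w && (w != [::]))).

Definition fqsym_mul (x y : {malg K[perm_word]}) : {malg K[perm_word]} :=
  linext (fun p : perm_word * perm_word =>
    let: (u, v) := (val p.1, val p.2) in
    \sum_(w <- shuffles u (shift (size u) v)) F0 w) (x ⊗ y).

Definition fqsym_cop :
    {malg K[perm_word]} -> {malg K[(perm_word * perm_word)%type]} :=
  linext (fun u : perm_word => \sum_(0 <= i < (size (val u)).+1)
    F0 (std (take i (val u))) ⊗ F0 (std (drop i (val u)))).

Definition fqsym_hopf : hopf_ops K perm_word :=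
  HopfOps fqsym_mul (F0 [::]) fqsym_cop
    (linext (fun u : perm_word => ((val u == [::])%:R : K^o))).

Definition fqsym_prec_basis (p : perm_word_pos * perm_word_pos) :
    {malg K[perm_word_pos]} :=
  let: (u, v) := (val p.1, val p.2) in
  \sum_(w <- shuffles u (shift (size u) v) | last 0 w == last 0 u) Fp w.

Definition fqsym_succ_basis (p : perm_word_pos * perm_word_pos) :
    {malg K[perm_word_pos]} :=
  let: (u, v) := (val p.1, val p.2) in
  \sum_(w <- shuffles u (shift (size u) v) |
      last 0 w == last 0 (shift (size u) v)) Fp w.

(* With n = size u, u^-1(n) is (index n u).+1, as index counts from 0.        *)
Definition fqsym_dprec_basis (u : perm_word_pos) :
    {malg K[(perm_word_pos * perm_word_pos)%type]} :=
  let n := size (val u) in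
  \sum_((index n (val u)).+1 <= i < n)
    Fp (std (take i (val u))) ⊗ Fp (std (drop i (val u))).

Definition fqsym_dsucc_basis (u : perm_word_pos) :
    {malg K[(perm_word_pos * perm_word_pos)%type]} :=
  let n := size (val u) in
  \sum_(1 <= i < (index n (val u)).+1)
    Fp (std (take i (val u))) ⊗ Fp (std (drop i (val u))).

Definition fqsym_bidend : bidend_ops K perm_word_pos :=
  BidendOps (linext fqsym_prec_basis) (linext fqsym_succ_basis)
            (linext fqsym_dprec_basis) (linext fqsym_dsucc_basis).

End FQSym.

Definition perm_deg (u : perm_word) : nat := size (val u).
Definition perm_pos_deg (u : perm_word_pos) : nat := size (val u).

Inductive tree (D : Type) := Node of D & seq (tree D).

Section TreeChoice.

Variable D : choiceType.

Fixpoint tree_encode (t : tree D) : GenTree.tree D :=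
  let: Node d l := t in
  GenTree.Node 0 (GenTree.Leaf d :: map tree_encode l).

Fixpoint tree_decode (g : GenTree.tree D) : option (tree D) :=
  if g is GenTree.Node _ (GenTree.Leaf d :: l) then
    Some (Node d (pmap tree_decode l))
  else None.

Lemma tree_encodeK : pcancel tree_encode tree_decode.
Proof.
rewrite /pcancel; fix IH 1 => -[d l] /=; congr (Some (Node d _)).
elim: l => //= t l IHl; rewrite IH /=; congr (_ :: _); exact: IHl.
Qed.

HB.instance Definition _ := Choice.copy (tree D) (pcan_type tree_encodeK).

End TreeChoice.

Notation forest D := {fmonom (tree D)}.
Notation mkforest s := (@FMonom _ s).

Fixpoint tree_deg (D : Type) (deg : D -> nat) (t : tree D) : nat :=
  let: Node d l := t in deg d + sumn (map (tree_deg deg) l).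

Definition forest_deg (D : choiceType) (deg : D -> nat) (F : forest D) : nat :=
  sumn (map (tree_deg deg) F).

Fixpoint choices (T : Type) (s : seq (seq T)) : seq (seq T) :=
  if s is l :: s' then [seq x :: y | x <- l, y <- choices s'] else [:: [::]].

(* A cut of a tree is encoded by marking vertices: a mark on a vertex other   *)
(* than the root means that the edge above it is cut, so that sets of edges   *)
(* are the markings that leave the root unmarked (the empty one being the     *)
(* empty cut), and the total cut is the marking of the root alone. With this  *)
(* encoding, Adm_*(t) consists of the markings with at most one mark on every *)
(* path from the root to a leaf.                                              *)
Section Cuts.

Variable D : Type.

Fixpoint markings (t : tree D) : seq (tree (D * bool)) :=
  let: Node d l := t in
  [seq Node (d, b) l' | b <- [:: false; true], l' <- choices (map markings l)].

Fixpoint leaf_paths (A : Type) (t : tree A) : seq (seq A) :=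
  let: Node a l := t in
  if l is [::] then [:: [:: a]]
  else [seq a :: p | p <- flatten (map (@leaf_paths A) l)].

Definition admissible (m : tree (D * bool)) : bool :=
  all (fun p => count snd p <= 1)%N (leaf_paths m).

Definition adm (t : tree D) : seq (tree (D * bool)) :=
  [seq m <- markings t | admissible m].

Definition adm_forest (F : seq (tree D)) : seq (seq (tree (D * bool))) :=
  choices (map adm F).

Fixpoint unmark (m : tree (D * bool)) : tree D :=
  let: Node a l := m in Node a.1 (map unmark l).

Fixpoint cutP (m : tree (D * bool)) : seq (tree D) :=
  let: Node a l := m in
  if a.2 then [:: unmark m] else flatten (map cutP l).

Fixpoint cutR (m : tree (D * bool)) : seq (tree D) :=
  let: Node a l := m in
  if a.2 then [::] else [:: Node a.1 (flatten (map cutR l))].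

Definition cutP_forest (c : seq (tree (D * bool))) : seq (tree D) :=
  flatten (map cutP c).
Definition cutR_forest (c : seq (tree (D * bool))) : seq (tree D) :=
  flatten (map cutR c).

End Cuts.

Section TreeAlgebra.

Variables (K : fieldType) (D : choiceType).

Definition forest_cop :
    {malg K[forest D]} -> {malg K[(forest D * forest D)%type]} :=
  linext (fun F : forest D => \sum_(c <- adm_forest F)
    << mkforest (cutP_forest c) >> ⊗ << mkforest (cutR_forest c) >>).

Definition forest_counit : {malg K[forest D]} -> K :=
  linext (fun F : forest D => ((F == mone)%:R : K^o)).

(* H^D is the monoid algebra of the free monoid on the trees.                 *)
Definition forest_hopf : hopf_ops K (forest D) :=
  HopfOps (fun x y => x * y) 1 forest_cop forest_counit.

Definition Bplus (d : D) : {malg K[forest D]} -> {malg K[forest D]} :=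
  linext (fun F : forest D => << mkforest [:: Node d F] >>).

(* A^D, the kernel of the counit, is taken as the space with basis the        *)
(* nonempty forests; see forest_counit_kernel.                                *)
Definition forest_pos := {F : forest D | F != mone}.

HB.instance Definition _ := Choice.on forest_pos.

Definition aug_incl : {malg K[forest_pos]} -> {malg K[forest D]} :=
  linext (fun F : forest_pos => << val F >>).

Lemma aug_incl_inj : injective aug_incl.
Proof.
have coefE x (F : forest_pos) : (aug_incl x)@_(val F) = x@_F.
  rewrite /aug_incl /linext raddf_sum /=.
  under eq_bigr => u _ do rewrite mcoeffZ mcoeffU1 (inj_eq val_inj).
  have [Fx|Fx] := boolP (F \in msupp x).
    rewrite (big_fsetD1 F) //= eqxx mulr1 big1_fset ?addr0 // => G.
    by rewrite !inE => /andP[/negbTE -> _] _; rewrite mulr0.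
  rewrite mcoeff_outdom // big1_fset // => G Gx _.
  by case: eqP Gx Fx => [-> ->|]; rewrite ?mulr0.
by move=> x y exy; apply/malgP => F; rewrite -!coefE exy.
Qed.

Lemma forest_counit_kernel (x : {malg K[forest D]}) :
  forest_counit x = 0 <-> exists y, x = aug_incl y.
Proof.
have counitE z : forest_counit z = z@_(mone : forest D).
  rewrite /forest_counit /linext.
  have [zs|zs] := boolP ((mone : forest D) \in msupp z).
    rewrite (big_fsetD1 (mone : forest D)) //= eqxx big1_fset ?addr0 => [|G].
      exact: mulr1.
    by rewrite !inE => /andP[/negbTE -> _] _; rewrite scaler0.
  rewrite mcoeff_outdom // big1_fset // => G Gz _.
  by case: eqP Gz zs => [-> ->|]; rewrite ?scaler0.
split=> [|[y ->]]; rewrite counitE; last first.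
  rewrite /aug_incl /linext raddf_sum /= big1_fset // => F _ _.
  by rewrite mcoeffZ mcoeffU1 (negbTE (valP F)) mulr0.
move=> x1; pose g (F : forest D) : {malg K[forest_pos]} :=
  if insub F is Some G then << G >> else 0.
exists (linext g x); rewrite [in RHS]/linext /aug_incl raddf_sum /=.
rewrite [LHS]monalgE big_seq [RHS]big_seq; apply: eq_bigr => F Fx.
rewrite linearZ /= /g; case: insubP => [G _ eG|]; last first.
  by rewrite negbK => /eqP F1; move: Fx; rewrite F1 -mcoeff_neq0 x1 eqxx.
rewrite linextU eG; apply/malgP => H.
by rewrite mcoeffZ !mcoeffU mulr_natr.
Qed.

(* The one-vertex tree with decoration d, as an element of A^D.               *)
Fact dot_subproof (d : D) : mkforest [:: Node d [::]] != mone :> forest D.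
Proof. by apply/eqP => /(congr1 (@fmonom_val _)); rewrite fm1. Qed.

Definition dot (d : D) : {malg K[forest_pos]} :=
  << (Sub (mkforest [:: Node d [::]]) (dot_subproof d) : forest_pos) >>.

(* The conditions that characterize the bidendriform bialgebra A^D.           *)
Definition is_tree_bidend (S : bidend_ops K forest_pos) : Prop :=
  [/\ bidendriform_bialgebra S,
      forall x y, aug_incl (bprec S (x ⊗ y) + bsucc S (x ⊗ y))
                  = aug_incl x * aug_incl y,
      forall d x, aug_incl (bprec S (dot d ⊗ x)) = Bplus d (aug_incl x),
      forall x, tmap aug_incl aug_incl (dprec S x + dsucc S x)
                = forest_cop (aug_incl x) - aug_incl x ⊗ 1 - 1 ⊗ aug_incl x
    & forall d, dprec S (dot d) = 0 /\ dsucc S (dot d) = 0].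

Definition forest_pos_deg (deg : D -> nat) (F : forest_pos) : nat :=
  forest_deg deg (val F).

End TreeAlgebra.

(* Main.v *)
(* Let T be a connected graded bidendriform bialgebra. Recursively on the     *)
(* degree, put P(a) = a - a''P(a') with a' ⊗ a'' = Δ≺(a): coassociativity     *)
(* gives Δ≺(P a) = 0, and the compatibilities give P(ab) = 0 together with    *)
(* P(a ≻ b) = a ≻ P(b) + (a ≺ b'') ≻ P(b'). Then                              *)
(* Q(a) = P(a) - x ≻ Q(y), with x ⊗ y = Δ≻(P a), is a projection onto the     *)
(* totally primitive elements which kills ab and a ≻ b. Reading the two       *)
(* formulas backwards expresses a by Q and by elements of lower degree; this  *)
(* recursion extends any linear map on the totally primitive elements to a    *)
(* morphism of dendriform algebras, so T is freely generated by them. For     *)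
(* T = (FQSym)_+ this gives a dendriform isomorphism with A^D, along which    *)
(* the coproducts are transported; they are the required ones because both    *)
(* the transported coproduct and the one by admissible cuts are multiplicative*)
(* and satisfy Δ(B_d(x)) = B_d(x) ⊗ 1 + (Id ⊗ B_d)Δ(x).                       *)

(* Rigidity is at work here: in a bidendriform bialgebra T with positive degrees, the coproducts
   force the dendriform algebra to be free on the totally primitive elements. The operator P of the
   sketch above is [exists_proj_dprec]; its values are killed by Δ≺ ([dprec_proj]). The operator Q
   is [exists_proj_prim]; its values are totally primitive ([proj_prim_tot]). The decisive facts are
   that P kills products ([proj_dprec_mul]) and that Q kills products and all a ≻ b
   ([proj_prim_mul], [proj_prim_succ]). Hence Q identifies the totally primitive elements with the
   indecomposables of the dendriform algebra.

   Freeness is obtained from two mutually inverse morphisms, without counting dimensions. In one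
   direction, [eval_map] extends the assignment of a basis of totally primitive elements to the
   decorations; [exists_prim_family] chooses this assignment degree by degree, which is possible
   because the number of decorations of degree n is p_n. In the other direction, [exists_lift]
   solves the formulas for P and Q backwards, and [lift_mul] and [lift_succ] show that the solution
   is a morphism. One composite fixes the dots and is the identity by [dend_morphism_ext]; the other
   is the identity by [lift_section]. The result is [exists_dendriform_iso].

   Coproducts then cost little. The compatibility formulas compute Δ≺ and Δ≻ of a ≺ b and a ≻ b from
   those of a and b, so a dendriform isomorphism that sends dots to totally primitive elements
   respects the coproducts everywhere ([tree_bidend_compatible]). In the same way the coproducts of
   T can be carried over to the forests ([transported_tree_bidend]), where [full_copE] recognizes
   their sum as the coproduct by admissible cuts.

   It remains that (FQSym)_+ is a bidendriform bialgebra ([fqsym_bidendriform]). Everything there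
   reduces to the compatibility of shuffling with cutting words ([big_splits_shuffles]): the half
   products record the last letter of a shuffle, the half coproducts record the side of the cut that
   contains the maximal letter. Adding units gives the Hopf statement ([hopf_iso]). *)
Require Import Defs.
From mathcomp Require Import all_boot all_algebra.
From mathcomp Require Import finmap zify ring.
From mathcomp.multinomials Require Import monalg.
From Stdlib Require Import ClassicalEpsilon.

Set Implicit Arguments.
Unset Strict Implicit.
Unset Printing Implicit Defensive.

Import GRing.Theory.
Local Open Scope ring_scope.

(* Unifying two distinct tensors or Sweedler sums by unfolding them takes very *)
(* long; the operations of Defs are therefore used in a locked form.          *)
Fact lock_key : unit. Proof. exact: tt. Qed.

Definition ltens (K : fieldType) (X Y : choiceType) :=
  locked_with lock_key (@tens K X Y).
Definition lsw (K : fieldType) (X Y : choiceType) (W : lmodType K) :=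
  locked_with lock_key (@sweedler K X Y W).
Definition lbmul (K : fieldType) (X : choiceType) :=
  locked_with lock_key (@bmul K X).
Definition ldred (K : fieldType) (X : choiceType) :=
  locked_with lock_key (@dred K X).
Definition ltmap (K : fieldType) (X Y X' Y' : choiceType) :=
  locked_with lock_key (@tmap K X Y X' Y').

Notation "x ⊗ y" := (ltens x y) : ring_scope.
Notation "\sw_ ( x , y <- t ) E" := (lsw t (fun x y => E)) : ring_scope.

Section Unlocking.

Variable K : fieldType.

Lemma tens_lock (X Y : choiceType) : @tens K X Y = @ltens K X Y.
Proof. by rewrite /ltens unlock. Qed.

Lemma sw_lock (X Y : choiceType) (W : lmodType K) :
  @sweedler K X Y W = @lsw K X Y W.
Proof. by rewrite /lsw unlock. Qed.

Lemma bmul_lock (X : choiceType) : @bmul K X = @lbmul K X.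
Proof. by rewrite /lbmul unlock. Qed.

Lemma dred_lock (X : choiceType) : @dred K X = @ldred K X.
Proof. by rewrite /ldred unlock. Qed.

Lemma tmap_lock (X Y X' Y' : choiceType) : @tmap K X Y X' Y' = @ltmap K X Y X' Y'.
Proof. by rewrite /ltmap unlock. Qed.

Lemma lbmulE (X : choiceType) (S : bidend_ops K X) a b :
  lbmul S a b = bprec S (a ⊗ b) + bsucc S (a ⊗ b).
Proof. by rewrite -bmul_lock /bmul !tens_lock. Qed.

Lemma ldredE (X : choiceType) (S : bidend_ops K X) a :
  ldred S a = dprec S a + dsucc S a.
Proof. by rewrite -dred_lock. Qed.

Lemma ltmapE (X Y X' Y' : choiceType) (f : {malg K[X]} -> {malg K[X']})
    (g : {malg K[Y]} -> {malg K[Y']}) (t : {malg K[(X * Y)%type]}) :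
  ltmap f g t = \sw_(x, y <- t) (f x ⊗ g y).
Proof. by rewrite -tmap_lock -sw_lock -tens_lock. Qed.

Lemma lswE (X Y : choiceType) (W : lmodType K) t
    (E : {malg K[X]} -> {malg K[Y]} -> W) :
  lsw t E = linext (fun p => E << p.1 >> << p.2 >>) t.
Proof. by rewrite -sw_lock. Qed.

End Unlocking.

(** * Linear and multilinear maps on spaces with a basis *)

Section LinearFunctions.

Variable K : fieldType.

Lemma lin_id (U : lmodType K) : linear (fun x : U => x).
Proof. by []. Qed.

Lemma lin_sum (U V : lmodType K) (f g : U -> V) :
  linear f -> linear g -> linear (fun x => f x + g x).
Proof. by move=> lf lg c x y; rewrite lf lg scalerDr addrACA. Qed.

Lemma lin_opp (U V : lmodType K) (f : U -> V) :
  linear f -> linear (fun x => - f x).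
Proof. by move=> lf c x y; rewrite lf opprD scalerN. Qed.

Lemma lin_scale (U V : lmodType K) (a : K) (f : U -> V) :
  linear f -> linear (fun x => a *: f x).
Proof. by move=> lf c x y; rewrite lf scalerDr !scalerA mulrC. Qed.

Lemma lin_const0 (U V : lmodType K) : linear (fun _ : U => 0 : V).
Proof. by move=> c x y; rewrite scaler0 addr0. Qed.

Lemma lin_app (U V W : lmodType K) (g : {linear V -> W}) (f : U -> V) :
  linear f -> linear (fun x => g (f x)).
Proof. by move=> lf c x y; rewrite lf linearP. Qed.

Lemma lin_bigsum (U V : lmodType K) (I : Type) (r : seq I) (P : pred I)
    (f : I -> U -> V) :
  (forall i, linear (f i)) -> linear (fun x => \sum_(i <- r | P i) f i x).
Proof.
move=> lf c x y; rewrite scaler_sumr -big_split /=.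
by apply: eq_bigr => i _; rewrite lf.
Qed.

Lemma lin0 (U V : lmodType K) (f : U -> V) : linear f -> f 0 = 0.
Proof. by move=> /(_ (-1) 0 0); rewrite scaler0 addr0 scaleN1r addNr. Qed.

Lemma linD (U V : lmodType K) (f : U -> V) x y :
  linear f -> f (x + y) = f x + f y.
Proof. by move=> /(_ 1 x y); rewrite !scale1r. Qed.

Lemma linZ (U V : lmodType K) (f : U -> V) c x :
  linear f -> f (c *: x) = c *: f x.
Proof. by move=> lf; rewrite -[c *: x]addr0 lf (lin0 lf) addr0. Qed.

Lemma linB (U V : lmodType K) (f : U -> V) x y :
  linear f -> f (x - y) = f x - f y.
Proof. by move=> lf; rewrite -scaleN1r addrC lf scaleN1r addrC. Qed.

Lemma lin_sumE (U V : lmodType K) (f : U -> V) (I : Type) (r : seq I)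
    (P : pred I) (F : I -> U) :
  linear f -> f (\sum_(i <- r | P i) F i) = \sum_(i <- r | P i) f (F i).
Proof.
move=> lf; elim/big_rec2: _ => [|i y z _ <-]; first exact: lin0.
by rewrite (linD _ _ lf).
Qed.

Definition bilinear_map (U V W : lmodType K) (E : U -> V -> W) : Prop :=
  (forall y, linear (fun x => E x y)) /\ (forall x, linear (E x)).

Definition trilinear_map (U V V' W : lmodType K) (E : U -> V -> V' -> W) : Prop :=
  [/\ forall y z, linear (fun x => E x y z), forall x z, linear (fun y => E x y z)
    & forall x y, linear (E x y)].

End LinearFunctions.

Section MalgLinear.

Variable K : fieldType.

Lemma linext_basis (X : choiceType) (x : {malg K[X]}) :
  linext (fun u => << u >> : {malg K[X]}) x = x.
Proof.
rewrite [RHS]monalgE; apply: eq_bigr => u _; apply/malgP => v.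
by rewrite mcoeffZ !mcoeffU mulr_natr.
Qed.

Lemma linear_linext (X : choiceType) (W : lmodType K) (f : {malg K[X]} -> W) :
  linear f -> forall x, f x = linext (fun u => f << u >>) x.
Proof.
move=> lf x; rewrite -{1}[x]linext_basis /linext (lin_sumE _ _ _ lf).
by apply: eq_bigr => u _; rewrite (linZ _ _ lf).
Qed.

Lemma eq_linext (X : choiceType) (W : lmodType K) (f g : X -> W) x :
  {in msupp x, f =1 g} -> linext f x = linext g x.
Proof.
move=> efg; rewrite /linext big_seq [RHS]big_seq.
by apply: eq_bigr => u /efg ->.
Qed.

Lemma eq_linear_on (X : choiceType) (W : lmodType K) (f g : {malg K[X]} -> W) x :
  linear f -> linear g -> (forall u, u \in msupp x -> f << u >> = g << u >>) ->
  f x = g x.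
Proof.
move=> lf lg efg; rewrite (linear_linext lf) (linear_linext lg).
exact: eq_linext.
Qed.

Lemma eq_linear (X : choiceType) (W : lmodType K) (f g : {malg K[X]} -> W) :
  linear f -> linear g -> (forall u, f << u >> = g << u >>) -> f =1 g.
Proof. by move=> lf lg efg x; apply: eq_linear_on. Qed.

Lemma eq_bilinear (X Y : choiceType) (W : lmodType K)
    (f g : {malg K[X]} -> {malg K[Y]} -> W) :
  bilinear_map f -> bilinear_map g ->
  (forall u v, f << u >> << v >> = g << u >> << v >>) ->
  forall x y, f x y = g x y.
Proof.
move=> [lf1 lf2] [lg1 lg2] efg x y.
by apply: (eq_linear (lf1 y) (lg1 y)) => u; apply: eq_linear.
Qed.

Lemma lin_linext (X : choiceType) (U W : lmodType K) (f : X -> W)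
    (g : U -> {malg K[X]}) : linear g -> linear (fun x => linext f (g x)).
Proof. exact: lin_app. Qed.

Lemma lin_linext_fun (X : choiceType) (U W : lmodType K) (f : U -> X -> W) x :
  (forall u, linear (fun z => f z u)) -> linear (fun z => linext (f z) x).
Proof. by move=> lf; apply: lin_bigsum => u; apply: lin_scale. Qed.

Lemma tensE (X Y : choiceType) (x : {malg K[X]}) (y : {malg K[Y]}) :
  x ⊗ y = linext (fun u => linext (fun v => << (u, v) >>) y) x.
Proof.
rewrite -tens_lock; apply: eq_bigr => u _; rewrite scaler_sumr; apply: eq_bigr => v _.
apply/malgP => p; rewrite !mcoeffZ !mcoeffU.
by case: eqP => _; rewrite ?mulr1n ?mulr0n ?mulr1 ?mulr0.
Qed.

Lemma tensUU (X Y : choiceType) (u : X) (v : Y) :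
  << u >> ⊗ << v >> = << (u, v) >> :> {malg K[(X * Y)%type]}.
Proof. by rewrite tensE !linextU. Qed.

Lemma tens_bilinear (X Y : choiceType) :
  bilinear_map (@ltens K X Y).
Proof.
split=> [y|x] c a b; rewrite !tensE; first by rewrite linearP.
apply: (@lin_linext_fun _ _ _ (fun z u => linext (fun v => << (u, v) >>) z) x).
by move=> u; apply: lin_linext; apply: lin_id.
Qed.

Lemma lin_tensl (X Y : choiceType) (U : lmodType K) (f : U -> {malg K[X]})
  (y : {malg K[Y]}) : linear f -> linear (fun x => f x ⊗ y).
Proof. by move=> lf c a b; rewrite lf (tens_bilinear X Y).1. Qed.

Lemma lin_tensr (X Y : choiceType) (U : lmodType K) (f : U -> {malg K[Y]})
  (x : {malg K[X]}) : linear f -> linear (fun y => x ⊗ f y).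
Proof. by move=> lf c a b; rewrite lf (tens_bilinear X Y).2. Qed.

Lemma lin_mull (M : monomType) (U : lmodType K) (f : U -> {malg K[M]})
  (y : {malg K[M]}) : linear f -> linear (fun x => f x * y).
Proof. by move=> lf c a b; rewrite lf mulrDl scalerAl. Qed.

Lemma malg_scalerAr (M : monomType) c (x y : {malg K[M]}) :
  x * (c *: y) = c *: (x * y).
Proof.
rewrite [in LHS](monalgE x) [in RHS](monalgE x) !mulr_suml scaler_sumr.
apply: eq_bigr => u _; rewrite (monalgE y) scaler_sumr !mulr_sumr scaler_sumr.
apply: eq_bigr => v _.
have scU a w : c *: << a *g w >> = << c * a *g w >> :> {malg K[M]}.
  by apply/malgP => z; rewrite mcoeffZ !mcoeffU; case: eqP; rewrite ?mulr1n ?mulr0n ?mulr0.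
by rewrite scU !malgM_def !fgmulUU scU mulrCA.
Qed.

Lemma lin_mulr (M : monomType) (U : lmodType K) (f : U -> {malg K[M]})
  (x : {malg K[M]}) : linear f -> linear (fun y => x * f y).
Proof. by move=> lf c a b; rewrite lf mulrDr malg_scalerAr. Qed.

Lemma lin_sw (X Y : choiceType) (U W : lmodType K)
    (f : U -> {malg K[(X * Y)%type]}) (E : {malg K[X]} -> {malg K[Y]} -> W) :
  linear f -> linear (fun z => lsw (f z) E).
Proof. by move=> lf; rewrite -sw_lock; apply: lin_linext. Qed.

Lemma lin_sw_fun (X Y : choiceType) (U W : lmodType K)
    (t : {malg K[(X * Y)%type]}) (E : U -> {malg K[X]} -> {malg K[Y]} -> W) :
  (forall x y, linear (fun z => E z x y)) ->
  linear (fun z => lsw t (E z)).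
Proof. move=> lE; rewrite -sw_lock /sweedler.
by apply: (@lin_linext_fun _ _ _ (fun z u => E z << u.1 >> << u.2 >>)) => u; apply: lE. Qed.

Lemma lin_bmull (X : choiceType) (S : bidend_ops K X) (U : lmodType K)
    (f : U -> {malg K[X]}) (y : {malg K[X]}) :
  linear f -> linear (fun x => lbmul S (f x) y).
Proof.
move=> lf c a b; rewrite !lbmulE; move: c a b.
by apply: lin_sum; apply: lin_app; apply: lin_tensl.
Qed.

Lemma lin_bmulr (X : choiceType) (S : bidend_ops K X) (U : lmodType K)
    (f : U -> {malg K[X]}) (x : {malg K[X]}) :
  linear f -> linear (fun y => lbmul S x (f y)).
Proof.
move=> lf c a b; rewrite !lbmulE; move: c a b.
by apply: lin_sum; apply: lin_app; apply: lin_tensr.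
Qed.

Lemma bmul0r (X : choiceType) (S : bidend_ops K X) x : lbmul S x 0 = 0.
Proof. by rewrite (lin0 (lin_bmulr S x (@lin_id K _))). Qed.

Lemma lin_dred (X : choiceType) (S : bidend_ops K X) (U : lmodType K)
    (f : U -> {malg K[X]}) : linear f -> linear (fun x => ldred S (f x)).
Proof.
move=> lf c a b; rewrite !ldredE; move: c a b.
by apply: lin_sum; apply: lin_app.
Qed.

End MalgLinear.

Ltac lin_step :=
  first [ assumption
        | exact: lin_id
        | exact: lin_const0
        | apply: lin_sum
        | apply: lin_opp
        | apply: lin_sw
        | apply: lin_sw_fun; move=> ? ?
        | apply: lin_tensl
        | apply: lin_tensr
        | apply: lin_mull
        | apply: lin_mulr
        | apply: lin_bmull
        | apply: lin_bmulr
        | apply: lin_dred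
        | apply: lin_scale
        | apply: lin_app ].
Ltac lin := repeat lin_step.
Ltac bilin := split=> ?; lin.
Ltac trilin := split=> ? ?; lin.

(** Identities in an abelian group of finitely supported functions: the maximal subterms that are
    neither sums nor opposites are generalized, and the rest is a ring identity between
    coefficients. *)
Ltac gen_atom gen e :=
  lazymatch e with
  | (?a + ?b)%R => first [gen_atom gen a | gen_atom gen b]
  | (- ?a)%R => gen_atom gen a
  | 0%R => fail
  | _ => tryif is_var e then fail else gen e
  end.
Ltac abel_with gen :=
  repeat match goal with |- ?a = ?b => first [gen_atom gen a | gen_atom gen b] end;
  apply/malgP => ?; rewrite ?(mcoeffD, mcoeffN, mcoeffB, mcoeff0); ring.
(* The second attempt also identifies atoms that are merely convertible, which *)
(* is slow.                                                                    *)
Ltac abel :=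
  first [ abel_with ltac:(fun e => let x := fresh "x" in generalize e => x)
        | abel_with ltac:(fun e => let x := fresh "x" in set x := e; clearbody x) ].

(** * Sweedler calculus *)

Section Sweedler.

Variable K : fieldType.
Implicit Types X Y : choiceType.

Lemma sw_basis X Y (W : lmodType K) (E : {malg K[X]} -> {malg K[Y]} -> W) u v :
  lsw << (u, v) >> E = E << u >> << v >>.
Proof. by rewrite lswE linextU. Qed.

Lemma sw_tens X Y (W : lmodType K) (E : {malg K[X]} -> {malg K[Y]} -> W) x y :
  bilinear_map E -> lsw (x ⊗ y) E = E x y.
Proof.
move=> bE; apply: (@eq_bilinear _ _ _ _ (fun x y => lsw (x ⊗ y) E) E _ bE).
  by bilin.
by move=> u v; rewrite tensUU sw_basis.
Qed.

Lemma sw_app X Y (V W : lmodType K) (f : V -> W)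
    (E : {malg K[X]} -> {malg K[Y]} -> V) t :
  linear f -> f (lsw t E) = lsw t (fun x y => f (E x y)).
Proof.
move=> lf; rewrite !lswE /linext (lin_sumE _ _ _ lf).
by apply: eq_bigr => u _; rewrite (linZ _ _ lf).
Qed.

Lemma sw_sw X Y (X' Y' : choiceType) (W : lmodType K)
    (G : {malg K[X]} -> {malg K[Y]} -> {malg K[(X' * Y')%type]})
    (E : {malg K[X']} -> {malg K[Y']} -> W) t :
  lsw (lsw t G) E = lsw t (fun x y => lsw (G x y) E).
Proof.
by rewrite (@sw_app _ _ _ _ (fun z => lsw z E)) //; lin.
Qed.

Lemma eq_sw_on X Y (W : lmodType K) (E F : {malg K[X]} -> {malg K[Y]} -> W) t :
  (forall u v, (u, v) \in msupp t -> E << u >> << v >> = F << u >> << v >>) ->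
  lsw t E = lsw t F.
Proof. by move=> eEF; rewrite !lswE; apply: eq_linext => -[u v] /= /eEF. Qed.

Lemma eq_sw X Y (W : lmodType K) (E F : {malg K[X]} -> {malg K[Y]} -> W) t :
  (forall x y, E x y = F x y) -> lsw t E = lsw t F.
Proof. by move=> eEF; apply: eq_sw_on. Qed.

Lemma sw_id X Y (t : {malg K[(X * Y)%type]}) : lsw t (fun x y => x ⊗ y) = t.
Proof.
rewrite -[RHS]linext_basis lswE; apply: eq_linext => -[u v] _ /=.
exact: tensUU.
Qed.

Lemma sw0l X Y (W : lmodType K) (E : {malg K[X]} -> {malg K[Y]} -> W) :
  lsw 0 E = 0.
Proof. by rewrite !lswE linear0. Qed.

Lemma swDl X Y (W : lmodType K) (E : {malg K[X]} -> {malg K[Y]} -> W) s t :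
  lsw (s + t) E = lsw s E + lsw t E.
Proof. by rewrite !lswE linearD. Qed.

Lemma sw0r X Y (W : lmodType K) (t : {malg K[(X * Y)%type]}) :
  lsw t (fun _ _ => 0 : W) = 0.
Proof. by rewrite !lswE /linext big1 // => u _; rewrite scaler0. Qed.

Lemma sw_eq0 X Y (W : lmodType K) (E : {malg K[X]} -> {malg K[Y]} -> W) t :
  (forall u v, (u, v) \in msupp t -> E << u >> << v >> = 0) -> lsw t E = 0.
Proof. by move=> E0; rewrite -[RHS](sw0r _ t); apply: eq_sw_on. Qed.

Lemma swDr X Y (W : lmodType K) (E F : {malg K[X]} -> {malg K[Y]} -> W) t :
  lsw t (fun x y => E x y + F x y) = lsw t E + lsw t F.
Proof.
rewrite !lswE /linext -big_split /=.
by apply: eq_bigr => u _; rewrite scalerDr.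
Qed.

Lemma swNr X Y (W : lmodType K) (E : {malg K[X]} -> {malg K[Y]} -> W) t :
  lsw t (fun x y => - E x y) = - lsw t E.
Proof.
by rewrite !lswE /linext -sumrN; apply: eq_bigr => u _; rewrite scalerN.
Qed.

Lemma swBr X Y (W : lmodType K) (E F : {malg K[X]} -> {malg K[Y]} -> W) t :
  lsw t (fun x y => E x y - F x y) = lsw t E - lsw t F.
Proof. by rewrite swDr swNr. Qed.

Lemma sw_bigsum X Y (W : lmodType K) (I : Type) (r : seq I) (P : pred I)
    (F : I -> {malg K[(X * Y)%type]}) (E : {malg K[X]} -> {malg K[Y]} -> W) :
  lsw (\sum_(i <- r | P i) F i) E = \sum_(i <- r | P i) lsw (F i) E.
Proof. by rewrite lswE linear_sum; apply: eq_bigr => i _; rewrite lswE. Qed.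

Lemma tens0l X Y (y : {malg K[Y]}) : (0 : {malg K[X]}) ⊗ y = 0.
Proof. by rewrite tensE linear0. Qed.

Lemma tens0r X Y (x : {malg K[X]}) : x ⊗ (0 : {malg K[Y]}) = 0.
Proof. exact: (lin0 (@lin_tensr K X Y _ _ x (@lin_id K _))). Qed.

Lemma tensDl X Y (x x' : {malg K[X]}) (y : {malg K[Y]}) :
  (x + x') ⊗ y = x ⊗ y + x' ⊗ y.
Proof. exact: (linD _ _ (@lin_tensl K X Y _ _ y (@lin_id K _))). Qed.

Lemma tensDr X Y (x : {malg K[X]}) (y y' : {malg K[Y]}) :
  x ⊗ (y + y') = x ⊗ y + x ⊗ y'.
Proof. exact: (linD _ _ (@lin_tensr K X Y _ _ x (@lin_id K _))). Qed.

Lemma tensBl X Y (x x' : {malg K[X]}) (y : {malg K[Y]}) :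
  (x - x') ⊗ y = x ⊗ y - x' ⊗ y.
Proof. exact: (linB _ _ (@lin_tensl K X Y _ _ y (@lin_id K _))). Qed.

Lemma tensBr X Y (x : {malg K[X]}) (y y' : {malg K[Y]}) :
  x ⊗ (y - y') = x ⊗ y - x ⊗ y'.
Proof. exact: (linB _ _ (@lin_tensr K X Y _ _ x (@lin_id K _))). Qed.

Lemma sw_tmap X Y (X' Y' : choiceType) (W : lmodType K)
    (f : {malg K[X]} -> {malg K[X']}) (g : {malg K[Y]} -> {malg K[Y']})
    (E : {malg K[X']} -> {malg K[Y']} -> W) t :
  bilinear_map E ->
  lsw (ltmap f g t) E = lsw t (fun x y => E (f x) (g y)).
Proof. by move=> bE; rewrite ltmapE sw_sw; apply: eq_sw => x y; rewrite sw_tens. Qed.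

Lemma lin_tmap X Y (X' Y' : choiceType) (U : lmodType K)
    (f : {malg K[X]} -> {malg K[X']}) (g : {malg K[Y]} -> {malg K[Y']})
    (h : U -> {malg K[(X * Y)%type]}) :
  linear h -> linear (fun z => ltmap f g (h z)).
Proof. by move=> lh c x y; rewrite !ltmapE lh swDl; congr (_ + _); rewrite !lswE linearZ. Qed.

End Sweedler.

(** * The bidendriform axioms as rewriting rules *)

Section Coassociativity.

Variables (K : fieldType) (X : choiceType) (T : bidend_ops K X).
Hypothesis TC : dendriform_coalgebra T.

Local Notation Dp := (dprec T).
Local Notation Ds := (dsucc T).
Local Notation Dt := (ldred T).

Section Trilinear.

Variables (W : lmodType K).
Variable H : {malg K[X]} -> {malg K[X]} -> {malg K[X]} -> W.
Hypothesis triH : trilinear_map H.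

Let G (t : {malg K[(X * (X * X))%type]}) : W :=
  \sw_(x, w <- t) \sw_(y, z <- w) H x y z.

Let lG : linear G. Proof. by rewrite /G; lin. Qed.

Let bilH x : bilinear_map (H x).
Proof. by split=> y; [apply: (let: And3 _ h _ := triH in h) | case: triH]. Qed.

Let G_tens x w : G (x ⊗ w) = \sw_(y, z <- w) H x y z.
Proof.
rewrite /G sw_tens //; split=> ?; last by lin.
by apply: lin_sw_fun => y z; case: triH.
Qed.

Let G_left t (F : {malg K[X]} -> {malg K[(X * X)%type]}) :
  G (\sw_(a1, a2 <- t) \sw_(x, y <- F a1) (x ⊗ (y ⊗ a2))) =
  \sw_(a1, a2 <- t) \sw_(x, y <- F a1) H x y a2.
Proof.
rewrite (sw_app _ _ lG); apply: eq_sw => a1 a2.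
rewrite (sw_app _ _ lG); apply: eq_sw => x y.
by rewrite G_tens sw_tens.
Qed.

Let G_right t (F : {malg K[X]} -> {malg K[(X * X)%type]}) :
  G (\sw_(a1, a2 <- t) (a1 ⊗ F a2)) = \sw_(a1, a2 <- t) \sw_(y, z <- F a2) H a1 y z.
Proof. by rewrite (sw_app _ _ lG); apply: eq_sw => a1 a2; rewrite G_tens. Qed.

(** The axiom is an equation in the triple tensor product; applying to it the linear map [G] induced
    by the trilinear [H] makes it usable under any trilinear expression. The next two lemmas do the
    same for the other axioms. *)
Lemma coassoc_prec a :
  \sw_(a1, a2 <- Dp a) \sw_(x, y <- Dp a1) H x y a2 =
  \sw_(a1, a2 <- Dp a) \sw_(y, z <- Dt a2) H a1 y z.
Proof. by case: (TC a); rewrite !sw_lock !tens_lock ?dred_lock => /(congr1 G); rewrite G_left G_right. Qed.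

Lemma coassoc_mid a :
  \sw_(a1, a2 <- Dp a) \sw_(x, y <- Ds a1) H x y a2 =
  \sw_(a1, a2 <- Ds a) \sw_(y, z <- Dp a2) H a1 y z.
Proof. by case: (TC a); rewrite !sw_lock !tens_lock ?dred_lock => _ /(congr1 G); rewrite G_left G_right. Qed.

Lemma coassoc_succ a :
  \sw_(a1, a2 <- Ds a) \sw_(x, y <- Dt a1) H x y a2 =
  \sw_(a1, a2 <- Ds a) \sw_(y, z <- Ds a2) H a1 y z.
Proof. by case: (TC a); rewrite !sw_lock !tens_lock ?dred_lock => _ _ /(congr1 G); rewrite G_left G_right. Qed.

End Trilinear.

End Coassociativity.

Section Dendriform.

Variables (K : fieldType) (X : choiceType) (S : bidend_ops K X).
Hypothesis SD : dendriform_algebra S.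

Local Notation "a ≺ b" := (bprec S (a ⊗ b)).
Local Notation "a ≻ b" := (bsucc S (a ⊗ b)).
Local Notation "a ⋅ b" := (lbmul S a b).

Lemma dend_precA a b c : (a ≺ b) ≺ c = a ≺ (b ⋅ c).
Proof. by case: (SD a b c); rewrite !tens_lock lbmulE. Qed.

Lemma dend_midA a b c : (a ≻ b) ≺ c = a ≻ (b ≺ c).
Proof. by case: (SD a b c); rewrite !tens_lock. Qed.

Lemma dend_succA a b c : (a ⋅ b) ≻ c = a ≻ (b ≻ c).
Proof. by case: (SD a b c); rewrite !tens_lock lbmulE. Qed.

Lemma bmulA a b c : (a ⋅ b) ⋅ c = a ⋅ (b ⋅ c).
Proof.
rewrite [LHS]lbmulE dend_succA [a ⋅ b]lbmulE tensDl linearD /= dend_precA dend_midA.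
by rewrite -addrA -linearD /= -tensDr -lbmulE -lbmulE.
Qed.

(** This comes from the last two dendriform axioms. It is the source of the correction term (a ≺
    b'') ≻ P(b') in P(a ≻ b). *)
Lemma bmul_succl a b c : (a ≻ b) ⋅ c = a ≻ (b ⋅ c) - (a ≺ b) ≻ c.
Proof.
rewrite [LHS]lbmulE dend_midA [b ⋅ c]lbmulE tensDr linearD /= -dend_succA.
by rewrite [a ⋅ b]lbmulE tensDl linearD /=; abel.
Qed.

Lemma bmul_precE a b : a ≺ b = a ⋅ b - a ≻ b.
Proof. by rewrite lbmulE addrK. Qed.

End Dendriform.

Section MulCoproduct.

Variables (K : fieldType) (X : choiceType) (T : bidend_ops K X).
Hypothesis TC : bidendriform_compat T.

Local Notation "a ≺ b" := (bprec T (a ⊗ b)).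
Local Notation "a ≻ b" := (bsucc T (a ⊗ b)).
Local Notation "a ⋅ b" := (lbmul T a b).
Local Notation Dp := (dprec T).
Local Notation Ds := (dsucc T).
Local Notation Dt := (ldred T).

Lemma compat_locked a b :
    [/\ Ds (a ≻ b) =
            \sw_(a1, a2 <- Dt a) \sw_(b1, b2 <- Ds b) ((a1 ⋅ b1) ⊗ (a2 ≻ b2))
          + \sw_(a1, a2 <- Dt a) (a1 ⊗ (a2 ≻ b))
          + \sw_(b1, b2 <- Ds b) (b1 ⊗ (a ≻ b2))
          + \sw_(b1, b2 <- Ds b) ((a ⋅ b1) ⊗ b2)
          + a ⊗ b,
        Ds (a ≺ b) =
            \sw_(a1, a2 <- Dt a) \sw_(b1, b2 <- Ds b) ((a1 ⋅ b1) ⊗ (a2 ≺ b2))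
          + \sw_(a1, a2 <- Dt a) (a1 ⊗ (a2 ≺ b))
          + \sw_(b1, b2 <- Ds b) (b1 ⊗ (a ≺ b2)),
        Dp (a ≻ b) =
            \sw_(a1, a2 <- Dt a) \sw_(b1, b2 <- Dp b) ((a1 ⋅ b1) ⊗ (a2 ≻ b2))
          + \sw_(b1, b2 <- Dp b) ((a ⋅ b1) ⊗ b2)
          + \sw_(b1, b2 <- Dp b) (b1 ⊗ (a ≻ b2))
      & Dp (a ≺ b) =
            \sw_(a1, a2 <- Dt a) \sw_(b1, b2 <- Dp b) ((a1 ⋅ b1) ⊗ (a2 ≺ b2))
          + \sw_(a1, a2 <- Dt a) ((a1 ⋅ b) ⊗ a2)
          + \sw_(b1, b2 <- Dp b) (b1 ⊗ (a ≺ b2))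
          + b ⊗ a].
Proof. by have := TC a b; rewrite !sw_lock !tens_lock !bmul_lock !dred_lock. Qed.

Lemma tens_mulr (x a b : {malg K[X]}) : x ⊗ (a ⋅ b) = x ⊗ (a ≺ b) + x ⊗ (a ≻ b).
Proof. by rewrite lbmulE tensDr. Qed.

Lemma sw_mulr (t s : {malg K[(X * X)%type]}) :
  \sw_(a1, a2 <- t) \sw_(b1, b2 <- s) ((a1 ⋅ b1) ⊗ (a2 ⋅ b2)) =
  \sw_(a1, a2 <- t) \sw_(b1, b2 <- s) ((a1 ⋅ b1) ⊗ (a2 ≺ b2)) +
  \sw_(a1, a2 <- t) \sw_(b1, b2 <- s) ((a1 ⋅ b1) ⊗ (a2 ≻ b2)).
Proof.
rewrite -swDr; apply: eq_sw => a1 a2; rewrite -swDr; apply: eq_sw => b1 b2.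
by rewrite tens_mulr.
Qed.

(** Adding the compatibilities for ≺ and ≻ merges the two half products into the associative product
    on the right factors. [dsucc_mul] and [dred_mul] follow the same pattern. *)
Lemma dprec_mul a b :
  Dp (a ⋅ b) =
    \sw_(a1, a2 <- Dt a) \sw_(b1, b2 <- Dp b) ((a1 ⋅ b1) ⊗ (a2 ⋅ b2))
  + \sw_(b1, b2 <- Dp b) ((a ⋅ b1) ⊗ b2)
  + \sw_(b1, b2 <- Dp b) (b1 ⊗ (a ⋅ b2))
  + \sw_(a1, a2 <- Dt a) ((a1 ⋅ b) ⊗ a2)
  + b ⊗ a.
Proof.
case: (compat_locked a b) => _ _ hs hp; rewrite lbmulE linearD /= hs hp.
rewrite sw_mulr.
have -> : \sw_(b1, b2 <- Dp b) (b1 ⊗ (a ⋅ b2)) =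
   \sw_(b1, b2 <- Dp b) (b1 ⊗ (a ≺ b2)) + \sw_(b1, b2 <- Dp b) (b1 ⊗ (a ≻ b2)).
  by rewrite -swDr; apply: eq_sw => *; rewrite tens_mulr.
by abel.
Qed.

Lemma dsucc_mul a b :
  Ds (a ⋅ b) =
    \sw_(a1, a2 <- Dt a) \sw_(b1, b2 <- Ds b) ((a1 ⋅ b1) ⊗ (a2 ⋅ b2))
  + \sw_(b1, b2 <- Ds b) ((a ⋅ b1) ⊗ b2)
  + \sw_(b1, b2 <- Ds b) (b1 ⊗ (a ⋅ b2))
  + \sw_(a1, a2 <- Dt a) (a1 ⊗ (a2 ⋅ b))
  + a ⊗ b.
Proof.
case: (compat_locked a b) => hs hp _ _; rewrite lbmulE linearD /= hs hp.
rewrite sw_mulr.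
have -> : \sw_(b1, b2 <- Ds b) (b1 ⊗ (a ⋅ b2)) =
   \sw_(b1, b2 <- Ds b) (b1 ⊗ (a ≺ b2)) + \sw_(b1, b2 <- Ds b) (b1 ⊗ (a ≻ b2)).
  by rewrite -swDr; apply: eq_sw => *; rewrite tens_mulr.
have -> : \sw_(a1, a2 <- Dt a) (a1 ⊗ (a2 ⋅ b)) =
   \sw_(a1, a2 <- Dt a) (a1 ⊗ (a2 ≺ b)) + \sw_(a1, a2 <- Dt a) (a1 ⊗ (a2 ≻ b)).
  by rewrite -swDr; apply: eq_sw => *; rewrite tens_mulr.
by abel.
Qed.

Lemma dred_mul a b :
  Dt (a ⋅ b) =
    \sw_(a1, a2 <- Dt a) \sw_(b1, b2 <- Dt b) ((a1 ⋅ b1) ⊗ (a2 ⋅ b2))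
  + \sw_(b1, b2 <- Dt b) ((a ⋅ b1) ⊗ b2)
  + \sw_(b1, b2 <- Dt b) (b1 ⊗ (a ⋅ b2))
  + \sw_(a1, a2 <- Dt a) (a1 ⊗ (a2 ⋅ b))
  + \sw_(a1, a2 <- Dt a) ((a1 ⋅ b) ⊗ a2)
  + a ⊗ b + b ⊗ a.
Proof.
rewrite ldredE dprec_mul dsucc_mul.
have -> : \sw_(a1, a2 <- Dt a) \sw_(b1, b2 <- Dt b) ((a1 ⋅ b1) ⊗ (a2 ⋅ b2)) =
   \sw_(a1, a2 <- Dt a) \sw_(b1, b2 <- Dp b) ((a1 ⋅ b1) ⊗ (a2 ⋅ b2)) +
   \sw_(a1, a2 <- Dt a) \sw_(b1, b2 <- Ds b) ((a1 ⋅ b1) ⊗ (a2 ⋅ b2)).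
  by rewrite -swDr; apply: eq_sw => *; rewrite -swDl -ldredE.
have -> : \sw_(b1, b2 <- Dt b) (b1 ⊗ (a ⋅ b2)) =
   \sw_(b1, b2 <- Dp b) (b1 ⊗ (a ⋅ b2)) + \sw_(b1, b2 <- Ds b) (b1 ⊗ (a ⋅ b2)).
  by rewrite -swDl -ldredE.
have -> : \sw_(b1, b2 <- Dt b) ((a ⋅ b1) ⊗ b2) =
   \sw_(b1, b2 <- Dp b) ((a ⋅ b1) ⊗ b2) + \sw_(b1, b2 <- Ds b) ((a ⋅ b1) ⊗ b2).
  by rewrite -swDl -ldredE.
by abel.
Qed.

End MulCoproduct.

(** * Graded bidendriform bialgebras *)

(** Recursion on the degree without a well-founded order: [F n] is correct on all elements of degree
    below n, and the default [w0] is reached only when the fuel is exhausted. *)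
Lemma degree_recursion (X W : Type) (deg : X -> nat) (w0 : W)
    (G : X -> (X -> W) -> W) :
  (forall u f g, (forall v, (deg v < deg u)%N -> f v = g v) -> G u f = G u g) ->
  exists f, forall u, f u = G u f.
Proof.
move=> Gext; pose F := fix F n := if n is n'.+1 then fun u => G u (F n') else fun _ => w0.
have Fstable n m u : (deg u < n)%N -> (deg u < m)%N -> F n u = F m u.
  elim: n m u => [//|n IHn] [//|m] u /= un um.
  by apply: Gext => v vu; apply: IHn; apply: leq_trans vu _.
exists (fun u => F (deg u).+1 u) => u; rewrite [LHS]/=.
by apply: Gext => v vu; apply: Fstable.
Qed.

Section Homogeneous.

Variable K : fieldType.
Implicit Types X Y : choiceType.

Lemma hom0 X (d : X -> nat) n : homogeneous d n (0 : {malg K[X]}).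
Proof. by move=> u; rewrite msupp0 inE. Qed.

Lemma homD X (d : X -> nat) n (x y : {malg K[X]}) :
  homogeneous d n x -> homogeneous d n y -> homogeneous d n (x + y).
Proof.
move=> hx hy u /(fsubsetP (msuppD_le x y)); rewrite inE => /orP[].
- exact: hx.
- exact: hy.
Qed.

Lemma homZ X (d : X -> nat) n c (x : {malg K[X]}) :
  homogeneous d n x -> homogeneous d n (c *: x).
Proof. by move=> hx u /(fsubsetP (msuppZ_le c x)) /hx. Qed.

Lemma homB X (d : X -> nat) n (x y : {malg K[X]}) :
  homogeneous d n x -> homogeneous d n y -> homogeneous d n (x - y).
Proof. by move=> hx hy; apply: homD; rewrite -?scaleN1r //; apply: homZ. Qed.

Lemma homU X (d : X -> nat) u : homogeneous d (d u) (<< u >> : {malg K[X]}).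
Proof. by move=> v; rewrite msuppU oner_eq0 inE => /eqP ->. Qed.

Lemma hom_bigsum X (d : X -> nat) n (I : eqType) (r : seq I) (P : pred I)
    (F : I -> {malg K[X]}) :
  (forall i, i \in r -> P i -> homogeneous d n (F i)) ->
  homogeneous d n (\sum_(i <- r | P i) F i).
Proof.
move=> hF; rewrite big_seq_cond.
elim/big_rec: _ => [|i y /andP[ir Pi] hy]; first exact: hom0.
by apply: homD => //; apply: hF.
Qed.

Lemma hom_linear X Y (d : X -> nat) (e : Y -> nat) n m
    (f : {malg K[X]} -> {malg K[Y]}) x :
  linear f -> homogeneous d n x ->
  (forall u, d u = n -> homogeneous e m (f << u >>)) -> homogeneous e m (f x).
Proof.
move=> lf hx hf; rewrite (linear_linext lf); apply: hom_bigsum => u ux _.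
by apply: homZ; apply: hf; apply: hx.
Qed.

Definition pair_deg X Y (d : X -> nat) (e : Y -> nat) (p : X * Y) : nat :=
  (d p.1 + e p.2)%N.

Lemma hom_tens X Y (d : X -> nat) (e : Y -> nat) n m x y :
  homogeneous d n x -> homogeneous e m y ->
  homogeneous (pair_deg d e) (n + m) (x ⊗ y : {malg K[(X * Y)%type]}).
Proof.
move=> hx hy; apply: (hom_linear (f := fun x => x ⊗ y) _ hx); first by lin.
move=> u <-; apply: (hom_linear (f := fun y => << u >> ⊗ y) _ hy); first by lin.
by move=> v <-; rewrite tensUU; apply: homU.
Qed.

End Homogeneous.

Definition graded_ops (K : fieldType) (X : choiceType) (d : X -> nat)
    (T : bidend_ops K X) : Prop :=
  [/\ forall p, homogeneous d (pair_deg d d p) (bprec T << p >>),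
      forall p, homogeneous d (pair_deg d d p) (bsucc T << p >>),
      forall u, homogeneous (pair_deg d d) (d u) (dprec T << u >>)
    & forall u, homogeneous (pair_deg d d) (d u) (dsucc T << u >>)].

Section GradedOps.

Variables (K : fieldType) (X : choiceType) (d : X -> nat) (T : bidend_ops K X).
Hypothesis gT : graded_ops d T.

Lemma hom_bprec n m a b :
  homogeneous d n a -> homogeneous d m b -> homogeneous d (n + m) (bprec T (a ⊗ b)).
Proof.
move=> ha hb; apply: (hom_linear _ (hom_tens ha hb)); first exact: linearP.
by case: gT => h _ _ _ p <-.
Qed.

Lemma hom_bsucc n m a b :
  homogeneous d n a -> homogeneous d m b -> homogeneous d (n + m) (bsucc T (a ⊗ b)).
Proof.
move=> ha hb; apply: (hom_linear _ (hom_tens ha hb)); first exact: linearP.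
by case: gT => _ h _ _ p <-.
Qed.

Lemma hom_bmul n m a b :
  homogeneous d n a -> homogeneous d m b -> homogeneous d (n + m) (lbmul T a b).
Proof. by move=> ha hb; rewrite lbmulE; apply: homD; [apply: hom_bprec | apply: hom_bsucc]. Qed.

Lemma hom_dprec n a : homogeneous d n a -> homogeneous (pair_deg d d) n (dprec T a).
Proof.
move=> ha; apply: (hom_linear _ ha); first exact: linearP.
by case: gT => _ _ h _ u <-.
Qed.

Lemma hom_dsucc n a : homogeneous d n a -> homogeneous (pair_deg d d) n (dsucc T a).
Proof.
move=> ha; apply: (hom_linear _ ha); first exact: linearP.
by case: gT => _ _ _ h u <-.
Qed.

Lemma hom_dred n a : homogeneous d n a -> homogeneous (pair_deg d d) n (ldred T a).
Proof. by move=> ha; rewrite ldredE; apply: homD; [apply: hom_dprec | apply: hom_dsucc]. Qed.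

End GradedOps.

Section SweedlerTens.

Variable K : fieldType.

Lemma sw_sw_tens (X Y X' Y' : choiceType) (W : lmodType K)
    (f : {malg K[X]} -> {malg K[Y]} -> {malg K[X']})
    (g : {malg K[X]} -> {malg K[Y]} -> {malg K[Y']})
    (E : {malg K[X']} -> {malg K[Y']} -> W) t :
  bilinear_map E ->
  lsw (\sw_(x, y <- t) (f x y ⊗ g x y)) E = \sw_(x, y <- t) E (f x y) (g x y).
Proof. by move=> bE; rewrite sw_sw; apply: eq_sw => x y; rewrite sw_tens. Qed.

Lemma sw_sw_tens2 (X Y X' Y' X'' Y'' : choiceType) (W : lmodType K)
    (f : {malg K[X]} -> {malg K[Y]} -> {malg K[X']} -> {malg K[Y']} -> {malg K[X'']})
    (g : {malg K[X]} -> {malg K[Y]} -> {malg K[X']} -> {malg K[Y']} -> {malg K[Y'']})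
    (E : {malg K[X'']} -> {malg K[Y'']} -> W) t s :
  bilinear_map E ->
  lsw (\sw_(x, y <- t) \sw_(z, w <- s) (f x y z w ⊗ g x y z w)) E =
  \sw_(x, y <- t) \sw_(z, w <- s) E (f x y z w) (g x y z w).
Proof. by move=> bE; rewrite sw_sw; apply: eq_sw => x y; rewrite sw_sw_tens. Qed.

Lemma sw_sw0 (X Y X' Y' : choiceType) (W : lmodType K)
    (E : {malg K[X]} -> {malg K[Y]} -> {malg K[X']} -> {malg K[Y']} -> W) t :
  lsw t (fun x y => lsw 0 (E x y)) = 0.
Proof. by apply: sw_eq0 => u v _; rewrite sw0l. Qed.

End SweedlerTens.

Section Vanishing.

Variables (K : fieldType) (X : choiceType) (T : bidend_ops K X).
Hypothesis TC : bidendriform_compat T.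

Local Notation "a ≺ b" := (bprec T (a ⊗ b)).
Local Notation "a ≻ b" := (bsucc T (a ⊗ b)).
Local Notation "a ⋅ b" := (lbmul T a b).
Local Notation Dp := (dprec T).
Local Notation Ds := (dsucc T).
Local Notation Dt := (ldred T).

Lemma dprec_mul0 a b : Dp b = 0 ->
  Dp (a ⋅ b) = \sw_(a1, a2 <- Dt a) ((a1 ⋅ b) ⊗ a2) + b ⊗ a.
Proof.
move=> b0; rewrite dprec_mul // b0 !sw0l !addr0.
by rewrite sw_sw0 add0r.
Qed.

Lemma dprec_succ0 a b : Dp b = 0 -> Dp (a ≻ b) = 0.
Proof.
move=> b0; case: (compat_locked TC a b) => _ _ -> _; rewrite b0 !sw0l !addr0.
by rewrite sw_sw0.
Qed.

Lemma dsucc_succ0 a b : Ds b = 0 ->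
  Ds (a ≻ b) = \sw_(a1, a2 <- Dt a) (a1 ⊗ (a2 ≻ b)) + a ⊗ b.
Proof.
move=> b0; case: (compat_locked TC a b) => -> _ _ _; rewrite b0 !sw0l !addr0.
by rewrite sw_sw0 add0r.
Qed.

End Vanishing.

(** * Projections onto the elements killed by Δ≺ and onto the totally primitive elements *)

Section Projections.

Variables (K : fieldType) (X : choiceType) (d : X -> nat) (T : bidend_ops K X).
Hypothesis TB : bidendriform_bialgebra T.
Hypothesis gT : graded_ops d T.
Hypothesis d_gt0 : forall u, (0 < d u)%N.

Local Notation "a ≺ b" := (bprec T (a ⊗ b)).
Local Notation "a ≻ b" := (bsucc T (a ⊗ b)).
Local Notation "a ⋅ b" := (lbmul T a b).
Local Notation Dp := (dprec T).
Local Notation Ds := (dsucc T).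
Local Notation Dt := (ldred T).

Let TD : dendriform_algebra T. Proof. by case: TB. Qed.
Let TC : dendriform_coalgebra T. Proof. by case: TB. Qed.
Let TM : bidendriform_compat T. Proof. by case: TB. Qed.

(** Degrees are positive, so both factors of a homogeneous tensor have strictly smaller degree.
    Every recursion and induction on the degree below rests on this. *)
Lemma pair_deg_lt n (t : {malg K[(X * X)%type]}) u v :
  homogeneous (pair_deg d d) n t -> (u, v) \in msupp t ->
  [/\ d u < n, d v < n & d u + d v = n]%N.
Proof.
move=> ht /ht; rewrite /pair_deg /= => <-.
by have := d_gt0 u; have := d_gt0 v; split=> //; lia.
Qed.

Lemma exists_proj_dprec : exists P : {linear {malg K[X]} -> {malg K[X]}},
  forall a, P a = a - \sw_(x, y <- Dp a) (y ⋅ P x).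
Proof.
have [u f g efg|f fE] := @degree_recursion X {malg K[X]} d 0
    (fun u f => << u >> - \sw_(x, y <- Dp << u >>) (y ⋅ linext f x)).
  congr (_ - _); apply: eq_sw_on => v w /(pair_deg_lt (hom_dprec gT (@homU _ _ _ _)))[vu _ _].
  by rewrite !linextU efg.
exists (linext f); apply: eq_linear; [by lin|by lin|].
by move=> u; rewrite [LHS]linextU fE.
Qed.

Section ProjDprec.

Variable P : {linear {malg K[X]} -> {malg K[X]}}.
Hypothesis PE : forall a, P a = a - \sw_(x, y <- Dp a) (y ⋅ P x).

Lemma proj_dprec_id a : Dp a = 0 -> P a = a.
Proof. by move=> a0; rewrite PE a0 sw0l subr0. Qed.

Lemma hom_proj_dprec n a : homogeneous d n a -> homogeneous d n (P a).
Proof.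
move=> ha; apply: (hom_linear _ ha); first exact: linearP.
move=> u; move: n {ha} => m; elim/ltn_ind: m u => m IH u um.
rewrite PE; apply: homB; first by rewrite -um; apply: homU.
rewrite -um; apply: (hom_linear (f := fun z => \sw_(x, y <- z) (y ⋅ P x))
   _ (hom_dprec gT (@homU _ _ _ _))); first by lin.
move=> [v w] /= vw; rewrite sw_basis -vw [pair_deg _ _ _]addnC.
apply: (hom_bmul gT); first exact: homU.
apply: IH => //; have := d_gt0 w; move: vw; rewrite /pair_deg /=; lia.
Qed.

(** By induction Δ≺(P(a')) = 0, so Δ≺(a''P(a')) consists of the cut of a'' and of the term P(a') ⊗
    a''. Coassociativity moves the cut of a'' over to a', where the definition of P makes everything
    cancel. *)
Lemma dprec_proj a : Dp (P a) = 0.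
Proof.
apply: (eq_linear (f := fun a => Dp (P a)) (g := fun=> 0)); [by lin|by lin|].
move=> u; have [m] := ubnP (d u); elim: m u => // m IH u um.
have hu := hom_dprec gT (@homU K X d u).
rewrite PE linearB /= (sw_app _ _ (@linearP _ _ _ _ _)).
rewrite (eq_sw_on (F := fun x y => \sw_(y1, y2 <- Dt y) ((y1 ⋅ P x) ⊗ y2) + P x ⊗ y)).
  (* The cut of the right factor becomes a second Δ≺ of the left factor x, where it contributes x -
     P(x). *)
  rewrite swDr -(@coassoc_prec _ _ _ TC _ (fun x y z => (y ⋅ P x) ⊗ z)); last by trilin.
  rewrite -{1}[Dp << u >>]sw_id -swDr -swBr.
  rewrite (eq_sw (F := fun _ _ => 0)) ?sw0r // => x y.
  rewrite [in X in _ - X]PE tensBl (sw_app (f := fun x => x ⊗ y)); last by lin.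
  by abel.
move=> x y /(pair_deg_lt hu)[xu _ _]; apply: dprec_mul0 => //.
by apply: IH; apply: leq_trans xu _.
Qed.

(** Of the five terms of Δ≺(ab), those whose left factor is a product contribute nothing, by
    induction. The terms b' ⊗ ab'' and b ⊗ a contribute a(b''P(b')) and aP(b), with sum ab by the
    definition of P(b). *)
Lemma proj_dprec_mul a b : P (a ⋅ b) = 0.
Proof.
apply: (eq_bilinear (f := fun a b => P (a ⋅ b)) (g := fun _ _ => 0)).
- by bilin.
- by bilin.
move=> u v; have [m] := ubnP (d u + d v); elim: m u v => // m IH u v uvm.
have hu := hom_dred gT (@homU K X d u).
have hv := hom_dprec gT (@homU K X d v).
have bE : bilinear_map (fun x y => y ⋅ P x) by bilin.
rewrite PE dprec_mul // !swDl sw_sw_tens2 // !sw_sw_tens // sw_tens //.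
rewrite [X in _ - (X + _ + _ + _ + _)]sw_eq0; last first.
  move=> x y /(pair_deg_lt hu)[xu _ _]; apply: sw_eq0 => z w /(pair_deg_lt hv)[zv _ _].
  by rewrite IH ?bmul0r //; lia.
rewrite [X in _ - (_ + X + _ + _ + _)]sw_eq0; last first.
  by move=> x y /(pair_deg_lt hv)[xv _ _]; rewrite IH ?bmul0r //; lia.
rewrite [X in _ - (_ + _ + _ + X + _)]sw_eq0; last first.
  by move=> x y /(pair_deg_lt hu)[xu _ _]; rewrite IH ?bmul0r //; lia.
rewrite !add0r addr0 (eq_sw (F := fun x y => << u >> ⋅ (y ⋅ P x))); last first.
  by move=> x y; rewrite bmulA.
rewrite -(sw_app (f := fun y => << u >> ⋅ y)); last by lin.
rewrite -(linD _ _ (f := fun y => << u >> ⋅ y)); last by lin.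
by rewrite [P << v >>]PE addrCA subrr addr0 subrr.
Qed.

(** Among the terms of Δ≺(a ≻ b) only b' ⊗ (a ≻ b'') survives, the other left factors being products
    killed by P; [bmul_succl] then splits (a ≻ b'')P(b'). *)
Lemma proj_dprec_succ a b :
  P (a ≻ b) = a ≻ P b + \sw_(b1, b2 <- Dp b) ((a ≺ b2) ≻ P b1).
Proof.
have bE : bilinear_map (fun x y => y ⋅ P x) by bilin.
rewrite PE; case: (compat_locked TM a b) => _ _ -> _.
rewrite !swDl sw_sw_tens2 // !sw_sw_tens //.
rewrite [X in _ - (X + _ + _)]sw_eq0; last first.
  by move=> x y _; apply: sw_eq0 => z w _; rewrite proj_dprec_mul bmul0r.
rewrite [X in _ - (_ + X + _)]sw_eq0; last first.
  by move=> x y _; rewrite proj_dprec_mul bmul0r.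
rewrite !add0r (eq_sw (F := fun x y => a ≻ (y ⋅ P x) - (a ≺ y) ≻ P x)); last first.
  by move=> x y; rewrite bmul_succl.
rewrite swBr -(sw_app (f := fun y => a ≻ y)); last by lin.
have -> : a ≻ P b = a ≻ b - a ≻ (\sw_(x, y <- Dp b) (y ⋅ P x)).
  by rewrite {1}PE tensBr linearB.
by abel.
Qed.

(** When Δ≺(a) = 0, the mixed coassociativity says that Δ≺ vanishes on the right factors of Δ≻(a),
    so that P acts on them as the identity. *)
Lemma sw_dsucc_proj (W : lmodType K) (H : {malg K[X]} -> {malg K[X]} -> W) a :
  bilinear_map H -> Dp a = 0 ->
  \sw_(x, y <- Ds a) H x (P y) = \sw_(x, y <- Ds a) H x y.
Proof.
move=> [H1 H2] a0.
rewrite (eq_sw (F := fun x y => H x y - \sw_(z, w <- Dp y) H x (w ⋅ P z))); last first.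
  by move=> x y; rewrite [in LHS]PE (linB _ _ (H2 x)) (sw_app _ _ (H2 x)).
rewrite swBr -(@coassoc_mid _ _ _ TC _ (fun x y z => H x (z ⋅ P y))).
  by rewrite a0 sw0l subr0.
split=> [y z|x z|x y] c u v; first exact: H1.
- by rewrite linearP (lin_bmulr T z (@lin_id K _)) (H2 x).
- by rewrite (lin_bmull T (P y) (@lin_id K _)) (H2 x).
Qed.

Lemma exists_proj_prim : exists Q : {linear {malg K[X]} -> {malg K[X]}},
  forall a, Q a = P a - \sw_(x, y <- Ds (P a)) (x ≻ Q y).
Proof.
have [u f g efg|f fE] := @degree_recursion X {malg K[X]} d 0
    (fun u f => P << u >> - \sw_(x, y <- Ds (P << u >>)) (x ≻ linext f y)).
  congr (_ - _); apply: eq_sw_on => v w.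
  move=> /(pair_deg_lt (hom_dsucc gT (hom_proj_dprec (@homU _ _ _ _))))[_ wu _].
  by rewrite !linextU efg.
exists (linext f); apply: eq_linear; [by lin|by lin|].
by move=> u; rewrite [LHS]linextU fE.
Qed.

Section ProjPrim.

Variable Q : {linear {malg K[X]} -> {malg K[X]}}.
Hypothesis QE : forall a, Q a = P a - \sw_(x, y <- Ds (P a)) (x ≻ Q y).

Lemma hom_proj_prim n a : homogeneous d n a -> homogeneous d n (Q a).
Proof.
move=> ha; apply: (hom_linear _ ha); first exact: linearP.
move=> u; move: n {ha} => m; elim/ltn_ind: m u => m IH u um.
have hP : homogeneous d m (P << u >>) by apply: hom_proj_dprec; rewrite -um; apply: homU.
rewrite QE; apply: homB => //.
apply: (hom_linear (f := fun z => \sw_(x, y <- z) (x ≻ Q y))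
   _ (hom_dsucc gT hP)); first by lin.
move=> [v w] /= vw; rewrite sw_basis -vw.
apply: (hom_bsucc gT); first exact: homU.
by apply: IH => //; have := d_gt0 v; move: vw; rewrite /pair_deg /=; lia.
Qed.

(** Write n = P(a), so Δ≺(n) = 0. By induction Q(y) is totally primitive, hence Δ≺(x ≻ Q(y)) = 0 and
    Δ≻(x ≻ Q(y)) = x' ⊗ (x'' ≻ Q(y)) + x ⊗ Q(y). Coassociativity trades the cut of x for Δ≻(y), and
    the defining equation of Q(y) reduces the sum to Δ≻(n). *)
Lemma proj_prim_tot a : prim_tot T (Q a).
Proof.
suff Q0 u : Dp (Q << u >>) = 0 /\ Ds (Q << u >>) = 0.
  by split; apply: (eq_linear (f := fun a => _ (Q a)) (g := fun=> 0)) => [||u];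
    [lin|lin|case: (Q0 u)|lin|lin|case: (Q0 u)].
have [m] := ubnP (d u); elim: m u => // m IH u um.
have hP := hom_dsucc gT (hom_proj_dprec (@homU K X d u)).
set n := P << u >> in hP *.
have n0 : Dp n = 0 by apply: dprec_proj.
rewrite QE -/n; split; rewrite linearB /=.
  rewrite n0 (sw_app (f := dprec T)); last exact: linearP.
  apply/eqP; rewrite sub0r oppr_eq0; apply/eqP; apply: sw_eq0 => x y /(pair_deg_lt hP)[_ yu _].
  by apply: dprec_succ0 => //; case: (IH y); first by apply: leq_trans yu _.
rewrite (sw_app (f := dsucc T)); last exact: linearP.
rewrite (eq_sw_on (F := fun x y =>
    \sw_(x1, x2 <- Dt x) (x1 ⊗ (x2 ≻ Q y)) + x ⊗ Q y)); last first.
  move=> x y /(pair_deg_lt hP)[_ yu _]; apply: dsucc_succ0 => //.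
  by case: (IH y); first by apply: leq_trans yu _.
rewrite swDr (@coassoc_succ _ _ _ TC _ (fun x y z => x ⊗ (y ≻ Q z))); last by trilin.
(* Replacing y by P(y) makes the inner sum equal to P(y) - Q(y). *)
rewrite -(@sw_dsucc_proj _ (fun x y => \sw_(y1, y2 <- Ds y) (x ⊗ (y1 ≻ Q y2)))) //; last by bilin.
rewrite (eq_sw (F := fun x y => x ⊗ P y - x ⊗ Q y)); last first.
  move=> x y; rewrite -(sw_app (f := fun y => x ⊗ y)); last by lin.
  by rewrite -tensBr [Q y]QE opprB addrCA subrr addr0.
rewrite swBr (@sw_dsucc_proj _ (fun x y => x ⊗ y)) //; last by bilin.
by rewrite sw_id; abel.
Qed.

Lemma proj_prim_id v : prim_tot T v -> Q v = v.
Proof. by case=> v1 v2; rewrite QE proj_dprec_id // v2 sw0l subr0. Qed.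

Lemma proj_prim_mul a b : Q (a ⋅ b) = 0.
Proof. by rewrite QE proj_dprec_mul !linear0 sw0l subr0. Qed.

(** Since Q = R ∘ P for the map [R] below, and P(a ≻ b) is a sum of terms c ≻ n with Δ≺(n) = 0, it
    suffices that R kills such terms. *)
Lemma proj_prim_succ a b : Q (a ≻ b) = 0.
Proof.
pose R n := n - \sw_(x, y <- Ds n) (x ≻ Q y).
have lR : linear R by rewrite /R; lin.
have bE : bilinear_map (fun x y => x ≻ Q y) by bilin.
(* The induction runs over homogeneous elements, because factors such as a ≺ b'' and P(b') are not
   basis vectors. *)
suff Q0 N n m a' b' : homogeneous d n a' -> homogeneous d m b' -> (n + m < N)%N ->
    Q (a' ≻ b') = 0.
  apply: (eq_bilinear (f := fun a b => Q (a ≻ b)) (g := fun _ _ => 0)).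
  - by bilin.
  - by bilin.
  by move=> u v; apply: (Q0 _ _ _ _ _ (@homU _ _ _ _) (@homU _ _ _ _) (ltnSn _)).
elim: N n m a' b' => // N IH n m {}a {}b ha hb nm.
(* In Δ≻(a' ≻ c) the right factors of the form _ ≻ _ are killed by Q through the induction. What
   remains is a' ≻ (c' ≻ Q(c'')) + a' ≻ Q(c), with c' ⊗ c'' = Δ≻(c), and this is a' ≻ c because P(c)
   = c. *)
have Rsucc n' m' a' c : homogeneous d n' a' -> homogeneous d m' c -> Dp c = 0 ->
    (n' + m' <= N)%N -> R (a' ≻ c) = 0.
  move=> ha' hc c0 nm'; rewrite /R; case: (compat_locked TM a' c) => -> _ _ _.
  have hda := hom_dred gT ha'; have hdc := hom_dsucc gT hc.
  rewrite !swDl sw_sw_tens2 // !sw_sw_tens // sw_tens //.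
  rewrite [X in _ - (X + _ + _ + _ + _)]sw_eq0; last first.
    move=> x y /(pair_deg_lt hda)[xu yu _]; apply: sw_eq0 => z w /(pair_deg_lt hdc)[zv wu _].
    by rewrite (IH _ _ _ _ (@homU _ _ _ _) (@homU _ _ _ _)) ?tens0r ?linear0 //; lia.
  rewrite [X in _ - (_ + X + _ + _ + _)]sw_eq0; last first.
    move=> x y /(pair_deg_lt hda)[xu yu _].
    by rewrite (IH _ _ _ _ (@homU _ _ _ _) hc) ?tens0r ?linear0 //; lia.
  rewrite [X in _ - (_ + _ + X + _ + _)]sw_eq0; last first.
    move=> x y /(pair_deg_lt hdc)[xu yu _].
    by rewrite (IH _ _ _ _ ha' (@homU _ _ _ _)) ?tens0r ?linear0 //; lia.
  rewrite !add0r (eq_sw (F := fun x y => a' ≻ (x ≻ Q y))); last first.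
    by move=> x y; rewrite dend_succA.
  rewrite -(sw_app (f := fun y => a' ≻ y)); last by lin.
  rewrite -(linD _ _ (f := fun y => a' ≻ y)); last by lin.
  by rewrite [Q c]QE proj_dprec_id // addrCA subrr addr0 subrr.
rewrite QE -/(R _) proj_dprec_succ (linD _ _ lR) (sw_app _ _ lR).
rewrite (Rsucc n m) ?add0r //; [|exact: hom_proj_dprec|exact: dprec_proj].
apply: sw_eq0 => x y /(pair_deg_lt (hom_dprec gT hb))[_ _ xy].
apply: (Rsucc (n + d y)%N (d x)).
- by apply: (hom_bprec gT) => //; apply: homU.
- by apply: hom_proj_dprec; apply: homU.
- exact: dprec_proj.
- by lia.
Qed.

End ProjPrim.

End ProjDprec.

End Projections.

(** * Extending a linear map to a dendriform morphism *)

Section Lift.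

Variables (K : fieldType) (X : choiceType) (d : X -> nat) (T : bidend_ops K X).
Hypothesis TB : bidendriform_bialgebra T.
Hypothesis gT : graded_ops d T.
Hypothesis d_gt0 : forall u, (0 < d u)%N.
Variables P Q : {linear {malg K[X]} -> {malg K[X]}}.
Hypothesis PE : forall a, P a = a - \sw_(x, y <- dprec T a) lbmul T y (P x).
Hypothesis QE : forall a, Q a = P a - \sw_(x, y <- dsucc T (P a)) bsucc T (x ⊗ Q y).
Variables (Y : choiceType) (S : bidend_ops K Y).
Hypothesis SD : dendriform_algebra S.
Variable theta : {linear {malg K[X]} -> {malg K[Y]}}.
Hypothesis theta_mul : forall a b, theta (lbmul T a b) = 0.
Hypothesis theta_succ : forall a b, theta (bsucc T (a ⊗ b)) = 0.

Local Notation Dp := (dprec T).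
Local Notation Ds := (dsucc T).
Local Notation Dt := (ldred T).

Let TD : dendriform_algebra T. Proof. by case: TB. Qed.
Let TM : bidendriform_compat T. Proof. by case: TB. Qed.

(** The value that a morphism F extending [theta] must take at P(a), read off from P(a) = Q(a) + x ≻
    Q(y) with x ⊗ y = Δ≻(P(a)). *)
Definition lift_prim (F : {malg K[X]} -> {malg K[Y]}) a : {malg K[Y]} :=
  theta a + \sw_(x, y <- Ds (P a)) bsucc S (F x ⊗ theta y).

(** The equation is a = P(a) + a''P(a') with F applied to it. It is a recursion on the degree, both
    sums involving F only on factors of smaller degree. *)
Lemma exists_lift : exists F : {linear {malg K[X]} -> {malg K[Y]}},
  forall a, F a = lift_prim F a + \sw_(x, y <- Dp a) lbmul S (F y) (lift_prim F x).
Proof.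
pose G u f : {malg K[Y]} := lift_prim (linext f) << u >> +
  \sw_(x, y <- Dp << u >>) lbmul S (linext f y) (lift_prim (linext f) x).
have prim_ext f g u : (forall v, (d v < d u)%N -> f v = g v) ->
    lift_prim (linext f) << u >> = lift_prim (linext g) << u >>.
  move=> efg; congr (_ + _); apply: eq_sw_on => v w.
  move=> /(pair_deg_lt d_gt0 (hom_dsucc gT (hom_proj_dprec gT d_gt0 PE (@homU _ _ _ _))))[vu _ _].
  by rewrite !linextU efg.
have [u f g efg|f fE] := @degree_recursion X {malg K[Y]} d 0 G.
  rewrite /G (prim_ext f g u efg).
  rewrite (eq_sw_on (F := fun x y => lbmul S (linext g y) (lift_prim (linext g) x))); first by [].
  move=> v w.
  move=> /(pair_deg_lt d_gt0 (hom_dprec gT (@homU _ _ _ _)))[vu wu _].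
  rewrite !linextU (efg w wu) (prim_ext f g v); first by [].
  by move=> z zv; apply: efg; apply: ltn_trans zv vu.
exists (linext f); rewrite /lift_prim; apply: eq_linear; [by lin|by lin|].
by move=> u; rewrite [LHS]linextU fE.
Qed.

Section LiftMorphism.

Variable F : {linear {malg K[X]} -> {malg K[Y]}}.
Hypothesis FE : forall a,
  F a = lift_prim F a + \sw_(x, y <- Dp a) lbmul S (F y) (lift_prim F x).

Local Notation F1 := (lift_prim F).

Let lin_F1 : linear F1. Proof. by rewrite /lift_prim; lin. Qed.

Let bilinear_step : bilinear_map (fun x y => lbmul S (F y) (F1 x)).
Proof.
by split=> [y|x]; [apply: (lin_bmulr S (F y) lin_F1)|lin].
Qed.

Lemma lift_prim_mul a b : F1 (lbmul T a b) = 0.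
Proof.
rewrite /lift_prim theta_mul (proj_dprec_mul TB gT d_gt0 PE).
by rewrite linear0 sw0l addr0.
Qed.

(** The argument of [proj_dprec_mul] again, with [F1] in place of P: it vanishes on products, so
    only b' ⊗ ab'' and b ⊗ a contribute, and associativity factors out F(a). *)
Lemma lift_mul a b : F (lbmul T a b) = lbmul S (F a) (F b).
Proof.
apply: (eq_bilinear (f := fun a b => F (lbmul T a b))
                    (g := fun a b => lbmul S (F a) (F b))).
- by bilin.
- by bilin.
move=> u v; have [m] := ubnP (d v); elim: m v => // m IH v vm.
have hv := hom_dprec gT (@homU K X d v).
rewrite FE lift_prim_mul add0r dprec_mul // !swDl.
rewrite sw_sw_tens2 // !sw_sw_tens // sw_tens //.
rewrite [X in X + _ + _ + _ + _]sw_eq0; last first.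
  by move=> x y _; apply: sw_eq0 => z w _; rewrite lift_prim_mul bmul0r.
rewrite [X in _ + X + _ + _ + _]sw_eq0; last first.
  by move=> x y _; rewrite lift_prim_mul bmul0r.
rewrite [X in _ + _ + _ + X + _]sw_eq0; last first.
  by move=> x y _; rewrite lift_prim_mul bmul0r.
rewrite !add0r addr0.
rewrite (eq_sw_on (F := fun x y => lbmul S (F << u >>) (lbmul S (F y) (F1 x)))); last first.
  move=> x y /(pair_deg_lt d_gt0 hv)[_ yv _].
  by rewrite IH ?bmulA //; apply: leq_trans yv _.
rewrite -(sw_app (f := fun y => lbmul S (F << u >>) y)); last by lin.
rewrite -(linD _ _ (f := fun y => lbmul S (F << u >>) y)); last by lin.
by rewrite addrC -FE.
Qed.

(** The difference a - P(a) is a sum of products, on which [theta] vanishes. *)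
Lemma theta_proj a : theta (P a) = theta a.
Proof.
rewrite PE linearB /= (sw_app (f := theta)); last exact: linearP.
by rewrite (eq_sw (F := fun _ _ => 0)) ?sw0r ?subr0.
Qed.

(** The counterpart of [proj_dprec_succ] for [F1], which stands for F ∘ P. *)
Lemma lift_prim_succ a b :
  F1 (bsucc T (a ⊗ b)) =
  bsucc S (F a ⊗ F1 b) + \sw_(b1, b2 <- Dp b) bsucc S (F (bprec T (a ⊗ b2)) ⊗ F1 b1).
Proof.
pose R n := \sw_(x, y <- Ds n) bsucc S (F x ⊗ theta y).
have lR : linear R by rewrite /R; lin.
have bE : bilinear_map (fun x y => bsucc S (F x ⊗ theta y)) by bilin.
(* [theta] kills every right factor of Δ≻(c ≻ n) of the form _ ≻ _, leaving (c n') ⊗ n'' and c ⊗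
   n. *)
have Rsucc c n : R (bsucc T (c ⊗ n)) = bsucc S (F c ⊗ (theta n + R n)).
  rewrite /R; case: (compat_locked TM c n) => -> _ _ _.
  rewrite !swDl sw_sw_tens2 // !sw_sw_tens // sw_tens //.
  rewrite [X in X + _ + _ + _ + _]sw_eq0; last first.
    by move=> x y _; apply: sw_eq0 => z w _; rewrite theta_succ tens0r linear0.
  rewrite [X in _ + X + _ + _ + _]sw_eq0; last first.
    by move=> x y _; rewrite theta_succ tens0r linear0.
  rewrite [X in _ + _ + X + _ + _]sw_eq0; last first.
    by move=> x y _; rewrite theta_succ tens0r linear0.
  rewrite !add0r (eq_sw (F := fun x y => bsucc S (F c ⊗ bsucc S (F x ⊗ theta y)))).
    rewrite -(sw_app (f := fun y => bsucc S (F c ⊗ y))); last by lin.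
    by rewrite tensDr linearD addrC.
  by move=> x y; rewrite lift_mul dend_succA.
rewrite /lift_prim theta_succ add0r (proj_dprec_succ TB gT d_gt0 PE) -/(R _).
rewrite (linD _ _ lR) (sw_app _ _ lR) Rsucc theta_proj; congr (_ + _).
by apply: eq_sw => x y; rewrite Rsucc theta_proj.
Qed.

Lemma lift_succ a b : F (bsucc T (a ⊗ b)) = bsucc S (F a ⊗ F b).
Proof.
apply: (eq_bilinear (f := fun a b => F (bsucc T (a ⊗ b)))
                    (g := fun a b => bsucc S (F a ⊗ F b))).
- by bilin.
- by bilin.
move=> u v; have [m] := ubnP (d v); elim: m v => // m IH v vm.
have hv := hom_dprec gT (@homU K X d v).
have IH' x y : (x, y) \in msupp (Dp << v >>) ->
    F (bsucc T (<< u >> ⊗ << y >>)) = bsucc S (F << u >> ⊗ F << y >>).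
  by move=> /(pair_deg_lt d_gt0 hv)[_ yv _]; apply: IH; apply: leq_trans yv _.
rewrite FE lift_prim_succ; case: (compat_locked TM << u >> << v >>) => _ _ -> _.
rewrite !swDl sw_sw_tens2 // !sw_sw_tens //.
rewrite [X in _ + (X + _ + _)]sw_eq0; last first.
  by move=> x y _; apply: sw_eq0 => z w _; rewrite lift_prim_mul bmul0r.
rewrite [X in _ + (_ + X + _)]sw_eq0; last first.
  by move=> x y _; rewrite lift_prim_mul bmul0r.
rewrite !add0r -addrA -swDr.
rewrite (eq_sw_on (F := fun x y =>
    bsucc S (F << u >> ⊗ lbmul S (F y) (F1 x)))); last first.
  (* The correction term of [bmul_succl] cancels the second term of [lift_prim_succ]; the morphism
     property for ≺ at the smaller element y comes from those for the product and for ≻. *)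
  move=> x y xy; rewrite (IH' _ _ xy) bmul_succl // (bmul_precE T) linearB /= lift_mul.
  by rewrite (IH' _ _ xy) -bmul_precE; abel.
rewrite -(sw_app (f := fun y => bsucc S (F << u >> ⊗ y))); last by lin.
by rewrite -linearD /= -tensDr -FE.
Qed.

Lemma lift_prec a b : F (bprec T (a ⊗ b)) = bprec S (F a ⊗ F b).
Proof. by rewrite !bmul_precE linearB /= lift_mul lift_succ. Qed.

Lemma lift_prim_tot v : prim_tot T v -> F v = theta v.
Proof.
case=> v1 v2; rewrite FE v1 sw0l addr0 /lift_prim.
by rewrite (proj_dprec_id PE v1) v2 sw0l addr0.
Qed.

(** Applying [phi] to the recursion for F turns it back into the formulas that express a through P
    and P through Q. *)
Lemma lift_section (phi : {linear {malg K[Y]} -> {malg K[X]}}) :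
  (forall a b, phi (bprec S (a ⊗ b)) = bprec T (phi a ⊗ phi b)) ->
  (forall a b, phi (bsucc S (a ⊗ b)) = bsucc T (phi a ⊗ phi b)) ->
  (forall a, phi (theta a) = Q a) -> forall a, phi (F a) = a.
Proof.
move=> phi_prec phi_succ phi_theta.
have phi_mul a b : phi (lbmul S a b) = lbmul T (phi a) (phi b).
  by rewrite !lbmulE linearD /= phi_prec phi_succ.
apply: (eq_linear (f := fun a => phi (F a)) (g := fun a => a)); [by lin|by lin|].
move=> u; have [m] := ubnP (d u); elim: m u => // m IH u um.
(* Degree equal to that of u is allowed: Δ≻(P(v)) only has left factors of degree below that of v,
   to which the induction hypothesis applies. *)
have phi_prim v : (d v <= d u)%N -> phi (F1 << v >>) = P << v >>.
  move=> vu; rewrite /lift_prim linearD /= phi_theta QE.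
  rewrite (sw_app (f := phi)); last exact: linearP.
  have hv := hom_dsucc gT (hom_proj_dprec gT d_gt0 PE (@homU K X d v)).
  rewrite (eq_sw_on (F := fun x y => bsucc T (x ⊗ Q y))) ?subrK // => x y.
  move=> /(pair_deg_lt d_gt0 hv)[xv _ _]; rewrite phi_succ phi_theta IH //.
  by apply: leq_trans xv _; apply: leq_trans vu _.
rewrite FE linearD /= phi_prim // (sw_app (f := phi)); last exact: linearP.
have hu := hom_dprec gT (@homU K X d u).
rewrite (eq_sw_on (F := fun x y => lbmul T y (P x))) => [|x y].
  by rewrite PE subrK.
move=> /(pair_deg_lt d_gt0 hu)[xu yu _]; rewrite phi_mul phi_prim 1?ltnW //.
by rewrite IH //; apply: leq_trans yu _.
Qed.

End LiftMorphism.

End Lift.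

(** * Shuffles and standardization *)

Section SplitsShuffles.

(** Listing the cuts of a word by recursion on its first letter matches the recursion of
    [shuffles]. *)
Fixpoint splits (T : Type) (w : seq T) : seq (seq T * seq T) :=
  if w is a :: w' then ([::], w) :: [seq (a :: p.1, p.2) | p <- splits w']
  else [:: ([::], [::])].

Lemma mem_splits (T : eqType) (w : seq T) p : p \in splits w -> p.1 ++ p.2 = w.
Proof.
elim: w p => [|a w IH] p /=; first by rewrite inE => /eqP ->.
by rewrite inE => /predU1P[-> //|/mapP[q /IH <- ->]].
Qed.

Lemma big_splits_cons (T : Type) (V : nmodType) (f : seq T -> seq T -> V) a w :
  \sum_(p <- splits (a :: w)) f p.1 p.2 =
  f [::] (a :: w) + \sum_(p <- splits w) f (a :: p.1) p.2.
Proof. by rewrite /= big_cons big_map. Qed.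

Lemma big_splitsE (T : Type) (V : nmodType) (f : seq T -> seq T -> V) w :
  \sum_(p <- splits w) f p.1 p.2 = \sum_(0 <= i < (size w).+1) f (take i w) (drop i w).
Proof.
elim: w f => [|a w IH] f; first by rewrite big_seq1 big_nat1.
by rewrite big_splits_cons (IH (fun x => f (a :: x))) [in RHS]big_nat_recl.
Qed.

(** Coassociativity of deconcatenation: both sides range over the factorizations of w into three
    words. *)
Lemma big_splits_assoc (T : Type) (V : nmodType)
    (f : seq T -> seq T -> seq T -> V) w :
  \sum_(p <- splits w) \sum_(q <- splits p.1) f q.1 q.2 p.2 =
  \sum_(p <- splits w) \sum_(q <- splits p.2) f p.1 q.1 q.2.
Proof.
elim: w f => [|a w IH] f; first by rewrite !big_seq1.
rewrite !(big_splits_cons (fun x y => \sum_(q <- splits x) f q.1 q.2 y))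
        !(big_splits_cons (fun x y => \sum_(q <- splits y) f x q.1 q.2)).
rewrite big_seq1 (big_splits_cons (f [::])) -addrA; congr (_ + _).
rewrite -(IH (fun x => f (a :: x))) -big_split /=; apply: eq_bigr => p _.
exact: (big_splits_cons (fun x y => f x y p.2)).
Qed.

Definition proper_splits (T : eqType) (w : seq T) : seq (seq T * seq T) :=
  [seq p <- splits w | (p.1 != [::]) && (p.2 != [::])].

Lemma mem_proper_splits (T : eqType) (w : seq T) p :
  p \in proper_splits w -> [/\ p.1 ++ p.2 = w, p.1 != [::] & p.2 != [::]].
Proof. by rewrite mem_filter => /andP[/andP[p1 p2] /mem_splits]. Qed.

Lemma big_proper_splits (T : eqType) (V : nmodType) (f : seq T -> seq T -> V) w :
  w != [::] -> \sum_(p <- splits w) f p.1 p.2 =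
  f [::] w + f w [::] + \sum_(p <- proper_splits w) f p.1 p.2.
Proof.
move=> w0; rewrite big_filter.
pose g x y := if (x != [::]) && (y != [::]) then f x y else 0.
have -> : \sum_(p <- splits w | (p.1 != [::]) && (p.2 != [::])) f p.1 p.2 =
    \sum_(p <- splits w) g p.1 p.2 by rewrite big_mkcond.
rewrite (big_splitsE g) (big_splitsE f) big_nat_recl // take0 drop0 -addrA; congr (_ + _).
case: w w0 => // a w _.
rewrite [in RHS]big_nat_recl // {1}/g /= add0r !big_nat_recr //= /g /= take_size drop_size /=.
rewrite addr0 addrC; congr (_ + _).
rewrite big_nat_cond [in RHS]big_nat_cond; apply: eq_bigr => i /andP[/andP[_ iw] _].
by rewrite -size_eq0 size_drop subn_eq0 leqNgt iw.
Qed.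

Lemma shuffles0l v : shuffles [::] v = [:: v].
Proof. by case: v. Qed.

Lemma shuffles0r u : shuffles u [::] = [:: u].
Proof. by case: u. Qed.

Lemma shuffles_cons a u b v :
  shuffles (a :: u) (b :: v) =
  map (cons a) (shuffles u (b :: v)) ++ map (cons b) (shuffles (a :: u) v).
Proof. by []. Qed.

Lemma big_shuffles_cons (V : nmodType) (f : seq nat -> V) a u b v :
  \sum_(s <- shuffles (a :: u) (b :: v)) f s =
  \sum_(s <- shuffles u (b :: v)) f (a :: s) +
  \sum_(s <- shuffles (a :: u) v) f (b :: s).
Proof. by rewrite shuffles_cons big_cat !big_map. Qed.

Variables (K : fieldType) (Z : choiceType).
Local Notation V := {malg K[Z]}.

(** Both sides range over the shuffles of three words, and the induction sorts them by their first
    letter. *)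
Lemma big_shuffles_assoc (f : seq nat -> V) u v w :
  \sum_(s <- shuffles u v) \sum_(r <- shuffles s w) f r =
  \sum_(s <- shuffles v w) \sum_(r <- shuffles u s) f r.
Proof.
elim: u v w f => [|a u IHu] v w f.
  rewrite shuffles0l big_seq1; apply: eq_bigr => s _.
  by rewrite shuffles0l big_seq1.
elim: v w f => [|b v IHv] w f; first by rewrite shuffles0r shuffles0l !big_seq1.
elim: w f => [|c w IHw] f.
  rewrite shuffles0r big_seq1; apply: eq_bigr => s _.
  by rewrite shuffles0r big_seq1.
rewrite (big_shuffles_cons (fun s => \sum_(r <- shuffles s (c :: w)) f r)).
rewrite (big_shuffles_cons (fun s => \sum_(r <- shuffles (a :: u) s) f r)).
under eq_bigr do rewrite big_shuffles_cons.
under [X in _ + X]eq_bigr do rewrite big_shuffles_cons.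
under [in RHS]eq_bigr do rewrite big_shuffles_cons.
under [X in _ = _ + X]eq_bigr do rewrite big_shuffles_cons.
rewrite !big_split /= (IHu _ _ (fun r => f (a :: r))) (IHv _ (fun r => f (b :: r))).
rewrite (big_shuffles_cons (fun s => \sum_(r <- shuffles u s) f (a :: r))).
have := IHw (fun r => f (c :: r)).
rewrite (big_shuffles_cons (fun s => \sum_(r <- shuffles s w) f (c :: r))) => IHw'.
by rewrite addrACA IHw'; abel.
Qed.

(** To cut a shuffle of u and v is to cut u and v and to shuffle the two left pieces and the two
    right pieces. This is the bialgebra property behind all the compatibilities of FQSym. *)
Lemma big_splits_shuffles (f : seq nat -> seq nat -> V) u v :
  \sum_(s <- shuffles u v) \sum_(p <- splits s) f p.1 p.2 =
  \sum_(p <- splits u) \sum_(q <- splits v)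
    \sum_(x <- shuffles p.1 q.1) \sum_(y <- shuffles p.2 q.2) f x y.
Proof.
elim: u v f => [|a u IHu] v f.
  rewrite shuffles0l !big_seq1; apply: eq_bigr => p _.
  by rewrite !shuffles0l !big_seq1.
elim: v f => [|b v IHv] f.
  rewrite shuffles0r !big_seq1; apply: eq_bigr => p _.
  by rewrite big_seq1 !shuffles0r !big_seq1.
pose G g p1 p2 q1 q2 : V := \sum_(x <- shuffles p1 q1) \sum_(y <- shuffles p2 q2) g x y.
pose GG g u v : V := \sum_(p <- splits u) \sum_(q <- splits v) G g p.1 p.2 q.1 q.2.
have GG_consl g c x y : GG g (c :: x) y = \sum_(q <- splits y) G g [::] (c :: x) q.1 q.2 +
    \sum_(p <- splits x) \sum_(q <- splits y) G g (c :: p.1) p.2 q.1 q.2.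
  exact: (big_splits_cons (fun p1 p2 => \sum_(q <- splits y) G g p1 p2 q.1 q.2)).
have GG_consr g x c y : GG g x (c :: y) = \sum_(p <- splits x) G g p.1 p.2 [::] (c :: y) +
    \sum_(p <- splits x) \sum_(q <- splits y) G g p.1 p.2 (c :: q.1) q.2.
  by rewrite -big_split; apply: eq_bigr => p _; apply: (big_splits_cons (G g p.1 p.2)).
rewrite (big_shuffles_cons (fun s => \sum_(p <- splits s) f p.1 p.2)).
under eq_bigr do rewrite big_splits_cons.
under [X in _ + X]eq_bigr do rewrite big_splits_cons.
rewrite !big_split /= (IHu _ (fun x => f (a :: x))) (IHv (fun x => f (b :: x))).
rewrite -[X in _ + X + _]/(GG (fun x => f (a :: x)) u (b :: v)).
rewrite -[X in _ + _ + (_ + X)]/(GG (fun x => f (b :: x)) (a :: u) v) -[RHS]/(GG f (a :: u) (b :: v)).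
rewrite GG_consr [in LHS]GG_consl GG_consl (big_splits_cons (G f [::] (a :: u))).
have -> : \sum_(p <- splits u) \sum_(q <- splits (b :: v)) G f (a :: p.1) p.2 q.1 q.2 =
    \sum_(p <- splits u) G f (a :: p.1) p.2 [::] (b :: v) +
    \sum_(p <- splits u) \sum_(q <- splits v) G f (a :: p.1) p.2 (b :: q.1) q.2.
  by rewrite -big_split; apply: eq_bigr => p _; apply: (big_splits_cons (G f (a :: p.1) p.2)).
have -> : \sum_(p <- splits u) \sum_(q <- splits v) G f (a :: p.1) p.2 (b :: q.1) q.2 =
    \sum_(p <- splits u) \sum_(q <- splits v) G (fun x => f (a :: x)) p.1 p.2 (b :: q.1) q.2 +
    \sum_(p <- splits u) \sum_(q <- splits v) G (fun x => f (b :: x)) (a :: p.1) p.2 q.1 q.2.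
  rewrite -big_split; apply: eq_bigr => p _; rewrite -big_split; apply: eq_bigr => q _.
  exact: (big_shuffles_cons (fun x => \sum_(y <- shuffles p.2 q.2) f x y)).
have -> : G f [::] (a :: u) [::] (b :: v) =
    \sum_(s <- shuffles u (b :: v)) f [::] (a :: s) +
    \sum_(s <- shuffles (a :: u) v) f [::] (b :: s).
  by rewrite /G big_seq1 big_shuffles_cons.
have -> : \sum_(p <- splits u) G (fun x => f (a :: x)) p.1 p.2 [::] (b :: v) =
    \sum_(p <- splits u) G f (a :: p.1) p.2 [::] (b :: v).
  by apply: eq_bigr => p _; rewrite /G !shuffles0r !big_seq1.
have -> : \sum_(q <- splits v) G (fun x => f (b :: x)) [::] (a :: u) q.1 q.2 =
    \sum_(q <- splits v) G f [::] (a :: u) (b :: q.1) q.2.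
  by apply: eq_bigr => q _; rewrite /G !shuffles0l !big_seq1.
by abel.
Qed.

End SplitsShuffles.

Section Letters.

Lemma map_shuffles (g : nat -> nat) u v :
  map (map g) (shuffles u v) = shuffles (map g u) (map g v).
Proof.
elim: u v => [|a u IHu] v; first by rewrite !shuffles0l.
elim: v => [|b v IHv]; first by rewrite !shuffles0r.
rewrite shuffles_cons map_cat [map g (a :: u)]/= [map g (b :: v)]/= shuffles_cons.
by rewrite -[g b :: _]/(map g (b :: v)) -[g a :: _]/(map g (a :: u)) -IHu -IHv -!map_comp.
Qed.

Lemma perm_shuffles u v w : w \in shuffles u v -> perm_eq w (u ++ v).
Proof.
elim: u v w => [|a u IHu] v w; first by rewrite shuffles0l inE => /eqP ->.
elim: v w => [|b v IHv] w; first by rewrite shuffles0r inE cats0 => /eqP ->.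
rewrite shuffles_cons mem_cat => /orP[] /mapP[s].
- by move=> /IHu sp -> /=; rewrite perm_cons.
- move=> /IHv sp -> /=; rewrite -cat_cons.
  apply: (@perm_trans _ (b :: ((a :: u) ++ v))); first by rewrite perm_cons.
  by rewrite perm_sym -[b :: v]cat1s perm_catCA.
Qed.

Lemma last_shuffles u v w x : u != [::] -> v != [::] -> w \in shuffles u v ->
  last x w = last x u \/ last x w = last x v.
Proof.
elim: u v w x => [//|a u IHu] v w x _; elim: v w x => [//|b v IHv] w x _.
rewrite shuffles_cons mem_cat => /orP[] /mapP[s ss ->] /=.
- have [u0|u0] := eqVneq u [::].
    by right; move: ss; rewrite u0 shuffles0l inE => /eqP ->.
  by case: (IHu (b :: v) s a u0 isT ss) => ->; [left|right].
- have [v0|v0] := eqVneq v [::].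
    by left; move: ss; rewrite v0 shuffles0r inE => /eqP ->.
  by case: (IHv s b v0 ss) => ->; [left|right].
Qed.

Definition rank_in (w : seq nat) x : nat := count (fun y => y <= x)%N w.

Lemma stdE w : std w = map (rank_in w) w.
Proof. by []. Qed.

Lemma size_std w : size (std w) = size w.
Proof. exact: size_map. Qed.

Lemma ltn_rank_in w x y : y \in w -> (x < y)%N -> (rank_in w x < rank_in w y)%N.
Proof.
move=> + xy; elim: w => // c w IH; rewrite inE /rank_in /= => /predU1P[<-|/IH].
  rewrite [(y <= x)%N]leqNgt xy leqnn add0n add1n ltnS; apply: sub_count => z /= zx.
  exact: leq_trans zx (ltnW xy).
by rewrite /rank_in; case: (leqP c x) => [cx|_]; case: (leqP c y) => /=; lia.
Qed.

Lemma leq_rank_in w x y : y \in w -> (rank_in w y <= rank_in w x)%N = (y <= x)%N.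
Proof.
move=> yw; apply/idP/idP => [|yx]; last by apply: sub_count => z /leq_trans; apply.
by apply: contraLR; rewrite -!ltnNge; apply: ltn_rank_in.
Qed.

Lemma rank_in_inj w : {in w &, injective (rank_in w)}.
Proof.
by move=> x y xw yw exy; apply/eqP; rewrite eqn_leq -(leq_rank_in y xw) -(leq_rank_in x yw) exy leqnn.
Qed.

Lemma eq_rank_in w w' : perm_eq w w' -> rank_in w =1 rank_in w'.
Proof. by move=> /permP e x; apply: e. Qed.

Lemma std_map g w : {in w &, {mono g : x y / (x <= y)%N}} -> std (map g w) = std w.
Proof.
move=> mg; rewrite /std -map_comp; apply/eq_in_map => x xw /=.
by rewrite count_map; apply: eq_in_count => y yw /=; apply: mg.
Qed.

Lemma std_map_rank w v : {subset v <= w} -> std (map (rank_in w) v) = std v.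
Proof. by move=> vw; apply: std_map => x y xv yv; apply/leq_rank_in/vw. Qed.

Lemma std_shift k w : std (shift k w) = std w.
Proof. by apply: std_map => x y _ _; rewrite leq_add2l. Qed.

Lemma std_perm_word w : uniq w -> is_perm_word (std w).
Proof.
move=> uw; rewrite /is_perm_word size_std.
have us : uniq (std w) by rewrite map_inj_in_uniq //; apply: rank_in_inj.
apply: uniq_perm => //; first exact: iota_uniq.
suff sub : {subset std w <= iota 1 (size w)}.
  by case: (uniq_min_size us sub); rewrite // size_iota size_std.
move=> r /mapP[x xw ->]; rewrite mem_iota add1n ltnS count_size andbT.
by rewrite -has_count; apply/hasP; exists x.
Qed.

Lemma std_id w : is_perm_word w -> std w = w.
Proof.
move=> pw; rewrite -[RHS]map_id; apply/eq_in_map => x; rewrite (perm_mem pw).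
rewrite (permP pw) mem_iota => /andP[x1 xw].
rewrite -(subnKC (_ : x <= size w)%N); last by lia.
rewrite iotaD count_cat.
rewrite (eq_in_count (a2 := predT)); last first.
  by move=> y; rewrite mem_iota /=; lia.
rewrite (eq_in_count (s := iota _ (_ - _)) (a2 := pred0)); last first.
  by move=> y; rewrite mem_iota /=; lia.
by rewrite count_predT count_pred0 size_iota addn0.
Qed.

Lemma perm_word_uniq w : is_perm_word w -> uniq w.
Proof. by move=> /perm_uniq ->; apply: iota_uniq. Qed.

Definition max_letter (w : seq nat) : nat := \max_(x <- w) x.

Lemma max_letter_geq w x : x \in w -> (x <= max_letter w)%N.
Proof. by move=> xw; apply: (@leq_bigmax_seq _ w xpredT id x). Qed.

Lemma max_letterE w m : m \in w -> (forall x, x \in w -> x <= m)%N -> max_letter w = m.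
Proof.
move=> mw wm; apply/eqP; rewrite eqn_leq max_letter_geq // andbT.
by apply/bigmax_leqP_seq => x xw _; apply: wm.
Qed.

Lemma max_letter_mem w : w != [::] -> max_letter w \in w.
Proof.
elim: w => // a w IH _; rewrite /max_letter big_cons -/(max_letter w) inE.
have [->|/IH wm] := eqVneq w [::]; first by rewrite /max_letter big_nil maxn0 eqxx.
by case: (leqP a (max_letter w)); rewrite ?wm ?orbT ?eqxx.
Qed.

Lemma max_letter_sub w v : {subset v <= w} -> max_letter w \in v ->
  max_letter v = max_letter w.
Proof. by move=> vw wv; apply: max_letterE => // x /vw /max_letter_geq. Qed.

End Letters.

(** * FQSym *)

Section FQSymWords.

Variable K : fieldType.

Local Notation fq := (fqsym_bidend K).
Local Notation pos_word := (fun w => is_perm_word w && (w != [::])).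
Local Notation "a ≺ b" := (bprec fq (a ⊗ b)).
Local Notation "a ≻ b" := (bsucc fq (a ⊗ b)).
Local Notation "a ⋅ b" := (lbmul fq a b).
Local Notation Dp := (dprec fq).
Local Notation Ds := (dsucc fq).
Local Notation Dt := (ldred fq).

(* A word with distinct letters stands for the basis element indexed by its   *)
(* standardization; the empty word stands for 0. Representing the factors of  *)
(* a product by words on separated alphabets removes all shifts.              *)
Definition wd (w : seq nat) : {malg K[perm_word_pos]} := @F_ K pos_word (std w).

Definition separated (u v : seq nat) : Prop :=
  uniq (u ++ v) /\ (forall x y, x \in u -> y \in v -> x < y)%N.

Definition shuffle_sum u v : {malg K[perm_word_pos]} :=
  \sum_(w <- shuffles u v) wd w.

(** For separated nonempty u and v, taking for x the last letter of u gives ≺, and the last letter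
    of v gives ≻. *)
Definition half_sum x u v : {malg K[perm_word_pos]} :=
  \sum_(w <- shuffles u v | last 0%N w == x) wd w.

Lemma wd0 : wd [::] = 0.
Proof. by rewrite /wd /F_ insubF // andbF. Qed.

Lemma F_wd w : is_perm_word w -> @F_ K pos_word w = wd w.
Proof. by move=> pw; rewrite /wd std_id. Qed.

Lemma wd_basis (U : perm_word_pos) : << U >> = wd (val U).
Proof.
have /andP[pU _] := valP U.
by rewrite -F_wd // /F_ valK.
Qed.

Lemma wdU w : uniq w -> w != [::] ->
  exists2 U : perm_word_pos, wd w = << U >> & val U = std w.
Proof.
move=> uw w0; have pw : pos_word (std w).
  by rewrite std_perm_word //= -size_eq0 size_std size_eq0.
exists (Sub (std w) pw); last exact: SubK.
by rewrite wd_basis SubK /wd [in RHS]std_id // std_perm_word.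
Qed.

Lemma wd_shift k w : wd (shift k w) = wd w.
Proof. by rewrite /wd std_shift. Qed.

Lemma separated_uniq u v : separated u v -> uniq u /\ uniq v.
Proof. by case; rewrite cat_uniq => /and3P[]. Qed.

Lemma rank_in_separated u v : separated u v ->
  map (rank_in (u ++ v)) u = std u /\
  map (rank_in (u ++ v)) v = shift (size u) (std v).
Proof.
case=> _ uv; split.
  apply/eq_in_map => x xu; rewrite /rank_in count_cat.
  rewrite [X in (_ + X)%N](eq_in_count (a2 := pred0)) ?count_pred0 ?addn0 // => y yv.
  by have := uv _ _ xu yv; rewrite ltnNge => /negbTE.
rewrite /shift /std -map_comp; apply/eq_in_map => x xv; rewrite /rank_in count_cat /=.
rewrite (eq_in_count (a2 := predT)) ?count_predT // => y yu.
by rewrite (ltnW (uv _ _ yu xv)).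
Qed.

Lemma last_rank_in (w v v' : seq nat) : {subset v <= w} -> {subset v' <= w} ->
  v != [::] -> v' != [::] ->
  (last 0%N (map (rank_in w) v) == last 0%N (map (rank_in w) v')) =
  (last 0%N v == last 0%N v').
Proof.
case: v v' => [//|a v] [//|a' v'] vw vw' _ _; rewrite !map_cons /= !last_map.
by apply: (inj_in_eq (@rank_in_inj w)); [apply: vw | apply: vw']; apply: mem_last.
Qed.

Lemma shuffles_neq0 u v w : w \in shuffles u v -> u != [::] -> w != [::].
Proof.
move=> /perm_shuffles /perm_size; rewrite size_cat -!size_eq0 => ->.
by rewrite addn_eq0; case: eqP.
Qed.

(** The rank function of u ++ v is increasing on its letters and maps u to std(u) and v to the shift
    of std(v), so it carries shuffles of u and v to the shuffles in the definition of FQSym, without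
    changing standardizations. *)
Lemma half_sum_rank x u v : separated u v -> u != [::] -> x \in [:: u; v] -> x != [::] ->
  \sum_(w <- shuffles (std u) (shift (size (std u)) (std v)) |
     last 0%N w == last 0%N (map (rank_in (u ++ v)) x)) @F_ K pos_word w =
  half_sum (last 0%N x) u v.
Proof.
move=> suv u0 xuv x0; have [ru rv] := rank_in_separated suv.
rewrite size_std -ru -rv -map_shuffles big_map big_seq_cond [RHS]big_seq_cond.
have sub w : w \in shuffles u v -> {subset w <= u ++ v}.
  by move=> wuv z; rewrite (perm_mem (perm_shuffles wuv)).
have subx : {subset x <= u ++ v}.
  move=> z zx; rewrite mem_cat; move: xuv zx; rewrite !inE.
  by case/orP=> /eqP -> ->; rewrite ?orbT.
apply: congr_big => // [w|w /andP[wuv _]].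
  have [wuv|//] := boolP (w \in _); rewrite /= last_rank_in //.
  - exact: sub.
  - exact: shuffles_neq0 wuv u0.
by rewrite (eq_map (eq_rank_in (_ : perm_eq (u ++ v) w))) // perm_sym perm_shuffles.
Qed.

Lemma bprec_wd u v : separated u v -> u != [::] -> v != [::] ->
  wd u ≺ wd v = half_sum (last 0%N u) u v.
Proof.
move=> suv u0 v0; have [uu uv] := separated_uniq suv.
have [U -> vU] := wdU uu u0; have [V -> vV] := wdU uv v0.
rewrite tensUU [LHS]linextU /fqsym_prec_basis /= vU vV -(half_sum_rank suv u0) //.
  by have [-> _] := rank_in_separated suv.
by rewrite inE eqxx.
Qed.

Lemma bsucc_wd u v : separated u v -> u != [::] -> v != [::] ->
  wd u ≻ wd v = half_sum (last 0%N v) u v.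
Proof.
move=> suv u0 v0; have [uu uv] := separated_uniq suv.
have [U -> vU] := wdU uu u0; have [V -> vV] := wdU uv v0.
rewrite tensUU [LHS]linextU /fqsym_succ_basis /= vU vV -(half_sum_rank suv u0) //.
  by have [_ ->] := rank_in_separated suv; rewrite size_std.
by rewrite !inE eqxx orbT.
Qed.

Lemma last_mem_neq0 (w : seq nat) : w != [::] -> last 0%N w \in w.
Proof. by case: w => // a w _; apply: mem_last. Qed.

Lemma separated_disj u v x : separated u v -> x \in u -> x \in v -> False.
Proof. by case=> _ uv /uv h /h; rewrite ltnn. Qed.

Lemma last_separated u v : separated u v -> u != [::] -> v != [::] ->
  (last 0%N u == last 0%N v) = false.
Proof.
move=> suv u0 v0; apply/negP => /eqP e.
by apply: (separated_disj suv (last_mem_neq0 u0)); rewrite e last_mem_neq0.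
Qed.

Lemma bmul_wd u v : separated u v -> u != [::] -> v != [::] ->
  wd u ⋅ wd v = shuffle_sum u v.
Proof.
move=> suv u0 v0; rewrite lbmulE bprec_wd // bsucc_wd // /shuffle_sum.
rewrite (bigID (fun w => last 0%N w == last 0%N u)) /=; congr (_ + _).
rewrite /half_sum big_seq_cond [RHS]big_seq_cond; apply: eq_bigl => w.
have [wuv|//] := boolP (w \in _); rewrite /=.
case: (last_shuffles 0%N u0 v0 wuv) => ->; rewrite eqxx; last rewrite eq_sym.
  by rewrite (last_separated suv).
by rewrite (last_separated suv).
Qed.

Lemma wd_std_take i w : wd (take i (std w)) = wd (take i w).
Proof. by rewrite /wd [std w]stdE -map_take std_map_rank // => x /mem_take. Qed.

Lemma wd_std_drop i w : wd (drop i (std w)) = wd (drop i w).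
Proof. by rewrite /wd [std w]stdE -map_drop std_map_rank // => x /mem_drop. Qed.

Lemma rank_max_letter w : w != [::] -> rank_in w (max_letter w) = size w.
Proof.
move=> w0; rewrite /rank_in (eq_in_count (a2 := predT)) ?count_predT // => x.
exact: max_letter_geq.
Qed.

(** The letter n = |w| of std(w) stands where the maximal letter of w stands, so the index bounds of
    Δ≺ and Δ≻ become a condition on the side of the cut containing that letter. *)
Lemma index_size_std w i : uniq w -> w != [::] ->
  (index (size w) (std w) < i)%N = (max_letter w \in take i w).
Proof.
move=> uw w0; rewrite -(rank_max_letter w0) stdE -in_take ?map_f ?max_letter_mem //.
rewrite -map_take; apply/mapP/idP => [[x xw e]|mw]; last by exists (max_letter w).
by rewrite (rank_in_inj (max_letter_mem w0) (mem_take xw) e).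
Qed.

Lemma mem_take_drop (T : eqType) i (w : seq T) x : uniq w -> x \in w ->
  (x \in drop i w) = (x \notin take i w).
Proof.
rewrite -{1 2}[w](cat_take_drop i) cat_uniq mem_cat => /and3P[_ /hasPn h _].
have [xd _|_] := boolP (x \in drop i w); first by rewrite (negbTE (h x xd)).
by rewrite orbF => ->.
Qed.

Lemma index_size_std_lt w : uniq w -> w != [::] -> (index (size w) (std w) < size w)%N.
Proof. by move=> uw w0; rewrite index_size_std // take_size max_letter_mem. Qed.

(** The sum may run over all cuts: the cut with empty right part contributes 0, because the empty
    word stands for 0. In [dsucc_wd] the same holds for an empty left part. *)
Lemma dprec_wd w : uniq w -> Dp (wd w) =
  \sum_(p <- splits w | max_letter w \in p.1) wd p.1 ⊗ wd p.2.
Proof.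
move=> uw; have [->|w0] := eqVneq w [::].
  by rewrite wd0 linear0 big_cons big_nil.
have [U -> vU] := wdU uw w0; rewrite [LHS]linextU /fqsym_dprec_basis /= vU.
pose g x y := if max_letter w \in x then wd x ⊗ wd y else 0.
transitivity (\sum_(p <- splits w) g p.1 p.2); last by rewrite [RHS]big_mkcond.
have g0 : g w [::] = 0 by rewrite /g wd0 tens0r if_same.
rewrite size_std tens_lock (big_splitsE g) big_nat_recr // drop_size take_size.
rewrite [g w _]g0 /= [in RHS]addr0.
rewrite (big_nat_widenl _ 0) // big_mkcond; apply: eq_bigr => i _ /=.
by rewrite /g -index_size_std // -2!/(wd _) wd_std_take wd_std_drop.
Qed.

Lemma dsucc_wd w : uniq w -> Ds (wd w) =
  \sum_(p <- splits w | max_letter w \in p.2) wd p.1 ⊗ wd p.2.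
Proof.
move=> uw; have [->|w0] := eqVneq w [::].
  by rewrite wd0 linear0 big_cons big_nil.
have [U -> vU] := wdU uw w0; rewrite [LHS]linextU /fqsym_dsucc_basis /= vU.
pose g x y := if max_letter w \in y then wd x ⊗ wd y else 0.
transitivity (\sum_(p <- splits w) g p.1 p.2); last by rewrite [RHS]big_mkcond.
have iw := index_size_std_lt uw w0.
rewrite size_std tens_lock (big_splitsE g).
rewrite (big_nat_widenl _ 0) // (big_nat_widen _ _ _ _ _ (leqW iw)) big_mkcond.
apply: eq_bigr => -[|i] _ /=; first by rewrite /g take0 wd0 tens0l if_same.
rewrite /g mem_take_drop ?max_letter_mem // -index_size_std // -leqNgt ltnS.
by rewrite -2!/(wd _) wd_std_take wd_std_drop.
Qed.

Lemma dred_wd w : uniq w -> Dt (wd w) = \sum_(p <- splits w) wd p.1 ⊗ wd p.2.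
Proof.
move=> uw; have [->|w0] := eqVneq w [::].
  by rewrite wd0 (lin0 (lin_dred fq (@lin_id K _))) big_seq1 wd0 tens0r.
rewrite ldredE dprec_wd // dsucc_wd // [RHS](bigID (fun p => max_letter w \in p.1)) /=.
congr (_ + _); rewrite big_seq_cond [RHS]big_seq_cond; apply: eq_bigl => p.
have [/mem_splits pw|//] := boolP (p \in _); rewrite /=.
have mw := max_letter_mem w0; move: uw mw; rewrite -pw cat_uniq mem_cat.
case/and3P=> _ /hasPn h _; set m := max_letter _.
by have [/h /negbTE ->|_] := boolP (m \in p.2); [|rewrite orbF => ->].
Qed.

End FQSymWords.

(** * The dendriform algebra (FQSym)_+ *)

Section FQSymBidendriform.

Variable K : fieldType.

Local Notation fq := (fqsym_bidend K).
Local Notation wd := (@wd K).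
Local Notation shuffle_sum := (shuffle_sum K).
Local Notation half_sum := (half_sum K).
Local Notation "a ≺ b" := (bprec fq (a ⊗ b)).
Local Notation "a ≻ b" := (bsucc fq (a ⊗ b)).
Local Notation "a ⋅ b" := (lbmul fq a b).
Local Notation Dp := (dprec fq).
Local Notation Ds := (dsucc fq).
Local Notation Dt := (ldred fq).

Lemma separatedI u v : uniq u -> uniq v ->
  (forall x y, x \in u -> y \in v -> x < y)%N -> separated u v.
Proof.
move=> uu uv h; split=> //; rewrite cat_uniq uu uv andbT /=.
by apply/hasPn => x xv; apply/negP => xu; have := h x x xu xv; rewrite ltnn.
Qed.

Lemma separated_sub u v u' v' : separated u v -> uniq u' -> uniq v' ->
  {subset u' <= u} -> {subset v' <= v} -> separated u' v'.
Proof.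
move=> suv uu uv su sv; apply: separatedI => // x y xu yv.
by case: suv => _; apply; [apply: su | apply: sv].
Qed.

Lemma mem_shuffles u v s x : s \in shuffles u v -> (x \in s) = (x \in u) || (x \in v).
Proof. by move=> /perm_shuffles /perm_mem ->; rewrite mem_cat. Qed.

Lemma uniq_shuffles u v s : separated u v -> s \in shuffles u v -> uniq s.
Proof. by move=> [uuv _] /perm_shuffles /perm_uniq ->. Qed.

Lemma separated_shuffles_l u v w s : separated u v -> separated u w -> separated v w ->
  s \in shuffles u v -> separated s w.
Proof.
move=> suv suw svw hs; have [_ uw] := separated_uniq suw.
apply: separatedI => //; first exact: uniq_shuffles suv hs.
move=> x y; rewrite (mem_shuffles _ hs) => /orP[]; [case: suw => _|case: svw => _]; exact.
Qed.

Lemma separated_shuffles_r u v w s : separated u v -> separated u w -> separated v w ->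
  s \in shuffles v w -> separated u s.
Proof.
move=> suv suw svw hs; have [uu _] := separated_uniq suw.
apply: separatedI => //; first exact: uniq_shuffles svw hs.
move=> x y xu; rewrite (mem_shuffles _ hs) => /orP[]; move: xu; [case: suv => _|case: suw => _]; exact.
Qed.

Lemma letters_perm_word (U : perm_word_pos) x : x \in val U -> (1 <= x <= size (val U))%N.
Proof. by have /andP[/perm_mem -> _] := valP U; rewrite mem_iota add1n ltnS. Qed.

(** Shifting V and W makes the three alphabets separated; the shift does not change the represented
    basis vectors. *)
Lemma basis_words (U V W : perm_word_pos) : exists u v w,
  [/\ << U >> = wd u, << V >> = wd v & << W >> = wd w] /\
  [/\ separated u v, separated u w & separated v w] /\
  [/\ u != [::], v != [::] & w != [::]].
Proof.
have un (Z : perm_word_pos) : uniq (val Z).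
  by have /andP[/perm_word_uniq] := valP Z.
have ush k (Z : perm_word_pos) : uniq (shift k (val Z)).
  by rewrite map_inj_uniq // => x y; apply: addnI.
have n0 (Z : perm_word_pos) : val Z != [::] by have /andP[] := valP Z.
have nsh k (Z : perm_word_pos) : shift k (val Z) != [::].
  by rewrite -size_eq0 size_map size_eq0.
exists (val U), (shift (size (val U)) (val V)),
  (shift (size (val U) + size (val V)) (val W)).
split; first by rewrite !wd_shift !wd_basis.
split; last by split.
split; apply: separatedI => // x y.
- move=> /letters_perm_word xu /mapP[z /letters_perm_word zv ->]; lia.
- move=> /letters_perm_word xu /mapP[z /letters_perm_word zv ->]; lia.
- by move=> /mapP[t /letters_perm_word tu ->] /mapP[z /letters_perm_word zv ->]; lia.
Qed.

(** In an iterated half-shuffle, the conditions on the inner and the outer shuffle amount to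
    prescribing the last letter of the final word. *)
Lemma last_nested_l s t r x : separated s t -> s != [::] -> t != [::] ->
  r \in shuffles s t -> x \in s ->
  (last 0%N s == x) && (last 0%N r == last 0%N s) = (last 0%N r == x).
Proof.
move=> st s0 t0 rst xs.
case: (last_shuffles 0%N s0 t0 rst) => ->; rewrite ?eqxx ?andbT //.
rewrite [X in _ && X]eq_sym (last_separated st) // andbF; apply/esym/negP => /eqP tx.
by apply: (separated_disj st xs); rewrite -tx last_mem_neq0.
Qed.

Lemma last_nested_r s t r x : separated s t -> s != [::] -> t != [::] ->
  r \in shuffles s t -> x \in t ->
  (last 0%N t == x) && (last 0%N r == last 0%N t) = (last 0%N r == x).
Proof.
move=> st s0 t0 rst xt.
case: (last_shuffles 0%N s0 t0 rst) => ->; rewrite ?eqxx ?andbT //.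
rewrite (last_separated st) // andbF; apply/esym/negP => /eqP sx.
by apply: (separated_disj st (last_mem_neq0 s0)); rewrite sx.
Qed.

Definition wd_last x w : {malg K[perm_word_pos]} :=
  if last 0%N w == x then wd w else 0.

Lemma half_sumE x u v : half_sum x u v = \sum_(w <- shuffles u v) wd_last x w.
Proof. exact: big_mkcond. Qed.

Section ThreeWords.

Variables u v w : seq nat.
Hypotheses (suv : separated u v) (suw : separated u w) (svw : separated v w).
Hypotheses (u0 : u != [::]) (v0 : v != [::]) (w0 : w != [::]).

Lemma half_sum_left x : x \in u ++ v ->
  \sum_(s <- shuffles u v | last 0%N s == x) half_sum (last 0%N s) s w =
  \sum_(s <- shuffles u v) \sum_(r <- shuffles s w) wd_last x r.
Proof.
move=> xuv; rewrite big_mkcond big_seq [RHS]big_seq; apply: eq_bigr => s hs.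
transitivity (\sum_(r <- shuffles s w)
    if (last 0%N s == x) && (last 0%N r == last 0%N s) then wd r else 0).
  by case: (last 0%N s == x) => /=; rewrite ?half_sumE // big1.
rewrite big_seq [RHS]big_seq; apply: eq_bigr => r hr.
rewrite (last_nested_l _ _ _ hr) //.
- exact: separated_shuffles_l hs.
- exact: shuffles_neq0 hs u0.
- by rewrite (mem_shuffles _ hs) -mem_cat.
Qed.

Lemma half_sum_right x : x \in v ++ w ->
  \sum_(s <- shuffles v w | last 0%N s == x) half_sum (last 0%N s) u s =
  \sum_(s <- shuffles v w) \sum_(r <- shuffles u s) wd_last x r.
Proof.
move=> xvw; rewrite big_mkcond big_seq [RHS]big_seq; apply: eq_bigr => s hs.
transitivity (\sum_(r <- shuffles u s)
    if (last 0%N s == x) && (last 0%N r == last 0%N s) then wd r else 0).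
  by case: (last 0%N s == x) => /=; rewrite ?half_sumE // big1.
rewrite big_seq [RHS]big_seq; apply: eq_bigr => r hr.
rewrite (last_nested_r _ _ _ hr) //.
- exact: separated_shuffles_r hs.
- exact: shuffles_neq0 hs v0.
- by rewrite (mem_shuffles _ hs) -mem_cat.
Qed.

(** In each of the three axioms both sides are the sum of the shuffles of u, v, w that end with the
    last letter of u, of v, of w respectively. *)
Lemma dend_words :
  [/\ (wd u ≺ wd v) ≺ wd w = wd u ≺ (wd v ⋅ wd w),
      (wd u ≻ wd v) ≺ wd w = wd u ≻ (wd v ≺ wd w)
    & (wd u ⋅ wd v) ≻ wd w = wd u ≻ (wd v ≻ wd w)].
Proof.
have prec_l (P : pred (seq nat)) : (\sum_(s <- shuffles u v | P s) wd s) ≺ wd w =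
    \sum_(s <- shuffles u v | P s) half_sum (last 0%N s) s w.
  rewrite (lin_sumE (f := fun z => z ≺ wd w)); last by lin.
  rewrite big_seq_cond [RHS]big_seq_cond; apply: eq_bigr => s /andP[hs _].
  by rewrite bprec_wd //; [apply: separated_shuffles_l hs | apply: shuffles_neq0 hs u0].
have succ_r (P : pred (seq nat)) : wd u ≻ (\sum_(s <- shuffles v w | P s) wd s) =
    \sum_(s <- shuffles v w | P s) half_sum (last 0%N s) u s.
  rewrite (lin_sumE (f := fun z => wd u ≻ z)); last by lin.
  rewrite big_seq_cond [RHS]big_seq_cond; apply: eq_bigr => s /andP[hs _].
  by rewrite bsucc_wd //; [apply: separated_shuffles_r hs | apply: shuffles_neq0 hs v0].
split.
- rewrite bprec_wd // bmul_wd // prec_l half_sum_left ?mem_cat ?last_mem_neq0 //.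
  rewrite big_shuffles_assoc (lin_sumE (f := fun z => wd u ≺ z)); last by lin.
  rewrite big_seq [RHS]big_seq; apply: eq_bigr => s hs.
  by rewrite bprec_wd ?half_sumE //; [apply: separated_shuffles_r hs | apply: shuffles_neq0 hs v0].
- rewrite bsucc_wd // bprec_wd // prec_l succ_r half_sum_left ?half_sum_right //.
  + exact: big_shuffles_assoc.
  + by rewrite mem_cat last_mem_neq0.
  + by rewrite mem_cat last_mem_neq0 ?orbT.
- rewrite bmul_wd // bsucc_wd // succ_r half_sum_right ?mem_cat ?last_mem_neq0 ?orbT //.
  rewrite -big_shuffles_assoc (lin_sumE (f := fun z => z ≻ wd w)); last by lin.
  rewrite big_seq [RHS]big_seq; apply: eq_bigr => s hs.
  by rewrite bsucc_wd ?half_sumE //; [apply: separated_shuffles_l hs | apply: shuffles_neq0 hs u0].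
Qed.

End ThreeWords.

Lemma eq_trilinear (X : choiceType) (W : lmodType K)
    (f g : {malg K[X]} -> {malg K[X]} -> {malg K[X]} -> W) :
  trilinear_map f -> trilinear_map g ->
  (forall u v w, f << u >> << v >> << w >> = g << u >> << v >> << w >>) ->
  forall x y z, f x y z = g x y z.
Proof.
move=> [f1 f2 f3] [g1 g2 g3] efg x y z.
apply: (eq_linear (f1 y z) (g1 y z)) => u.
by apply: (eq_bilinear (f := f << u >>) (g := g << u >>)).
Qed.

Lemma fqsym_dendriform_algebra : dendriform_algebra fq.
Proof.
suff h a b c : [/\ (a ≺ b) ≺ c = a ≺ (b ⋅ c), (a ≻ b) ≺ c = a ≻ (b ≺ c)
    & (a ⋅ b) ≻ c = a ≻ (b ≻ c)].
  by move=> a b c; have := h a b c; rewrite !lbmulE -!tens_lock.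
split.
- apply: (eq_trilinear (f := fun a b c => (a ≺ b) ≺ c)
                       (g := fun a b c => a ≺ (b ⋅ c))).
  + by trilin.
  + by trilin.
  move=> U V W; have [u [v [w [[-> -> ->] [[? ? ?] [? ? ?]]]]]] := basis_words U V W.
  by have [||||||h _ _] := @dend_words u v w; [..|exact: h].
- apply: (eq_trilinear (f := fun a b c => (a ≻ b) ≺ c)
                       (g := fun a b c => a ≻ (b ≺ c))).
  + by trilin.
  + by trilin.
  move=> U V W; have [u [v [w [[-> -> ->] [[? ? ?] [? ? ?]]]]]] := basis_words U V W.
  by have [||||||_ h _] := @dend_words u v w; [..|exact: h].
- apply: (eq_trilinear (f := fun a b c => (a ⋅ b) ≻ c)
                       (g := fun a b c => a ≻ (b ≻ c))).
  + by trilin.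
  + by trilin.
  move=> U V W; have [u [v [w [[-> -> ->] [[? ? ?] [? ? ?]]]]]] := basis_words U V W.
  by have [||||||_ _ h] := @dend_words u v w; [..|exact: h].
Qed.

Section SweedlerWords.

Variables (W : lmodType K).
Variable E : {malg K[perm_word_pos]} -> {malg K[perm_word_pos]} -> W.
Hypothesis bE : bilinear_map E.
Variable w : seq nat.
Hypothesis uw : uniq w.

Let big_tens (P : pred (seq nat * seq nat)) :
  lsw (\sum_(p <- splits w | P p) wd p.1 ⊗ wd p.2) E =
  \sum_(p <- splits w) if P p then E (wd p.1) (wd p.2) else 0.
Proof.
rewrite sw_bigsum [LHS]big_mkcond; apply: eq_bigr => p _.
by case: (P p); rewrite ?sw_tens.
Qed.

Lemma sw_dprec_wd : lsw (Dp (wd w)) E =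
  \sum_(p <- splits w) if max_letter w \in p.1 then E (wd p.1) (wd p.2) else 0.
Proof. by rewrite dprec_wd // big_tens. Qed.

Lemma sw_dsucc_wd : lsw (Ds (wd w)) E =
  \sum_(p <- splits w) if max_letter w \in p.2 then E (wd p.1) (wd p.2) else 0.
Proof. by rewrite dsucc_wd // big_tens. Qed.

Lemma sw_dred_wd : lsw (Dt (wd w)) E = \sum_(p <- splits w) E (wd p.1) (wd p.2).
Proof. by rewrite dred_wd // big_tens. Qed.

Hypothesis w0 : w != [::].

Let big_proper (P : seq nat -> seq nat -> bool) :
  \sum_(p <- splits w) (if P p.1 p.2 then E (wd p.1) (wd p.2) else 0) =
  \sum_(p <- proper_splits w) if P p.1 p.2 then E (wd p.1) (wd p.2) else 0.
Proof.
rewrite (big_proper_splits (fun x y => if P x y then E (wd x) (wd y) else 0) w0).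
rewrite wd0 (lin0 (f := fun x => E x _)) ?(lin0 (f := E _)) ?if_same ?add0r //.
- by case: bE.
- by case: bE.
Qed.

Lemma sw_dprec_proper : lsw (Dp (wd w)) E =
  \sum_(p <- proper_splits w) if max_letter w \in p.1 then E (wd p.1) (wd p.2) else 0.
Proof. by rewrite sw_dprec_wd (big_proper (fun x y => max_letter w \in x)). Qed.

Lemma sw_dsucc_proper : lsw (Ds (wd w)) E =
  \sum_(p <- proper_splits w) if max_letter w \in p.2 then E (wd p.1) (wd p.2) else 0.
Proof. by rewrite sw_dsucc_wd (big_proper (fun x y => max_letter w \in y)). Qed.

Lemma sw_dred_proper :
  lsw (Dt (wd w)) E = \sum_(p <- proper_splits w) E (wd p.1) (wd p.2).
Proof. by rewrite sw_dred_wd (big_proper (fun _ _ => true)). Qed.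

End SweedlerWords.

End FQSymBidendriform.

(** * The dendriform coalgebra (FQSym)_+ and the coproducts of half-shuffles *)

Section FQSymCoalgebra.

Variable K : fieldType.

Local Notation fq := (fqsym_bidend K).
Local Notation wd := (@wd K).
Local Notation shuffle_sum := (shuffle_sum K).
Local Notation half_sum := (half_sum K).
Local Notation "a ≺ b" := (bprec fq (a ⊗ b)).
Local Notation "a ≻ b" := (bsucc fq (a ⊗ b)).
Local Notation "a ⋅ b" := (lbmul fq a b).
Local Notation Dp := (dprec fq).
Local Notation Ds := (dsucc fq).
Local Notation Dt := (ldred fq).

Section MaxLetterSplits.

Variable w : seq nat.
Hypothesis uw : uniq w.

Local Notation m := (max_letter w).

Lemma mem_splits_uniq p : p \in splits w ->
  [/\ uniq p.1, uniq p.2, {subset p.1 <= w}, {subset p.2 <= w} &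
      forall x, x \in p.1 -> x \in p.2 -> False].
Proof.
move=> /mem_splits pw; have := uw; rewrite -pw cat_uniq => /and3P[u1 /hasPn h u2].
split=> // [x|x|x x1 /h /negP//]; rewrite mem_cat => ->; rewrite ?orbT //.
Qed.

(* Refining a cut of w whose left (right) part contains the maximal letter:   *)
(* this letter is still the maximal one of that part.                         *)
Lemma splits_max_l p (x : seq nat) : p \in splits w -> {subset x <= p.1} ->
  (m \in p.1) && (max_letter p.1 \in x) = (m \in x).
Proof.
move=> /mem_splits_uniq[_ _ s1 _ _] xp; apply/andP/idP => [[m1]|mx].
  by rewrite (max_letter_sub s1 m1).
by have m1 := xp _ mx; rewrite (max_letter_sub s1 m1).
Qed.

Lemma splits_max_r p (x : seq nat) : p \in splits w -> {subset x <= p.2} ->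
  (m \in p.2) && (max_letter p.2 \in x) = (m \in x).
Proof.
move=> /mem_splits_uniq[_ _ _ s2 _] xp; apply/andP/idP => [[m1]|mx].
  by rewrite (max_letter_sub s2 m1).
by have m1 := xp _ mx; rewrite (max_letter_sub s2 m1).
Qed.

End MaxLetterSplits.

Lemma if_and (V : nmodType) (b c : bool) (x : V) :
  (if b then (if c then x else 0) else 0) = if b && c then x else 0.
Proof. by case: b. Qed.

Lemma if_sum (V : nmodType) (I : Type) (r : seq I) (b : bool) (F : I -> V) :
  (if b then \sum_(i <- r) F i else 0) = \sum_(i <- r) if b then F i else 0.
Proof. by case: b => //; rewrite big1. Qed.

Lemma splits_sub1 (w : seq nat) p : p \in splits w -> {subset p.1 <= w}.
Proof. by move=> /mem_splits <- x; rewrite mem_cat => ->. Qed.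

Lemma splits_sub2 (w : seq nat) p : p \in splits w -> {subset p.2 <= w}.
Proof. by move=> /mem_splits <- x; rewrite mem_cat => ->; rewrite orbT. Qed.

(** In each of the three axioms both sides are the sum over the factorizations w = xyz in which the
    maximal letter of w lies in x, in y, in z respectively. *)
Lemma coalg_words w : uniq w ->
  [/\ \sw_(a1, a2 <- Dp (wd w)) \sw_(x, y <- Dp a1) (x ⊗ (y ⊗ a2))
        = \sw_(a1, a2 <- Dp (wd w)) (a1 ⊗ Dt a2),
      \sw_(a1, a2 <- Dp (wd w)) \sw_(x, y <- Ds a1) (x ⊗ (y ⊗ a2))
        = \sw_(a1, a2 <- Ds (wd w)) (a1 ⊗ Dp a2)
    & \sw_(a1, a2 <- Ds (wd w)) \sw_(x, y <- Dt a1) (x ⊗ (y ⊗ a2))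
        = \sw_(a1, a2 <- Ds (wd w)) (a1 ⊗ Ds a2)].
Proof.
move=> uw; set m := max_letter w.
pose G x y z := wd x ⊗ (wd y ⊗ wd z).
have tens_sw x (t : {malg K[(perm_word_pos * perm_word_pos)%type]}) :
    x ⊗ t = \sw_(y, z <- t) (x ⊗ (y ⊗ z)).
  by rewrite -(sw_app (f := fun t => x ⊗ t)) ?sw_id //; lin.
split.
- rewrite [LHS]sw_dprec_wd; [|by bilin|exact: uw].
  rewrite [RHS]sw_dprec_wd; [|by bilin|exact: uw].
  pose G' x y z := if m \in x then G x y z else 0.
  transitivity (\sum_(p <- splits w) \sum_(q <- splits p.1) G' q.1 q.2 p.2).
    rewrite big_seq [RHS]big_seq; apply: eq_bigr => p pw.
    have [u1 _ _ _ _] := mem_splits_uniq uw pw.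
    rewrite sw_dprec_wd; [|by bilin|exact: u1].
    rewrite if_sum big_seq [RHS]big_seq; apply: eq_bigr => q qp.
    by rewrite if_and (splits_max_l uw pw) //; apply: splits_sub1.
  rewrite big_splits_assoc big_seq [RHS]big_seq; apply: eq_bigr => p pw.
  have [_ u2 _ _ _] := mem_splits_uniq uw pw.
  by rewrite tens_sw sw_dred_wd; [rewrite if_sum|bilin|exact: u2].
- rewrite [LHS]sw_dprec_wd; [|by bilin|exact: uw].
  rewrite [RHS]sw_dsucc_wd; [|by bilin|exact: uw].
  pose G' x y z := if m \in y then G x y z else 0.
  transitivity (\sum_(p <- splits w) \sum_(q <- splits p.1) G' q.1 q.2 p.2).
    rewrite big_seq [RHS]big_seq; apply: eq_bigr => p pw.
    have [u1 _ _ _ _] := mem_splits_uniq uw pw.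
    rewrite sw_dsucc_wd; [|by bilin|exact: u1].
    rewrite if_sum big_seq [RHS]big_seq; apply: eq_bigr => q qp.
    by rewrite if_and (splits_max_l uw pw) //; apply: splits_sub2.
  rewrite big_splits_assoc big_seq [RHS]big_seq; apply: eq_bigr => p pw.
  have [_ u2 _ _ _] := mem_splits_uniq uw pw.
  rewrite tens_sw sw_dprec_wd; [|by bilin|exact: u2].
  rewrite if_sum big_seq [RHS]big_seq; apply: eq_bigr => q qp.
  by rewrite if_and (splits_max_r uw pw) //; apply: splits_sub1.
- rewrite [LHS]sw_dsucc_wd; [|by bilin|exact: uw].
  rewrite [RHS]sw_dsucc_wd; [|by bilin|exact: uw].
  pose G' x y z := if m \in z then G x y z else 0.
  transitivity (\sum_(p <- splits w) \sum_(q <- splits p.1) G' q.1 q.2 p.2).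
    rewrite big_seq [RHS]big_seq; apply: eq_bigr => p pw.
    have [u1 _ _ _ _] := mem_splits_uniq uw pw.
    by rewrite sw_dred_wd; [rewrite if_sum|bilin|exact: u1].
  rewrite big_splits_assoc big_seq [RHS]big_seq; apply: eq_bigr => p pw.
  have [_ u2 _ _ _] := mem_splits_uniq uw pw.
  rewrite tens_sw sw_dsucc_wd; [|by bilin|exact: u2].
  rewrite if_sum big_seq [RHS]big_seq; apply: eq_bigr => q qp.
  by rewrite if_and (splits_max_r uw pw) //; apply: splits_sub2.
Qed.

Lemma fqsym_dendriform_coalgebra : dendriform_coalgebra fq.
Proof.
move=> a; rewrite !sw_lock !tens_lock dred_lock.
have basis U : exists2 w, << U >> = wd w & uniq w.
  exists (val U); first exact: wd_basis.
  by have /andP[/perm_word_uniq] := valP U.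
split.
- move: a; apply: eq_linear; [by lin|by lin|] => U.
  by have [w -> uw] := basis U; have [h _ _] := coalg_words uw; exact: h.
- move: a; apply: eq_linear; [by lin|by lin|] => U.
  by have [w -> uw] := basis U; have [_ h _] := coalg_words uw; exact: h.
- move: a; apply: eq_linear; [by lin|by lin|] => U.
  by have [w -> uw] := basis U; have [_ _ h] := coalg_words uw; exact: h.
Qed.

Section ShuffleCoproduct.

Variables u v : seq nat.
Hypothesis suv : separated u v.
Hypotheses (u0 : u != [::]) (v0 : v != [::]).

(** Treats both half coproducts at once: the part that must contain the maximal letter is the right
    one for [true] (Δ≻) and the left one for [false] (Δ≺). *)
Definition side (s : bool) (x y : seq nat) := if s then y else x.

Lemma max_letter_shuffles w : w \in shuffles u v -> max_letter w = max_letter v.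
Proof.
move=> hw; apply: max_letterE => [|x]; rewrite (mem_shuffles _ hw).
  by rewrite max_letter_mem ?orbT.
case/orP=> [xu|]; last exact: max_letter_geq.
by case: suv => _ h; apply/ltnW/h/max_letter_mem.
Qed.

(** Besides [big_splits_shuffles]: the maximal letter of a shuffle belongs to v, so its side is
    decided by the cut of v, while the last letter only concerns the right pieces. *)
Lemma cop_half_sum s x :
  \sum_(w <- shuffles u v | last 0%N w == x)
    \sum_(p <- splits w | max_letter w \in side s p.1 p.2) wd p.1 ⊗ wd p.2 =
  \sum_(p <- splits u) \sum_(q <- splits v)
    if max_letter v \in side s q.1 q.2
    then shuffle_sum p.1 q.1 ⊗ half_sum x p.2 q.2 else 0.
Proof.
pose f a b := if (last 0%N (a ++ b) == x) && (max_letter v \in side s a b)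
              then wd a ⊗ wd b else 0.
transitivity (\sum_(w <- shuffles u v) \sum_(p <- splits w) f p.1 p.2).
  rewrite big_mkcond big_seq [RHS]big_seq; apply: eq_bigr => w hw.
  rewrite big_mkcond if_sum big_seq [RHS]big_seq; apply: eq_bigr => p /mem_splits pw.
  by rewrite if_and /f pw max_letter_shuffles.
have [uu uv] := separated_uniq suv.
rewrite big_splits_shuffles big_seq [RHS]big_seq; apply: eq_bigr => p pu.
rewrite big_seq [RHS]big_seq; apply: eq_bigr => q qv.
rewrite /shuffle_sum (lin_sumE (f := fun z => z ⊗ _)); last by lin.
rewrite if_sum big_seq [RHS]big_seq; apply: eq_bigr => a ha.
rewrite half_sumE (lin_sumE (f := fun z => _ ⊗ z)); last by lin.
rewrite if_sum big_seq [RHS]big_seq; apply: eq_bigr => b hb.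
(* An empty right piece contributes 0; otherwise the last letter of a ++ b is that of b. *)
rewrite /f /wd_last {f}; have [->|b0] := eqVneq b [::].
  by rewrite wd0 tens0r !if_same tens0r if_same.
have -> : last 0%N (a ++ b) = last 0%N b by rewrite last_cat; case: b b0 {hb}.
have -> : (max_letter v \in side s a b) = (max_letter v \in side s q.1 q.2).
  have mu (z : seq nat) : {subset z <= u} -> (max_letter v \in z) = false.
    by move=> zu; apply/negP => /zu mu; apply: (separated_disj suv mu (max_letter_mem v0)).
  rewrite /side; case: s.
    by rewrite (mem_shuffles _ hb) (mu _ (splits_sub2 pu)).
  by rewrite (mem_shuffles _ ha) (mu _ (splits_sub1 pu)).
by rewrite andbC; case: (_ \in _) => //=; case: ifP; rewrite ?tens0r.
Qed.

Let shuffle_sum0l x : shuffle_sum [::] x = wd x.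
Proof. by rewrite /shuffle_sum shuffles0l big_seq1. Qed.

Let shuffle_sum0r x : shuffle_sum x [::] = wd x.
Proof. by rewrite /shuffle_sum shuffles0r big_seq1. Qed.

Let half_sum0l l x : half_sum l [::] x = wd_last K l x.
Proof. by rewrite half_sumE shuffles0l big_seq1. Qed.

Let half_sum0r l x : half_sum l x [::] = wd_last K l x.
Proof. by rewrite half_sumE shuffles0r big_seq1. Qed.

(** Separating the cuts of u and v that have an empty part produces, one by one, the terms of the
    bidendriform compatibilities. *)
Lemma cop_half_sum_proper s l :
  \sum_(w <- shuffles u v | last 0%N w == l)
    \sum_(p <- splits w | max_letter w \in side s p.1 p.2) wd p.1 ⊗ wd p.2 =
  (if s then wd u ⊗ wd_last K l v else wd v ⊗ wd_last K l u)
  + \sum_(q <- proper_splits v) (if max_letter v \in side s q.1 q.2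
      then wd q.1 ⊗ half_sum l u q.2 else 0)
  + \sum_(q <- proper_splits v) (if max_letter v \in side s q.1 q.2
      then shuffle_sum u q.1 ⊗ wd_last K l q.2 else 0)
  + \sum_(p <- proper_splits u) (if s then wd p.1 ⊗ half_sum l p.2 v
      else shuffle_sum p.1 v ⊗ wd_last K l p.2)
  + \sum_(p <- proper_splits u) \sum_(q <- proper_splits v)
      if max_letter v \in side s q.1 q.2
      then shuffle_sum p.1 q.1 ⊗ half_sum l p.2 q.2 else 0.
Proof.
rewrite cop_half_sum.
pose Psi p1 p2 q1 q2 := if max_letter v \in side s q1 q2
    then shuffle_sum p1 q1 ⊗ half_sum l p2 q2 else 0.
rewrite (big_proper_splits (fun x y => \sum_(q <- splits v) Psi x y q.1 q.2) u0).
rewrite (big_proper_splits (Psi [::] u) v0) (big_proper_splits (Psi u [::]) v0).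
under [X in _ + X]eq_bigr do rewrite (big_proper_splits (Psi _ _) v0).
have mv := max_letter_mem v0.
have wd_last0 : wd_last K l [::] = 0 by rewrite /wd_last wd0 if_same.
have Psi1 p1 p2 : Psi p1 p2 [::] v + Psi p1 p2 v [::] =
    if s then wd p1 ⊗ half_sum l p2 v else shuffle_sum p1 v ⊗ wd_last K l p2.
  by rewrite /Psi /side shuffle_sum0r half_sum0r; clear Psi; case: s; rewrite mv ?addr0 ?add0r.
rewrite !Psi1 shuffle_sum0l half_sum0l wd_last0 wd0 tens0r tens0l.
under [X in _ + X]eq_bigr do rewrite Psi1.
rewrite big_split /=.
have -> : \sum_(q <- proper_splits v) Psi [::] u q.1 q.2 =
    \sum_(q <- proper_splits v) (if max_letter v \in side s q.1 q.2
      then wd q.1 ⊗ half_sum l u q.2 else 0).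
  by apply: eq_bigr => q _; rewrite /Psi shuffle_sum0l.
have -> : \sum_(q <- proper_splits v) Psi u [::] q.1 q.2 =
    \sum_(q <- proper_splits v) (if max_letter v \in side s q.1 q.2
      then shuffle_sum u q.1 ⊗ wd_last K l q.2 else 0).
  by apply: eq_bigr => q _; rewrite /Psi half_sum0l.
rewrite /Psi; clear Psi Psi1.
by case: s; abel.
Qed.

End ShuffleCoproduct.

End FQSymCoalgebra.

(** * Compatibility of products and coproducts in (FQSym)_+ *)

Section FQSymCompat.

Variable K : fieldType.

Local Notation fq := (fqsym_bidend K).
Local Notation wd := (@wd K).
Local Notation shuffle_sum := (shuffle_sum K).
Local Notation half_sum := (half_sum K).
Local Notation "a ≺ b" := (bprec fq (a ⊗ b)).
Local Notation "a ≻ b" := (bsucc fq (a ⊗ b)).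
Local Notation "a ⋅ b" := (lbmul fq a b).
Local Notation Dp := (dprec fq).
Local Notation Ds := (dsucc fq).
Local Notation Dt := (ldred fq).

Section TwoWords.

Variables u v : seq nat.
Hypothesis suv : separated u v.
Hypotheses (u0 : u != [::]) (v0 : v != [::]).

Let uu : uniq u. Proof. by case: (separated_uniq suv). Qed.
Let uv : uniq v. Proof. by case: (separated_uniq suv). Qed.
Local Notation lu := (last 0%N u).
Local Notation lv := (last 0%N v).

Let proper_sub (w x y : seq nat) p : uniq w -> p \in proper_splits w ->
  [/\ uniq p.1, uniq p.2, {subset p.1 <= w}, {subset p.2 <= w} &
      [/\ p.1 != [::], p.2 != [::] & last 0%N p.2 = last 0%N w]].
Proof.
move=> uw /mem_proper_splits[pw p1 p2]; move: uw; rewrite -pw cat_uniq => /and3P[-> _ ->].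
split=> //; try by move=> z zp; rewrite mem_cat zp ?orbT.
by split=> //; rewrite last_cat; case: (p.2) p2.
Qed.

Let sub_l p1 : uniq p1 -> {subset p1 <= u} -> separated p1 v.
Proof. by move=> h1 h2; apply: separated_sub suv _ _ _ _. Qed.

Let sub_r q1 : uniq q1 -> {subset q1 <= v} -> separated u q1.
Proof. by move=> h1 h2; apply: separated_sub suv _ _ _ _. Qed.

Let wd_last_r l w : last 0%N w = l -> wd_last K l w = wd w.
Proof. by move=> <-; rewrite /wd_last eqxx. Qed.

Let wd_last_uv w : w != [::] -> {subset w <= u} -> wd_last K lv w = 0.
Proof.
move=> w0 wu; rewrite /wd_last; case: eqP => // e.
by case: (separated_disj suv (wu _ (last_mem_neq0 w0))); rewrite e last_mem_neq0.
Qed.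

Let wd_last_vu w : w != [::] -> {subset w <= v} -> wd_last K lu w = 0.
Proof.
move=> w0 wv; rewrite /wd_last; case: eqP => // e.
by case: (separated_disj suv (last_mem_neq0 u0)); rewrite -e; apply/wv/last_mem_neq0.
Qed.

Let dsucc_half l : Ds (half_sum l u v) =
  \sum_(w <- shuffles u v | last 0%N w == l)
    \sum_(p <- splits w | max_letter w \in side true p.1 p.2) wd p.1 ⊗ wd p.2.
Proof.
rewrite (lin_sumE (f := Ds)); last exact: linearP.
rewrite big_seq_cond [RHS]big_seq_cond; apply: eq_bigr => w /andP[hw _].
exact/dsucc_wd/(uniq_shuffles suv hw).
Qed.

Let dprec_half l : Dp (half_sum l u v) =
  \sum_(w <- shuffles u v | last 0%N w == l)
    \sum_(p <- splits w | max_letter w \in side false p.1 p.2) wd p.1 ⊗ wd p.2.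
Proof.
rewrite (lin_sumE (f := Dp)); last exact: linearP.
rewrite big_seq_cond [RHS]big_seq_cond; apply: eq_bigr => w /andP[hw _].
exact/dprec_wd/(uniq_shuffles suv hw).
Qed.

Let inner_l (f : seq nat -> seq nat -> {malg K[(perm_word_pos * perm_word_pos)%type]})
    (E : {malg K[perm_word_pos]} -> {malg K[perm_word_pos]} ->
         {malg K[(perm_word_pos * perm_word_pos)%type]}) : bilinear_map E ->
  (forall p1 p2, separated p1 v -> separated p2 v -> p1 != [::] -> p2 != [::] ->
     {subset p2 <= u} -> last 0%N p2 = lu -> E (wd p1) (wd p2) = f p1 p2) ->
  lsw (Dt (wd u)) E = \sum_(p <- proper_splits u) f p.1 p.2.
Proof.
move=> bE Ef; rewrite sw_dred_proper; [|exact: bE|exact: uu|exact: u0].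
rewrite big_seq [RHS]big_seq; apply: eq_bigr => p.
move=> /(proper_sub [::] [::] uu)[h1 h2 s1 s2 [n1 n2 l2]].
by apply: Ef; [apply: sub_l|apply: sub_l|..].
Qed.

Let inner_r s (f : seq nat -> seq nat -> {malg K[(perm_word_pos * perm_word_pos)%type]})
    (E : {malg K[perm_word_pos]} -> {malg K[perm_word_pos]} ->
         {malg K[(perm_word_pos * perm_word_pos)%type]}) : bilinear_map E ->
  (forall q1 q2, uniq q1 -> uniq q2 -> {subset q1 <= v} -> {subset q2 <= v} ->
     q1 != [::] -> q2 != [::] -> last 0%N q2 = lv -> E (wd q1) (wd q2) = f q1 q2) ->
  lsw (if s then Ds (wd v) else Dp (wd v)) E =
  \sum_(q <- proper_splits v) if max_letter v \in side s q.1 q.2 then f q.1 q.2 else 0.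
Proof.
move=> bE Ef; transitivity (\sum_(q <- proper_splits v)
    if max_letter v \in side s q.1 q.2 then E (wd q.1) (wd q.2) else 0).
  case: s.
    by rewrite sw_dsucc_proper; [|exact: bE|exact: uv|exact: v0].
  by rewrite sw_dprec_proper; [|exact: bE|exact: uv|exact: v0].
rewrite big_seq [RHS]big_seq; apply: eq_bigr => q.
move=> /(proper_sub [::] [::] uv)[h1 h2 s1 s2 [n1 n2 l2]].
by rewrite Ef.
Qed.

Let inner_lr s (f : seq nat -> seq nat -> seq nat -> seq nat ->
                    {malg K[(perm_word_pos * perm_word_pos)%type]}) E :
  (forall x y, bilinear_map (fun a b => E x y a b)) ->
  (forall a b, bilinear_map (fun x y => E x y a b)) ->
  (forall p1 p2 q1 q2, separated p1 q1 -> separated p2 q2 ->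
     p1 != [::] -> p2 != [::] -> q1 != [::] -> q2 != [::] ->
     last 0%N p2 = lu -> last 0%N q2 = lv ->
     E (wd p1) (wd p2) (wd q1) (wd q2) = f p1 p2 q1 q2) ->
  \sw_(x, y <- Dt (wd u)) lsw (if s then Ds (wd v) else Dp (wd v)) (E x y) =
  \sum_(p <- proper_splits u) \sum_(q <- proper_splits v)
     if max_letter v \in side s q.1 q.2 then f p.1 p.2 q.1 q.2 else 0.
Proof.
move=> bE1 bE2 Ef; rewrite sw_dred_proper; [|split=> z; apply: lin_sw_fun => a b|exact: uu|exact: u0].
- rewrite big_seq [RHS]big_seq; apply: eq_bigr => p.
  move=> /(proper_sub [::] [::] uu)[h1 h2 s1 s2 [n1 n2 l2]].
  apply: inner_r => // q1 q2 k1 k2 t1 t2 m1 m2 r2; apply: Ef => //.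
  + by apply: separated_sub suv _ _ _ _.
  + by apply: separated_sub suv _ _ _ _.
- exact: (bE2 a b).1.
- exact: (bE2 a b).2.
Qed.

(** The formulas are the four cases of [cop_half_sum_proper], the last letter being that of u or of
    v and s being [true] or [false]. Terms whose right factor is a piece of the wrong word vanish,
    as they cannot end with the prescribed letter. *)
Lemma compat_words :
    [/\ Ds (wd u ≻ wd v) =
            \sw_(a1, a2 <- Dt (wd u)) \sw_(b1, b2 <- Ds (wd v)) ((a1 ⋅ b1) ⊗ (a2 ≻ b2))
          + \sw_(a1, a2 <- Dt (wd u)) (a1 ⊗ (a2 ≻ wd v))
          + \sw_(b1, b2 <- Ds (wd v)) (b1 ⊗ (wd u ≻ b2))
          + \sw_(b1, b2 <- Ds (wd v)) ((wd u ⋅ b1) ⊗ b2)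
          + wd u ⊗ wd v,
        Ds (wd u ≺ wd v) =
            \sw_(a1, a2 <- Dt (wd u)) \sw_(b1, b2 <- Ds (wd v)) ((a1 ⋅ b1) ⊗ (a2 ≺ b2))
          + \sw_(a1, a2 <- Dt (wd u)) (a1 ⊗ (a2 ≺ wd v))
          + \sw_(b1, b2 <- Ds (wd v)) (b1 ⊗ (wd u ≺ b2)),
        Dp (wd u ≻ wd v) =
            \sw_(a1, a2 <- Dt (wd u)) \sw_(b1, b2 <- Dp (wd v)) ((a1 ⋅ b1) ⊗ (a2 ≻ b2))
          + \sw_(b1, b2 <- Dp (wd v)) ((wd u ⋅ b1) ⊗ b2)
          + \sw_(b1, b2 <- Dp (wd v)) (b1 ⊗ (wd u ≻ b2))
      & Dp (wd u ≺ wd v) =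
            \sw_(a1, a2 <- Dt (wd u)) \sw_(b1, b2 <- Dp (wd v)) ((a1 ⋅ b1) ⊗ (a2 ≺ b2))
          + \sw_(a1, a2 <- Dt (wd u)) ((a1 ⋅ wd v) ⊗ a2)
          + \sw_(b1, b2 <- Dp (wd v)) (b1 ⊗ (wd u ≺ b2))
          + wd v ⊗ wd u].
Proof.
have mm s : \sw_(a1, a2 <- Dt (wd u))
      \sw_(b1, b2 <- if s then Ds (wd v) else Dp (wd v)) ((a1 ⋅ b1) ⊗ (a2 ≻ b2)) =
    \sum_(p <- proper_splits u) \sum_(q <- proper_splits v)
      if max_letter v \in side s q.1 q.2
      then shuffle_sum p.1 q.1 ⊗ half_sum lv p.2 q.2 else 0.
  apply: (inner_lr s (f := fun p1 p2 q1 q2 => shuffle_sum p1 q1 ⊗ half_sum lv p2 q2)).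
  - by move=> x y; bilin.
  - by move=> x y; bilin.
  - move=> p1 p2 q1 q2 s1 s2 p10 p20 q10 q20 lp lq.
    by rewrite (bmul_wd K s1 p10 q10) (bsucc_wd K s2 p20 q20) lq.
have mp s : \sw_(a1, a2 <- Dt (wd u))
      \sw_(b1, b2 <- if s then Ds (wd v) else Dp (wd v)) ((a1 ⋅ b1) ⊗ (a2 ≺ b2)) =
    \sum_(p <- proper_splits u) \sum_(q <- proper_splits v)
      if max_letter v \in side s q.1 q.2
      then shuffle_sum p.1 q.1 ⊗ half_sum lu p.2 q.2 else 0.
  apply: (inner_lr s (f := fun p1 p2 q1 q2 => shuffle_sum p1 q1 ⊗ half_sum lu p2 q2)).
  - by move=> x y; bilin.
  - by move=> x y; bilin.
  - move=> p1 p2 q1 q2 s1 s2 p10 p20 q10 q20 lp lq.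
    by rewrite (bmul_wd K s1 p10 q10) (bprec_wd K s2 p20 q20) lp.
have bs s : lsw (if s then Ds (wd v) else Dp (wd v)) (fun b1 b2 => b1 ⊗ (wd u ≻ b2)) =
    \sum_(q <- proper_splits v) if max_letter v \in side s q.1 q.2
      then wd q.1 ⊗ half_sum lv u q.2 else 0.
  apply: (inner_r s (f := fun q1 q2 => wd q1 ⊗ half_sum lv u q2)); first by bilin.
  move=> q1 q2 k1 k2 t1 t2 m1 m2 r2.
  by rewrite (bsucc_wd K (sub_r k2 t2) u0 m2) r2.
have bp s : lsw (if s then Ds (wd v) else Dp (wd v)) (fun b1 b2 => b1 ⊗ (wd u ≺ b2)) =
    \sum_(q <- proper_splits v) if max_letter v \in side s q.1 q.2
      then wd q.1 ⊗ half_sum lu u q.2 else 0.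
  apply: (inner_r s (f := fun q1 q2 => wd q1 ⊗ half_sum lu u q2)); first by bilin.
  move=> q1 q2 k1 k2 t1 t2 m1 m2 r2.
  by rewrite (bprec_wd K (sub_r k2 t2) u0 m2).
have bm s : lsw (if s then Ds (wd v) else Dp (wd v)) (fun b1 b2 => (wd u ⋅ b1) ⊗ b2) =
    \sum_(q <- proper_splits v) if max_letter v \in side s q.1 q.2
      then shuffle_sum u q.1 ⊗ wd_last K lv q.2 else 0.
  apply: (inner_r s (f := fun q1 q2 => shuffle_sum u q1 ⊗ wd_last K lv q2)); first by bilin.
  move=> q1 q2 k1 k2 t1 t2 m1 m2 r2.
  by rewrite (bmul_wd K (sub_r k1 t1) u0 m1) wd_last_r.
have bm0 s : \sum_(q <- proper_splits v) (if max_letter v \in side s q.1 q.2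
      then shuffle_sum u q.1 ⊗ wd_last K lu q.2 else 0) = 0.
  rewrite big_seq big1 // => q /(proper_sub [::] [::] uv)[h1 h2 s1 s2 [n1 n2 l2]].
  by rewrite wd_last_vu // tens0r if_same.
have am0 : \sum_(p <- proper_splits u) shuffle_sum p.1 v ⊗ wd_last K lv p.2 = 0.
  rewrite big_seq big1 // => q /(proper_sub [::] [::] uu)[h1 h2 s1 s2 [n1 n2 l2]].
  by rewrite wd_last_uv // tens0r.
split.
- rewrite (bsucc_wd K suv u0 v0) dsucc_half (cop_half_sum_proper K suv u0 v0).
  rewrite (mm true) (bs true) (bm true) wd_last_r; last by [].
  rewrite (inner_l (f := fun p1 p2 => wd p1 ⊗ half_sum lv p2 v)); [by abel|by bilin|].
  by move=> p1 p2 s1 s2 n1 n2 pu lp; rewrite (bsucc_wd K s2 n2 v0).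
- rewrite (bprec_wd K suv u0 v0) dsucc_half (cop_half_sum_proper K suv u0 v0).
  rewrite (mp true) (bp true) (bm0 true) wd_last_vu; [|exact: v0|by []].
  rewrite (inner_l (f := fun p1 p2 => wd p1 ⊗ half_sum lu p2 v)).
  + by rewrite tens0r; abel.
  + by bilin.
  + by move=> p1 p2 s1 s2 n1 n2 pu lp; rewrite (bprec_wd K s2 n2 v0) lp.
- rewrite (bsucc_wd K suv u0 v0) dprec_half (cop_half_sum_proper K suv u0 v0).
  rewrite (mm false) (bs false) (bm false) am0 wd_last_uv; [|exact: u0|by []].
  by rewrite tens0r; abel.
- rewrite (bprec_wd K suv u0 v0) dprec_half (cop_half_sum_proper K suv u0 v0).
  rewrite (mp false) (bp false) (bm0 false) wd_last_r; last by [].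
  rewrite (inner_l (f := fun p1 p2 => shuffle_sum p1 v ⊗ wd_last K lu p2)).
  + by abel.
  + by bilin.
  + move=> p1 p2 s1 s2 n1 n2 pu lp.
    by rewrite (bmul_wd K s1 n1 v0) wd_last_r.
Qed.

End TwoWords.

Lemma fqsym_compat : bidendriform_compat fq.
Proof.
have words (U V : perm_word_pos) : exists u v, [/\ << U >> = wd u, << V >> = wd v,
    separated u v, u != [::] & v != [::]].
  by have [u [v [w [[-> -> _] [[s _ _] [u0 v0 _]]]]]] := basis_words K U V V; exists u, v.
move=> a b; rewrite !sw_lock !tens_lock !bmul_lock !dred_lock.
split; move: a b; (apply: eq_bilinear; [by bilin|by bilin|]) => U V;
  have [u [v [-> -> suv u0 v0]]] := words U V;
  have [h1 h2 h3 h4] := compat_words suv u0 v0; assumption.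
Qed.

Lemma fqsym_bidendriform : bidendriform_bialgebra fq.
Proof.
split; first exact: fqsym_dendriform_algebra.
- exact: fqsym_dendriform_coalgebra.
- exact: fqsym_compat.
Qed.

Lemma hom_F w :
  homogeneous perm_pos_deg (size w) (@F_ K (fun w => is_perm_word w && (w != [::])) w).
Proof.
by rewrite /F_; case: insubP => [U _ <-|_]; [apply: homU | apply: hom0].
Qed.

Lemma fqsym_graded : graded_ops perm_pos_deg fq.
Proof.
have hsh (P : pred (seq nat)) (U V : perm_word_pos) :
    homogeneous perm_pos_deg (pair_deg perm_pos_deg perm_pos_deg (U, V))
    (\sum_(w <- shuffles (val U) (shift (size (val U)) (val V)) | P w)
       @F_ K (fun w => is_perm_word w && (w != [::])) w).
  apply: hom_bigsum => w /perm_shuffles/perm_size; rewrite size_cat size_map => e _.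
  by rewrite /pair_deg /perm_pos_deg /= -e; apply: hom_F.
have hcut (P : pred (seq nat * seq nat)) (U : perm_word_pos) :
    homogeneous (pair_deg perm_pos_deg perm_pos_deg) (perm_pos_deg U)
    (\sum_(p <- splits (val U) | P p) wd p.1 ⊗ wd p.2).
  apply: hom_bigsum => p /mem_splits pU _; rewrite /perm_pos_deg -pU size_cat.
  by rewrite -(size_std p.1) -(size_std p.2); apply: hom_tens; apply: hom_F.
split=> [[U V]|[U V]|U|U].
- by rewrite [bprec _ _]linextU; apply: hsh.
- by rewrite [bsucc _ _]linextU; apply: hsh.
- rewrite wd_basis dprec_wd; first exact: hcut.
  by have /andP[/perm_word_uniq] := valP U.
- rewrite wd_basis dsucc_wd; first exact: hcut.
  by have /andP[/perm_word_uniq] := valP U.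
Qed.

Lemma perm_pos_deg_gt0 (U : perm_word_pos) : (0 < perm_pos_deg U)%N.
Proof. by rewrite /perm_pos_deg lt0n size_eq0; have /andP[] := valP U. Qed.

End FQSymCompat.

(** * Planar forests *)

Section Forests.

Variables (K : fieldType) (D : choiceType).

Local Notation H := {malg K[forest D]}.
Local Notation A := {malg K[forest_pos D]}.
Local Notation aug := (@aug_incl K D).

(** Simultaneous induction on trees and forests: the step supplies the hypothesis for the children
    of the first tree and for the remaining trees. *)
Lemma forest_ind (P : seq (tree D) -> Prop) :
  P [::] -> (forall d l s, P l -> P s -> P (Node d l :: s)) -> forall s, P s.
Proof.
move=> P0 Pcons; suff Pt : forall t s, P s -> P (t :: s).
  by elim=> // t s; apply: Pt.
fix IH 1 => -[d l] s Ps; apply: Pcons => //.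
elim: l => [|t l IHl]; first exact: P0.
by apply: IH.
Qed.

Definition fH := locked_with lock_key (fun s : seq (tree D) => << mkforest s >> : H).

Lemma fHE s : fH s = << mkforest s >>.
Proof. by rewrite /fH unlock. Qed.

Lemma fH_basis (F : forest D) : << F >> = fH F.
Proof. by rewrite fHE fmK. Qed.

Lemma mkforest_cat (s t : seq (tree D)) :
  mkforest (s ++ t) = mmul (mkforest s) (mkforest t) :> forest D.
Proof. by rewrite -[mmul _ _]fmK fmM. Qed.

Lemma mkforest_eq1 (s : seq (tree D)) : (mkforest s == mone :> forest D) = (s == [::]).
Proof. by rewrite fmP fm1. Qed.

Lemma mul_basis (F G : forest D) : << F >> * << G >> = << mmul F G >> :> H.
Proof. by rewrite malgM_def fgmulUU mulr1. Qed.

Lemma fH_cat s t : fH (s ++ t) = fH s * fH t.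
Proof. by rewrite !fHE mkforest_cat mul_basis. Qed.

Lemma fH0 : fH [::] = 1.
Proof. by rewrite fHE -[RHS]/(<< mone >>); congr << _ >>; apply/eqP; rewrite mkforest_eq1. Qed.

Lemma Bplus_fH d s : Bplus d (fH s) = fH [:: Node d s].
Proof. by rewrite /Bplus !fHE linextU. Qed.

Lemma lin_Bplus (U : lmodType K) d (f : U -> H) : linear f -> linear (fun x => Bplus d (f x)).
Proof. exact: lin_app. Qed.

Definition tree_succ (t : tree D) (y : H) : H :=
  let: Node d l := t in fH [:: t] * y - Bplus d (fH l * y).

Definition forest_succ (s : seq (tree D)) (y : H) : H := foldr tree_succ y s.

(* The only dendriform structure such that •_d ≺ x = B_d(x): a tree B_d(x)    *)
(* acts by t ≻ y = ty - B_d(xy), and a forest acts through its trees.         *)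
Definition sucH := locked_with lock_key
  (fun x y : H => linext (fun F : forest D => forest_succ F y) x).

Lemma sucHE x y : sucH x y = linext (fun F : forest D => forest_succ F y) x.
Proof. by rewrite /sucH unlock. Qed.

Lemma lin_tree_succ t : linear (tree_succ t).
Proof.
by case: t => d l; apply: lin_sum; [lin | apply: lin_opp; apply: lin_Bplus; lin].
Qed.

Lemma lin_forest_succ s : linear (forest_succ s).
Proof. by elim: s => [|t s IH] c x y //=; rewrite IH lin_tree_succ. Qed.

Lemma sucH_bilinear : bilinear_map sucH.
Proof.
split=> [y|x] c a b; rewrite !sucHE; first exact: linearP.
apply: (@lin_linext_fun K (forest D) H H (fun y F => forest_succ F y) x _ c a b) => F.
exact: lin_forest_succ.
Qed.

Lemma lin_sucHl (U : lmodType K) (f : U -> H) y :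
  linear f -> linear (fun x => sucH (f x) y).
Proof. by move=> lf c a b; rewrite lf sucH_bilinear.1. Qed.

Lemma lin_sucHr (U : lmodType K) (f : U -> H) x :
  linear f -> linear (fun y => sucH x (f y)).
Proof. by move=> lf c a b; rewrite lf sucH_bilinear.2. Qed.

Ltac linH :=
  repeat first [apply: lin_Bplus | apply: lin_sucHl | apply: lin_sucHr | lin_step].

Lemma sucH_basis s y : sucH (fH s) y = forest_succ s y.
Proof. by rewrite sucHE fHE linextU. Qed.

Lemma sucH_Bplus d x y : sucH (Bplus d x) y = Bplus d x * y - Bplus d (x * y).
Proof.
move: x; apply: eq_linear; [by linH|by linH|] => F.
by rewrite fH_basis Bplus_fH sucH_basis.
Qed.

Lemma sucHM x y z : sucH (x * y) z = sucH x (sucH y z).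
Proof.
apply: (eq_bilinear (f := fun x y => sucH (x * y) z) (g := fun x y => sucH x (sucH y z))).
- by split=> ?; linH.
- by split=> ?; linH.
by move=> F G; rewrite !fH_basis -fH_cat !sucH_basis; apply: foldr_cat.
Qed.

Lemma fH_cons t s : fH (t :: s) = fH [:: t] * fH s.
Proof. exact: (fH_cat [:: t] s). Qed.

(** The middle dendriform axiom (a ≻ b) ≺ c = a ≻ (b ≺ c), where u ≺ v stands for uv - u ≻ v. The
    induction peels off the trees of a, each acting by ty - B_d(xy). *)
Lemma sucH_mid a b c :
  sucH a b * c - sucH (sucH a b) c = sucH a (b * c) - sucH a (sucH b c).
Proof.
move: a; apply: eq_linear; [by linH|by linH|] => F; rewrite fH_basis.
elim: (F : seq _) => [|[d l] s IH] /=; first by rewrite !sucH_basis.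
rewrite fH_cons !sucHM; set b' := sucH (fH s) b in IH *.
have tE y : sucH (fH [:: Node d l]) y = fH [:: Node d l] * y - Bplus d (fH l * y).
  by rewrite -Bplus_fH sucH_Bplus.
rewrite [in LHS]tE (linB _ _ (f := fun x => sucH x c)); last by linH.
rewrite sucHM sucH_Bplus mulrBl -(linB _ _ (f := sucH (fH [:: Node d l]))); last by linH.
rewrite -[in RHS]IH (linB _ _ (f := sucH (fH [:: Node d l]))); last by linH.
rewrite [sucH _ (b' * c)]tE.
have cancel (x y z t : H) : x - y - (z - (y - t)) = x - t - z by abel.
by rewrite (mulrA (fH [:: Node d l]) b' c) (mulrA (fH l) b' c); apply: cancel.
Qed.

(** The counit as a coefficient: its kernel is the image of [aug]. *)
Definition c0 (x : H) : K := x@_(mone : forest D).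

Lemma c0B x y : c0 (x - y) = c0 x - c0 y.
Proof. exact: mcoeffB. Qed.

Lemma c0M x y : c0 (x * y) = c0 x * c0 y.
Proof. by rewrite /c0 (mcoeff1g_is_multiplicative (forest D) K).1. Qed.

Lemma c0_Bplus d x : c0 (Bplus d x) = 0.
Proof.
rewrite /c0 /Bplus /linext raddf_sum big1 // => F _ /=.
by rewrite mcoeffZ mcoeffU1 mkforest_eq1 mulr0.
Qed.

Lemma c0_forest_succ s y : c0 y = 0 -> c0 (forest_succ s y) = 0.
Proof.
move=> y0; elim: s => [|[d l] s IH] //=.
by rewrite c0B c0M IH mulr0 c0_Bplus subr0.
Qed.

Lemma c0_sucH x y : c0 y = 0 -> c0 (sucH x y) = 0.
Proof.
move=> y0; rewrite /c0 sucHE /linext raddf_sum big1 // => F _ /=.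
by rewrite mcoeffZ -/(c0 _) c0_forest_succ ?mulr0.
Qed.

Lemma c0_prec x y : c0 x = 0 -> c0 y = 0 -> c0 (x * y - sucH x y) = 0.
Proof. by move=> x0 y0; rewrite c0B c0M x0 mul0r c0_sucH ?subr0. Qed.

Lemma c0_aug x : c0 (aug x) = 0.
Proof.
rewrite /c0 /aug_incl /linext raddf_sum big1 // => F _ /=.
by rewrite mcoeffZ mcoeffU1 (negbTE (valP F)) mulr0.
Qed.

(** The projection of H^D onto A^D along the empty forest, used to restrict operations from H^D to
    A^D. *)
Definition pos_part : {linear H -> A} :=
  linext (fun F : forest D => if insub F is Some G then << G >> else 0).

Lemma aug_basis (G : forest_pos D) : aug << G >> = << val G >>.
Proof. by rewrite /aug_incl linextU. Qed.

Lemma pos_partK x : c0 x = 0 -> aug (pos_part x) = x.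
Proof.
move=> x0; suff -> : aug (pos_part x) = x - c0 x *: 1 by rewrite x0 scale0r subr0.
have lc0 : linear (fun x : H => c0 x *: (1 : H)).
  by move=> c a b; rewrite /c0 mcoeffD mcoeffZ scalerDl scalerA.
move: {x0} x; apply: eq_linear.
- by rewrite /aug_incl; lin.
- by apply: lin_sum; [lin | apply: lin_opp].
move=> F; rewrite [pos_part _]linextU /c0 mcoeffU1.
case: insubP => [G F1 <-|]; first by rewrite aug_basis (negbTE (valP G)) scale0r subr0.
rewrite negbK => /eqP ->; rewrite eqxx scale1r subrr.
exact: linear0.
Qed.

Lemma lin_aug (U : lmodType K) (f : U -> A) : linear f -> linear (fun x => aug (f x)).
Proof. exact: lin_app. Qed.

Lemma augD x y : aug (x + y) = aug x + aug y. Proof. exact: linearD. Qed.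

Definition fA := locked_with lock_key (fun s : seq (tree D) => pos_part (fH s)).

Lemma fAE s : fA s = pos_part (fH s).
Proof. by rewrite /fA unlock. Qed.

Lemma aug_fA s : s != [::] -> aug (fA s) = fH s.
Proof. by move=> s0; rewrite fAE; apply: pos_partK; rewrite /c0 fHE mcoeffU1 mkforest_eq1 (negbTE s0). Qed.

Lemma fA0 : fA [::] = 0.
Proof.
rewrite fAE fHE [pos_part _]linextU insubF //.
by apply/negbF; apply: mkforest_eq1.
Qed.

Lemma fA_basis (G : forest_pos D) : << G >> = fA (val G).
Proof. by rewrite fAE -fH_basis [pos_part _]linextU valK. Qed.

Lemma fA_dot d : fA [:: Node d [::]] = dot K d.
Proof. by rewrite /dot fA_basis SubK. Qed.

Lemma forest_pos_neq0 (G : forest_pos D) : (val G : seq _) != [::].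
Proof. by rewrite -mkforest_eq1 fmK (valP G). Qed.

Definition tree_succ_op : {linear {malg K[(forest_pos D * forest_pos D)%type]} -> A} :=
  linext (fun p => pos_part (sucH << val p.1 >> << val p.2 >>)).

Definition tree_prec_op : {linear {malg K[(forest_pos D * forest_pos D)%type]} -> A} :=
  linext (fun p => pos_part (<< val p.1 >> * << val p.2 >> - sucH << val p.1 >> << val p.2 >>)).

Lemma c0_basis (G : forest_pos D) : c0 << val G >> = 0.
Proof. by rewrite -aug_basis c0_aug. Qed.

Lemma aug_succ x y : aug (tree_succ_op (x ⊗ y)) = sucH (aug x) (aug y).
Proof.
apply: (eq_bilinear (f := fun x y => aug (tree_succ_op (x ⊗ y)))
                    (g := fun x y => sucH (aug x) (aug y))).
- by split=> ?; apply: lin_aug; lin.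
- by split=> ?; linH; apply: lin_aug; lin.
move=> F G; rewrite tensUU [tree_succ_op _]linextU pos_partK ?c0_sucH ?c0_basis //.
by congr (sucH _ _); apply/esym; apply: aug_basis.
Qed.

Lemma aug_prec x y :
  aug (tree_prec_op (x ⊗ y)) = aug x * aug y - sucH (aug x) (aug y).
Proof.
apply: (eq_bilinear (f := fun x y => aug (tree_prec_op (x ⊗ y)))
                    (g := fun x y => aug x * aug y - sucH (aug x) (aug y))).
- by split=> ?; apply: lin_aug; lin.
- by split=> ?; apply: lin_sum; linH; try apply: lin_aug; lin.
move=> F G; rewrite tensUU [tree_prec_op _]linextU pos_partK.
  exact: (congr2 (fun a b : H => a * b - sucH a b) (esym (aug_basis F)) (esym (aug_basis G))).
by apply: c0_prec; apply: c0_basis.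
Qed.

(** The part of [is_tree_bidend] that concerns the products only; it is enough for the isomorphism
    of dendriform algebras. *)
Definition is_tree_dendriform (S : bidend_ops K (forest_pos D)) : Prop :=
  [/\ dendriform_algebra S,
      forall x y, aug (lbmul S x y) = aug x * aug y
    & forall d x, aug (bprec S (dot K d ⊗ x)) = Bplus d (aug x)].

Lemma is_tree_dendriformI (S : bidend_ops K (forest_pos D)) :
  (forall x y, aug (bprec S (x ⊗ y)) = aug x * aug y - sucH (aug x) (aug y)) ->
  (forall x y, aug (bsucc S (x ⊗ y)) = sucH (aug x) (aug y)) ->
  is_tree_dendriform S.
Proof.
move=> precE succE.
have mulE x y : aug (lbmul S x y) = aug x * aug y.
  by rewrite lbmulE augD precE succE subrK.
split=> [a b c|//|d x]; last first.
  rewrite precE -fA_dot aug_fA // -Bplus_fH sucH_Bplus fH0 mul1r.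
  by rewrite opprB addrC subrK.
rewrite !tens_lock -!lbmulE; split; apply: aug_incl_inj.
(* With u ≺ v = uv - u ≻ v, the first axiom follows from the associativity of the product and the
   other two axioms. *)
- rewrite !precE mulE; move: (aug a) (aug b) (aug c) => x y z.
  have := sucH_mid x y z; rewrite mulrBl (linB _ _ (f := fun x => sucH x z)); last by linH.
  rewrite sucHM mulrA; move: (sucH x y * z) (sucH (sucH x y) z) (sucH x (y * z)) (_ * z).
  move: (sucH x _) => t1 t2 t3 t4 t5 /eqP; rewrite subr_eq => /eqP ->; abel.
- rewrite precE !succE precE; move: (aug a) (aug b) (aug c) => x y z.
  by rewrite sucH_mid; apply/esym; apply: (linB _ _ (f := sucH x)); linH.
- by rewrite !succE mulE sucHM.
Qed.

Lemma tree_dendriform Dp Ds : is_tree_dendriform (BidendOps tree_prec_op tree_succ_op Dp Ds).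
Proof. by apply: is_tree_dendriformI; [exact: aug_prec|exact: aug_succ]. Qed.

End Forests.

(** * Freeness of the dendriform algebra of forests *)

Section FreeMorphism.

Variables (K : fieldType) (D : choiceType).

Local Notation A := {malg K[forest_pos D]}.
Local Notation aug := (@aug_incl K D).
Local Notation fA := (@fA K D).

Variable S : bidend_ops K (forest_pos D).
Hypothesis ST : is_tree_dendriform S.

Let SD : dendriform_algebra S. Proof. by case: ST. Qed.

Lemma fA_cat s t : s != [::] -> t != [::] -> fA (s ++ t) = lbmul S (fA s) (fA t).
Proof.
case: ST => _ mulE _ s0 t0; have st0 : s ++ t != [::] by case: s s0.
by apply: aug_incl_inj; rewrite mulE (aug_fA K st0) (aug_fA K s0) (aug_fA K t0) fH_cat.
Qed.

Lemma fA_cons t s : s != [::] -> fA (t :: s) = lbmul S (fA [:: t]) (fA s).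
Proof. by move=> s0; rewrite -(fA_cat (s := [:: t])). Qed.

Lemma fA_node d s : s != [::] -> fA [:: Node d s] = bprec S (dot K d ⊗ fA s).
Proof.
case: ST => _ _ dotE s0; apply: aug_incl_inj.
have t0 : [:: Node d s] != [::] by [].
by rewrite dotE (aug_fA K s0) (aug_fA K t0) Bplus_fH.
Qed.

(** Dots, the products • ≺ x and concatenation produce every nonempty forest. The target operations
    [up] and [um] are arbitrary functions. *)
Lemma dend_morphism_ext (U : lmodType K) (f g : A -> U)
    (up um : U -> U -> U) :
  linear f -> linear g ->
  (forall a b, f (bprec S (a ⊗ b)) = up (f a) (f b)) ->
  (forall a b, f (lbmul S a b) = um (f a) (f b)) ->
  (forall a b, g (bprec S (a ⊗ b)) = up (g a) (g b)) ->
  (forall a b, g (lbmul S a b) = um (g a) (g b)) ->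
  (forall d, f (dot K d) = g (dot K d)) -> forall a, f a = g a.
Proof.
move=> lf lg fp fm gp gm fg; apply: eq_linear => // F; rewrite fA_basis.
elim/forest_ind: (val F : seq _) => [|d l s IHl IHs].
  by rewrite fA0 (lin0 lf) (lin0 lg).
have tE : f (fA [:: Node d l]) = g (fA [:: Node d l]).
  have [->|l0] := eqVneq l [::]; first by rewrite fA_dot.
  by rewrite fA_node // fp gp fg IHl.
have [->|s0] := eqVneq s [::]; first exact: tE.
by rewrite fA_cons // fm gm tE IHs.
Qed.

Variables (X : choiceType) (T : bidend_ops K X).
Hypothesis TD : dendriform_algebra T.
Variable p : D -> {malg K[X]}.

(** T has no unit, so the product of the empty sequence is set to 0, in accordance with [fA0]. *)
Definition fold_mul (s : seq {malg K[X]}) : {malg K[X]} :=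
  if s is x :: s' then foldl (lbmul T) x s' else 0.

Fixpoint tree_eval (t : tree D) : {malg K[X]} :=
  let: Node d l := t in
  if l is [::] then p d else bprec T (p d ⊗ fold_mul (map tree_eval l)).

Definition forest_eval (s : seq (tree D)) : {malg K[X]} := fold_mul (map tree_eval s).

Lemma fold_mul_cons x s : s != [::] -> fold_mul (x :: s) = lbmul T x (fold_mul s).
Proof.
case: s => //= y s _; elim: s y => //= z s IH y.
by rewrite (bmulA TD) -IH.
Qed.

Lemma forest_eval_cons t s : s != [::] ->
  forest_eval (t :: s) = lbmul T (tree_eval t) (forest_eval s).
Proof. by move=> s0; rewrite [LHS]fold_mul_cons // -size_eq0 size_map size_eq0. Qed.

Lemma forest_eval_cat s t : s != [::] -> t != [::] ->
  forest_eval (s ++ t) = lbmul T (forest_eval s) (forest_eval t).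
Proof.
move=> + t0; elim: s => // x s IH _.
have [->|s0] := eqVneq s [::]; first by rewrite /= forest_eval_cons.
rewrite cat_cons forest_eval_cons ?IH //; last by case: s s0 {IH}.
by rewrite forest_eval_cons // bmulA.
Qed.

Lemma tree_eval_node d s : s != [::] ->
  tree_eval (Node d s) = bprec T (p d ⊗ forest_eval s).
Proof. by case: s. Qed.

(** The morphism of the universal property of A^D, sending the dot decorated by d to [p d]. *)
Definition eval_map : {linear A -> {malg K[X]}} :=
  linext (fun F : forest_pos D => forest_eval (val F)).

Lemma eval_fA s : eval_map (fA s) = forest_eval s.
Proof.
have [->|s0] := eqVneq s [::]; first by rewrite fA0 linear0.
have F1 : mkforest s != mone :> forest D by rewrite mkforest_eq1.
by rewrite -[s]/(val (Sub (mkforest s) F1 : forest_pos D) : seq _) -fA_basis [LHS]linextU.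
Qed.

Lemma eval_dot d : eval_map (dot K d) = p d.
Proof. by rewrite -fA_dot eval_fA. Qed.

Lemma eval_mul a b : eval_map (lbmul S a b) = lbmul T (eval_map a) (eval_map b).
Proof.
apply: (eq_bilinear (f := fun a b => eval_map (lbmul S a b))
                    (g := fun a b => lbmul T (eval_map a) (eval_map b))).
- by bilin.
- by bilin.
move=> F G; rewrite !fA_basis -fA_cat ?forest_pos_neq0 // !eval_fA.
by rewrite forest_eval_cat ?forest_pos_neq0.
Qed.

Lemma eval_dot_prec d x : eval_map (bprec S (dot K d ⊗ x)) = bprec T (p d ⊗ eval_map x).
Proof.
move: x; apply: eq_linear; [by lin|by lin|] => F.
rewrite !fA_basis -fA_node ?forest_pos_neq0 // !eval_fA.
by rewrite -tree_eval_node ?forest_pos_neq0.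
Qed.

(** For a tree, ≻ is the product minus ≺, and (• ≺ l) ≺ c = • ≺ (lc) reduces to the known case of a
    dot on the left. For a forest, (ts) ≻ c = t ≻ (s ≻ c). *)
Lemma eval_succ a b : eval_map (bsucc S (a ⊗ b)) = bsucc T (eval_map a ⊗ eval_map b).
Proof.
move: a; apply: eq_linear; [by lin|by lin|] => F; rewrite fA_basis.
have tE d l c : eval_map (bsucc S (fA [:: Node d l] ⊗ c)) =
                bsucc T (eval_map (fA [:: Node d l]) ⊗ eval_map c).
  have bsuccE (Z : choiceType) (R : bidend_ops K Z) x y :
      bsucc R (x ⊗ y) = lbmul R x y - bprec R (x ⊗ y).
    by rewrite lbmulE addrC addKr.
  rewrite !bsuccE linearB /= eval_mul; congr (_ - _).
  have [->|l0] := eqVneq l [::].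
    by rewrite fA_dot eval_dot_prec eval_dot.
  rewrite fA_node // (dend_precA SD) !eval_dot_prec eval_mul.
  by rewrite (dend_precA TD).
elim: (val F : seq _) => [|[d l] s IH]; first by rewrite fA0 !(tens0l, linear0).
have [->|s0] := eqVneq s [::]; first exact: tE.
by rewrite fA_cons // (dend_succA SD) tE IH eval_mul (dend_succA TD).
Qed.

Lemma eval_prec a b : eval_map (bprec S (a ⊗ b)) = bprec T (eval_map a ⊗ eval_map b).
Proof. by rewrite !bmul_precE linearB /= eval_mul eval_succ. Qed.

Lemma hom_eval (deg : D -> nat) (d : X -> nat) : graded_ops d T ->
  (forall x, homogeneous d (deg x) (p x)) ->
  forall F : forest_pos D, homogeneous d (forest_pos_deg deg F) (eval_map << F >>).
Proof.
move=> gT hp F; rewrite fA_basis eval_fA /forest_pos_deg /forest_deg.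
elim/forest_ind: (val F : seq _) => [|c l s IHl IHs]; first exact: hom0.
have tE : homogeneous d (tree_deg deg (Node c l)) (tree_eval (Node c l)).
  have [->|l0] := eqVneq l [::]; first by rewrite /= addn0; apply: hp.
  by rewrite tree_eval_node //; apply: (hom_bprec gT).
have [->|s0] := eqVneq s [::]; first by rewrite /= addn0; apply: tE.
by rewrite forest_eval_cons //; apply: (hom_bmul gT).
Qed.

End FreeMorphism.

(** * The isomorphisms *)

Section Isomorphism.

Variables (K : fieldType) (X : choiceType) (d : X -> nat) (T : bidend_ops K X).
Hypothesis TB : bidendriform_bialgebra T.
Hypothesis gT : graded_ops d T.
Hypothesis d_gt0 : forall u, (0 < d u)%N.
Variable p : nat -> nat.
Hypothesis hp : forall n, (1 <= n)%N ->
  has_dim (fun a : {malg K[X]} => prim_tot T a /\ homogeneous d n a) (p n).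
Variables (D : choiceType) (deg : D -> nat).
Hypothesis hD0 : forall x, deg x <> 0%N.
Hypothesis hD : forall n, (1 <= n)%N -> has_card (fun x => deg x = n) (p n).
Variable S : bidend_ops K (forest_pos D).
Hypothesis ST : is_tree_dendriform S.

Let TD : dendriform_algebra T. Proof. by case: TB. Qed.

(** In each degree n + 1 a basis of totally primitive elements and an enumeration of the decorations
    share the index set 'I_(p n.+1); [f] is the resulting assignment of primitive elements to
    decorations. *)
Lemma exists_prim_family : exists (b : forall n, 'I_(p n.+1) -> {malg K[X]})
    (e : forall n, 'I_(p n.+1) -> D) (f : D -> {malg K[X]}),
  [/\ forall n i, deg (e n i) = n.+1,
      forall n i, f (e n i) = b n i,
      forall x, exists n i, x = e n i,
      forall n (c : 'I_(p n.+1) -> K), \sum_i c i *: b n i = 0 -> forall i, c i = 0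
    & [/\ forall n i, prim_tot T (b n i), forall n i, homogeneous d n.+1 (b n i)
        & forall n a, prim_tot T a -> homogeneous d n.+1 a ->
            exists c : 'I_(p n.+1) -> K, a = \sum_i c i *: b n i]].
Proof.
pose sb n := constructive_indefinite_description _ (hp (ltn0Sn n)).
have ex_e n : exists e : 'I_(p n.+1) -> D,
    injective e /\ forall x, deg x = n.+1 <-> exists i, e i = x.
  by case: (hD (ltn0Sn n)) => e e1 e2; exists e.
pose se n := constructive_indefinite_description _ (ex_e n).
pose b n := sval (sb n); pose e n := sval (se n).
have bP n := svalP (sb n); have eP n := svalP (se n).
have deg_e n i : deg (e n i) = n.+1 by apply/(eP n).2; exists i.
have ex_ni x : exists n i, x = e n i.
  case dx : (deg x) => [|n]; first by case: (hD0 dx).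
  by have /(eP n).2[i ei] := dx; exists n, i.
have ex_f x : exists a, exists n i, x = e n i /\ a = b n i.
  by have [n [i xe]] := ex_ni x; exists (b n i), n, i.
pose sf x := constructive_indefinite_description _ (ex_f x).
exists b, e, (fun x => sval (sf x)); split=> //.
(* The indices chosen for [e n i] are n and i again: the degree determines n, and the injectivity of
   [e n] determines i. *)
- move=> n i; have [m [j [eij ->]]] := svalP (sf (e n i)).
  have nm : n = m by apply/eqP; rewrite -eqSS -(deg_e n i) eij deg_e.
  by case: m / nm j eij => j /(eP n).1 ->.
- by move=> n c; case: (bP n) => _ h _; apply: h.
split=> [n i|n i|n a a1 a2].
- by case: (bP n) => /(_ i)[].
- by case: (bP n) => /(_ i)[].
- by case: (bP n) => _ _; apply; split.
Qed.

(** [theta] is Q followed by the linear map that sends each chosen primitive element to the dot with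
    the corresponding decoration, so it inherits the vanishing properties of Q. *)
Lemma exists_theta (Q : {linear {malg K[X]} -> {malg K[X]}}) :
  (forall a, prim_tot T (Q a)) ->
  (forall n a, homogeneous d n a -> homogeneous d n (Q a)) ->
  (forall a, prim_tot T a -> Q a = a) ->
  (forall a b, Q (lbmul T a b) = 0) -> (forall a b, Q (bsucc T (a ⊗ b)) = 0) ->
  exists (f : D -> {malg K[X]}) (theta : {linear {malg K[X]} -> {malg K[forest_pos D]}}),
  [/\ forall x, prim_tot T (f x), forall x, homogeneous d (deg x) (f x),
      forall x, theta (f x) = dot K x,
      forall phi : {linear {malg K[forest_pos D]} -> {malg K[X]}},
        (forall x, phi (dot K x) = f x) -> forall a, phi (theta a) = Q a
    & (forall a b, theta (lbmul T a b) = 0) /\ (forall a b, theta (bsucc T (a ⊗ b)) = 0)].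
Proof.
move=> Qprim Qhom Qid Qmul Qsucc.
have [b [e [f [deg_e fe ex_e free_b [prim_b hom_b gen_b]]]]] := exists_prim_family.
(* The graph of [theta] in degree n + 1: a linear relation, functional because the basis vectors are
   independent. *)
pose R n a w := exists2 c : 'I_(p n.+1) -> K,
  Q a = \sum_i c i *: b n i & w = \sum_i c i *: dot K (e n i).
have R0 n : R n 0 0.
  by exists (fun=> 0); rewrite ?linear0 big1 // => i _; rewrite scale0r.
have RD n k a1 w1 a2 w2 : R n a1 w1 -> R n a2 w2 -> R n (k *: a1 + a2) (k *: w1 + w2).
  move=> [c1 Q1 ->] [c2 Q2 ->]; exists (fun i => k * c1 i + c2 i).
    rewrite linearP Q1 Q2 scaler_sumr -big_split; apply: eq_bigr => i _ /=.
    by rewrite scalerDl scalerA.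
  by rewrite scaler_sumr -big_split; apply: eq_bigr => i _ /=; rewrite scalerDl scalerA.
have R_fun n a w w' : R n a w -> R n a w' -> w = w'.
  move=> [c Qc ->] [c' Qc' ->].
  suff cc i : c i = c' i by apply: eq_bigr => i _; rewrite cc.
  apply/eqP; rewrite -subr_eq0; apply/eqP; move: i.
  apply: (free_b n (fun i => c i - c' i)).
  transitivity (\sum_i c i *: b n i - \sum_i c' i *: b n i).
    by rewrite -sumrB; apply: eq_bigr => i _; rewrite scalerBl.
  by rewrite -Qc -Qc' subrr.
(* The predecessor appears because index n stands for degree n + 1. *)
have ex_w u : exists w, R (d u).-1 << u >> w.
  have hu : homogeneous d (d u).-1.+1 (<< u >> : {malg K[X]}).
    by rewrite prednK ?d_gt0 //; apply: homU.
  have [c Qc] := gen_b _ _ (Qprim << u >>) (Qhom _ _ hu).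
  by exists (\sum_i c i *: dot K (e _ i)), c.
pose sw u := constructive_indefinite_description _ (ex_w u).
pose theta : {linear {malg K[X]} -> {malg K[forest_pos D]}} := linext (fun u => sval (sw u)).
have Rtheta n a : homogeneous d n.+1 a -> R n a (theta a).
  move=> ha; rewrite -{1}[a]linext_basis /theta /= /linext big_seq [X in R _ _ X]big_seq.
  elim/big_rec2: _ => [|u w a' ua IH]; first exact: R0.
  apply: RD => //; move: (svalP (sw u)); move: (sval (sw u)) => w'.
  by rewrite (ha _ ua).
have theta0 n a : homogeneous d n a -> (0 < n)%N -> Q a = 0 -> theta a = 0.
  case: n => // n ha _ Q0; apply: R_fun (Rtheta _ _ ha) _.
  by exists (fun=> 0); rewrite ?Q0 big1 // => i _; rewrite scale0r.
exists f, theta; split.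
- by move=> x; have [n [i ->]] := ex_e x; rewrite fe.
- by move=> x; have [n [i ->]] := ex_e x; rewrite fe deg_e.
- move=> x; have [n [i ->]] := ex_e x; rewrite fe.
  apply: R_fun (Rtheta n _ (hom_b n i)) _.
  exists (fun j => (j == i)%:R).
    rewrite Qid // (bigD1 i) //= eqxx scale1r big1 ?addr0 // => j /negbTE ->.
    by rewrite scale0r.
  rewrite (bigD1 i) //= eqxx scale1r big1 ?addr0 // => j /negbTE ->.
  by rewrite scale0r.
- move=> phi phif; apply: (eq_linear (f := fun a => phi (theta a)) (g := Q)).
  + by lin.
  + exact: linearP.
  move=> u; have hu : homogeneous d (d u).-1.+1 (<< u >> : {malg K[X]}).
    by rewrite prednK ?d_gt0 //; apply: homU.
  have [c -> ->] := Rtheta _ _ hu; rewrite linear_sum; apply: eq_bigr => i _.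
  by rewrite linearZ /= phif fe.
split.
- apply: (eq_bilinear (f := fun a b => theta (lbmul T a b)) (g := fun _ _ => 0)).
  + by bilin.
  + by bilin.
  move=> u v; apply: (theta0 _ _ (hom_bmul gT (@homU _ _ _ _) (@homU _ _ _ _))).
    by rewrite addn_gt0 d_gt0.
  exact: Qmul.
- apply: (eq_bilinear (f := fun a b => theta (bsucc T (a ⊗ b))) (g := fun _ _ => 0)).
  + by bilin.
  + by bilin.
  move=> u v; apply: (theta0 _ _ (hom_bsucc gT (@homU _ _ _ _) (@homU _ _ _ _))).
    by rewrite addn_gt0 d_gt0.
  exact: Qsucc.
Qed.

(** [phi] evaluates forests at the totally primitive elements, and [psi] is the lift of [theta]. *)
Lemma exists_dendriform_iso :
  exists (phi : {linear {malg K[forest_pos D]} -> {malg K[X]}})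
         (psi : {linear {malg K[X]} -> {malg K[forest_pos D]}}),
  [/\ cancel phi psi, cancel psi phi,
      forall a b, phi (bprec S (a ⊗ b)) = bprec T (phi a ⊗ phi b),
      forall a b, phi (bsucc S (a ⊗ b)) = bsucc T (phi a ⊗ phi b)
    & (forall x, prim_tot T (phi (dot K x))) /\
      (forall F, homogeneous d (forest_pos_deg deg F) (phi << F >>))].
Proof.
have SD : dendriform_algebra S by case: ST.
have [P PE] := exists_proj_dprec gT d_gt0.
have [Q QE] := exists_proj_prim gT d_gt0 PE.
have [f [theta [prim_f hom_f theta_f phi_theta [theta_mul theta_succ]]]] :=
  exists_theta (proj_prim_tot TB gT d_gt0 PE QE) (hom_proj_prim gT d_gt0 PE QE)
    (proj_prim_id PE QE) (proj_prim_mul TB gT d_gt0 PE QE)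
    (proj_prim_succ TB gT d_gt0 PE QE).
have [psi psiE] := exists_lift gT d_gt0 PE S theta.
have psi_mul := lift_mul TB gT d_gt0 PE SD theta_mul psiE.
have psi_prec := lift_prec TB gT d_gt0 PE SD theta_mul theta_succ psiE.
pose phi := eval_map T f.
have phi_prec : forall a b, phi (bprec S (a ⊗ b)) = bprec T (phi a ⊗ phi b).
  exact: (eval_prec ST TD).
have phi_succ : forall a b, phi (bsucc S (a ⊗ b)) = bsucc T (phi a ⊗ phi b).
  exact: (eval_succ ST TD).
have phi_mul : forall a b, phi (lbmul S a b) = lbmul T (phi a) (phi b).
  exact: (eval_mul ST TD).
have phi_dot x : phi (dot K x) = f x by apply: eval_dot.
exists phi, psi; split.
(* psi ∘ phi is an endomorphism of the free algebra; it fixes the dots because the lift agrees with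
   [theta] on totally primitive elements. *)
- apply: (dend_morphism_ext ST (f := fun a => psi (phi a)) (g := fun a => a)
    (up := fun a b => bprec S (a ⊗ b)) (um := lbmul S)) => //.
  + by lin.
  + by move=> a b; rewrite phi_prec psi_prec.
  + by move=> a b; rewrite phi_mul psi_mul.
  + by move=> x; rewrite phi_dot (lift_prim_tot PE psiE (prim_f x)) theta_f.
- exact: (lift_section gT d_gt0 PE QE psiE phi_prec phi_succ (phi_theta phi phi_dot)).
- exact: phi_prec.
- exact: phi_succ.
split=> [x|F]; first by rewrite phi_dot; apply: prim_f.
exact: (hom_eval TD gT hom_f).
Qed.

End Isomorphism.

(** * The coproduct by admissible cuts *)

Section ForestCoproduct.

Variables (K : fieldType) (D : choiceType).

Local Notation H := {malg K[forest D]}.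
Local Notation fH := (@fH K D).
Local Notation cop := (@forest_cop K D).
Local Notation aug := (@aug_incl K D).

Lemma big_choices_cat (V : nmodType) (A : Type) (l1 l2 : seq (seq A)) (f : seq A -> V) :
  \sum_(c <- choices (l1 ++ l2)) f c =
  \sum_(c1 <- choices l1) \sum_(c2 <- choices l2) f (c1 ++ c2).
Proof.
elim: l1 f => [|l l1 IH] f; first by rewrite big_seq1.
rewrite /= !big_allpairs_dep; apply: eq_bigr => x _.
exact: (IH (fun c => f (x :: c))).
Qed.

(** Lets a condition on the markings of a forest be imposed tree by tree. *)
Lemma choices_filter (A : Type) (P : pred A) (s : seq (seq A)) :
  [seq x <- choices s | all P x] = choices (map (filter P) s).
Proof.
elim: s => //= l s IH; rewrite -IH; elim: l => //= x l IHl.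
rewrite filter_cat IHl filter_map.
case Px : (P x); last by rewrite (eq_filter (a2 := pred0)) ?filter_pred0 // => y /=; rewrite Px.
by rewrite /=; congr (map _ _ ++ _); apply: eq_filter => y /=; rewrite Px.
Qed.

Lemma all_flatten_map (A B : Type) (P : pred B) (f : A -> seq B) (s : seq A) :
  all P (flatten (map f s)) = all (fun x => all P (f x)) s.
Proof. by elim: s => //= x s IH; rewrite all_cat IH. Qed.

(** The condition that admissibility imposes on the subtrees below a marked root. *)
Definition unmarked (m : tree (D * bool)) : bool :=
  all (fun p => count snd p == 0)%N (leaf_paths m).

Lemma leaf_paths_cons (A : Type) (a : A) t l :
  leaf_paths (Node a (t :: l)) =
  [seq a :: p | p <- flatten (map (@leaf_paths A) (t :: l))].
Proof. by []. Qed.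

Lemma leaf_paths_neq0 (A : choiceType) (t : tree A) : (0 < size (leaf_paths t))%N.
Proof.
suff: all (fun t : tree A => 0 < size (leaf_paths t))%N [:: t] by rewrite /= andbT.
elim/forest_ind: [:: t] => // a l s; case: l => [|t' l] //= /andP[ht _] ->.
by rewrite size_map size_cat addn_gt0 ht.
Qed.

Lemma admissible_node d (b : bool) l :
  admissible (Node (d, b) l) = all (if b then unmarked else @admissible D) l.
Proof.
rewrite /admissible; case: l => [|m l]; first by case: b.
rewrite leaf_paths_cons all_map all_flatten_map.
by apply: eq_all => z; case: b => //=; apply: eq_all => q /=; case: (count _ _).
Qed.

Lemma unmarked_node d (b : bool) l :
  unmarked (Node (d, b) l) = ~~ b && all unmarked l.
Proof.
rewrite /unmarked; case: l => [|m l]; first by case: b.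
rewrite leaf_paths_cons all_map all_flatten_map; case: b => //=.
by have := leaf_paths_neq0 m; case: (leaf_paths m).
Qed.

Fixpoint clear_marks (t : tree D) : tree (D * bool) :=
  let: Node d l := t in Node (d, false) (map clear_marks l).

Lemma choices_single (A B : Type) (f : A -> B) s :
  choices (map (fun x => [:: f x]) s) = [:: map f s].
Proof. by elim: s => //= x s ->. Qed.

Lemma filter_markings (Q : pred (tree (D * bool))) d l :
  [seq m <- markings (Node d l) | Q m] =
  [seq Node (d, false) l' | l' <- choices (map (@markings D) l) & Q (Node (d, false) l')] ++
  [seq Node (d, true) l' | l' <- choices (map (@markings D) l) & Q (Node (d, true) l')].
Proof. by rewrite /= cats0 filter_cat !filter_map. Qed.

Lemma filter_unmarked (s : seq (tree D)) :
  map (filter unmarked \o @markings D) s = map (fun t => [:: clear_marks t]) s.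
Proof.
elim/forest_ind: s => // d l s IHl IHs; rewrite !map_cons IHs; congr (_ :: _).
rewrite [LHS](filter_markings unmarked).
rewrite (eq_filter (a2 := all unmarked)); last by move=> l' /=; rewrite unmarked_node.
rewrite [X in _ ++ map _ X](eq_filter (a2 := pred0)); last by move=> l' /=; rewrite unmarked_node.
by rewrite filter_pred0 cats0 choices_filter -map_comp IHl choices_single.
Qed.

(** Either the root is unmarked and the children carry an admissible cut, or the root is marked and
    nothing below it is, which is the total cut. *)
Lemma adm_node d l :
  adm (Node d l) = [seq Node (d, false) c | c <- adm_forest l] ++
                   [:: Node (d, true) (map clear_marks l)].
Proof.
rewrite /adm (filter_markings (@admissible D)) /adm_forest.
rewrite (eq_filter (a2 := all (@admissible D))); last by move=> l' /=; rewrite admissible_node.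
rewrite [X in _ ++ map _ X](eq_filter (a2 := all unmarked)); last first.
  by move=> l' /=; rewrite admissible_node.
by rewrite !choices_filter -!map_comp filter_unmarked choices_single.
Qed.

Lemma unmark_clear (s : seq (tree D)) : map (@unmark D) (map clear_marks s) = s.
Proof. by elim/forest_ind: s => //= d l s -> ->. Qed.

Lemma cop_fH s : cop (fH s) =
  \sum_(c <- adm_forest s) fH (cutP_forest c) ⊗ fH (cutR_forest c).
Proof.
rewrite fHE [LHS]linextU tens_lock; apply: eq_bigr => c _.
by rewrite !fHE.
Qed.

Lemma lin_cop (U : lmodType K) (f : U -> H) : linear f -> linear (fun x => cop (f x)).
Proof. exact: lin_app. Qed.

Lemma cop_one : cop 1 = 1 ⊗ 1.
Proof. by rewrite -fH0 cop_fH big_seq1. Qed.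

Lemma cop_cat s t : cop (fH (s ++ t)) =
  \sw_(x, y <- cop (fH s)) \sw_(z, w <- cop (fH t)) ((x * z) ⊗ (y * w)).
Proof.
rewrite !cop_fH {1}/adm_forest map_cat big_choices_cat sw_bigsum.
apply: eq_bigr => c1 _; rewrite sw_tens; last by bilin.
rewrite sw_bigsum; apply: eq_bigr => c2 _; rewrite sw_tens; last by bilin.
by rewrite /cutP_forest /cutR_forest !map_cat !flatten_cat !fH_cat.
Qed.

(** The cocycle property of B_d: the total cut gives the first term, all other cuts are cuts of the
    forest below the root. With [cop_cat] it determines the coproduct. *)
Lemma cop_node d s : cop (fH [:: Node d s]) =
  fH [:: Node d s] ⊗ 1 + \sw_(x, y <- cop (fH s)) (x ⊗ Bplus d y).
Proof.
rewrite !cop_fH /adm_forest [map _ [:: _]]/= adm_node.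
set l := _ ++ _.
have -> : choices [:: l] = [seq [:: m] | m <- l].
  by rewrite /=; elim: l => //= m l ->.
rewrite big_map big_cat big_map big_seq1 [LHS]addrC; congr (_ + _).
  by rewrite /cutP_forest /cutR_forest /= unmark_clear fH0.
rewrite sw_bigsum; apply: eq_bigr => c _; rewrite sw_tens.
  by rewrite Bplus_fH /cutP_forest /cutR_forest /= !cats0.
by split=> ?; [lin | apply: lin_tensr; apply: lin_Bplus; lin].
Qed.

Section TreeBialgebra.

Variable S : bidend_ops K (forest_pos D).
Hypothesis ST : is_tree_dendriform S.
Hypothesis SM : bidendriform_compat S.
Hypothesis prim_dot : forall d, prim_tot S (dot K d).

Lemma dred_dot d : ldred S (dot K d) = 0.
Proof. by case: (prim_dot d) => h1 h2; rewrite ldredE h1 h2 addr0. Qed.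

(** The same cocycle property for the bidendriform structure, since • ≺ x = B_d(x). *)
Lemma dred_dot_prec d x :
  ldred S (bprec S (dot K d ⊗ x)) =
  \sw_(x1, x2 <- ldred S x) (x1 ⊗ bprec S (dot K d ⊗ x2)) + x ⊗ dot K d.
Proof.
have [_ hs _ hp] := compat_locked SM (dot K d) x.
rewrite ldredE hs hp dred_dot !sw0l !add0r [ldred S x]ldredE swDl; abel.
Qed.

(** The full coproduct rebuilt from the reduced one, with values in H^D ⊗ H^D. *)
Definition full_cop (x : {malg K[forest_pos D]}) : {malg K[(forest D * forest D)%type]} :=
  ltmap aug aug (ldred S x) + aug x ⊗ 1 + 1 ⊗ aug x.

Lemma aug_bilinear : bilinear_map (fun x y => aug x ⊗ aug y).
Proof. by split=> ?; [apply: lin_tensl|apply: lin_tensr]; apply: lin_aug; apply: lin_id. Qed.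

(** The nine products of the three terms of each factor are the seven terms of [dred_mul] together
    with ab ⊗ 1 and 1 ⊗ ab. *)
Lemma full_cop_mul a b : full_cop (lbmul S a b) =
  \sw_(x, y <- full_cop a) \sw_(z, w <- full_cop b) ((x * z) ⊗ (y * w)).
Proof.
have mulE : forall x y, aug (lbmul S x y) = aug x * aug y by case: ST.
have bT := aug_bilinear.
pose E1 (x y : H) := \sw_(z, w <- ldred S b) ((x * aug z) ⊗ (y * aug w)).
pose E2 (x y : H) := (x * aug b) ⊗ y.
pose E3 (x y : H) := x ⊗ (y * aug b).
have inner x y : \sw_(z, w <- full_cop b) ((x * z) ⊗ (y * w)) =
    E1 x y + E2 x y + E3 x y.
  have bE : bilinear_map (fun z w : H => (x * z) ⊗ (y * w)) by bilin.
  rewrite /full_cop !swDl (sw_tmap _ _ _ bE) !(sw_tens _ _ bE) /E1 /E2 /E3 !mulr1.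
  by [].
rewrite (eq_sw _ inner) !swDr /full_cop.
have bE1 : bilinear_map E1 by split=> ?; apply: lin_sw_fun => z w; lin.
have bE2 : bilinear_map E2 by rewrite /E2; bilin.
have bE3 : bilinear_map E3 by rewrite /E3; bilin.
rewrite !swDl !(sw_tmap _ _ _ bE1) !(sw_tmap _ _ _ bE2) !(sw_tmap _ _ _ bE3).
rewrite !(sw_tens _ _ bE1) !(sw_tens _ _ bE2) !(sw_tens _ _ bE3).
rewrite mulE dred_mul // ltmapE !swDl !sw_sw_tens2 // !sw_sw_tens // !sw_tens //.
have e1 : \sw_(x, y <- ldred S a) \sw_(z, w <- ldred S b)
      (aug (lbmul S x z) ⊗ aug (lbmul S y w)) =
    \sw_(x, y <- ldred S a) E1 (aug x) (aug y).
  by apply: eq_sw => x y; apply: eq_sw => z w; rewrite !mulE.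
have e2 : \sw_(z, w <- ldred S b) (aug (lbmul S a z) ⊗ aug w) = E1 (aug a) 1.
  by apply: eq_sw => x y; rewrite mulE mul1r.
have e3 : \sw_(z, w <- ldred S b) (aug z ⊗ aug (lbmul S a w)) = E1 1 (aug a).
  by apply: eq_sw => x y; rewrite mulE mul1r.
have e4 : \sw_(x, y <- ldred S a) (aug x ⊗ aug (lbmul S y b)) =
    \sw_(x, y <- ldred S a) E3 (aug x) (aug y).
  by apply: eq_sw => x y; rewrite mulE.
have e5 : \sw_(x, y <- ldred S a) (aug (lbmul S x b) ⊗ aug y) =
    \sw_(x, y <- ldred S a) E2 (aug x) (aug y).
  by apply: eq_sw => x y; rewrite mulE.
have f1 : E2 1 (aug a) = aug b ⊗ aug a by apply: (congr1 (fun z => z ⊗ aug a)); apply: mul1r.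
have f2 : E3 (aug a) 1 = aug a ⊗ aug b by apply: (congr1 (fun z => aug a ⊗ z)); apply: mul1r.
rewrite [X in X + _ + _ + _ + _ + _ + _ + _ + _ = _]e1.
rewrite [X in _ + X + _ + _ + _ + _ + _ + _ + _ = _]e2.
rewrite [X in _ + _ + X + _ + _ + _ + _ + _ + _ = _]e3.
rewrite [X in _ + _ + _ + X + _ + _ + _ + _ + _ = _]e4.
rewrite [X in _ + _ + _ + _ + X + _ + _ + _ + _ = _]e5.
rewrite [X in _ = _ + (_ + _ + X) + _]f1 [X in _ = _ + _ + (_ + X + _)]f2.
rewrite -[(aug a * aug b) ⊗ 1]/(E2 (aug a) 1) -[1 ⊗ (aug a * aug b)]/(E3 1 (aug a)).
by abel.
Qed.

(** Both sides are multiplicative and satisfy the cocycle equation for B_d, so induction on forests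
    identifies them. *)
Lemma full_copE x : full_cop x = cop (aug x).
Proof.
have bT := aug_bilinear.
have lfull : linear full_cop.
  apply: lin_sum; [apply: lin_sum; [apply: lin_tmap; lin|]|].
    by apply: lin_tensl; apply: lin_aug; apply: lin_id.
  by apply: lin_tensr; apply: lin_aug; apply: lin_id.
move: x; apply: eq_linear => //; first by apply: lin_cop; apply: lin_aug; apply: lin_id.
move=> F; rewrite fA_basis (aug_fA K (forest_pos_neq0 F)).
elim/forest_ind: (val F : seq _) (forest_pos_neq0 F) => // d l s IHl IHs _.
have node_neq0 : [:: Node d l] != [::] by [].
have tE : full_cop (fA K [:: Node d l]) = cop (fH [:: Node d l]).
  rewrite cop_node /full_cop (aug_fA K node_neq0).
  have [l0|l0] := eqVneq l [::].
    rewrite l0 fA_dot dred_dot ltmapE sw0l add0r fH0 cop_one sw_tens.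
      by rewrite -fH0 Bplus_fH.
    by split=> ?; [lin | apply: lin_tensr; apply: lin_Bplus; lin].
  have bB : bilinear_map (fun x y : H => x ⊗ Bplus d y).
    by split=> ?; [lin | apply: lin_tensr; apply: lin_Bplus; lin].
  rewrite -(IHl l0) /full_cop (aug_fA K l0) !swDl !sw_tens //.
  rewrite (fA_node ST d l0) dred_dot_prec !ltmapE swDl sw_sw_tens // sw_tens // sw_sw_tens //.
  have -> : \sw_(x, y <- ldred S (fA K l)) (aug x ⊗ aug (bprec S (dot K d ⊗ y))) =
      \sw_(x, y <- ldred S (fA K l)) (aug x ⊗ Bplus d (aug y)).
    by apply: eq_sw => x y; case: ST => _ _ ->.
  rewrite (aug_fA K l0) -fA_dot aug_fA // -[in RHS]fH0 !Bplus_fH fH0.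
  by abel.
have [s0|s0] := eqVneq s [::]; first by rewrite s0; apply: tE.
by rewrite (fA_cons ST _ s0) -[Node d l :: s]cat1s cop_cat -tE -(IHs s0) full_cop_mul.
Qed.

End TreeBialgebra.

End ForestCoproduct.

(** * Coproducts along dendriform morphisms *)

Section CoalgebraMorphisms.

Variables (K : fieldType) (X Y : choiceType).
Variables (T : bidend_ops K X) (U : bidend_ops K Y).
Variable f : {linear {malg K[X]} -> {malg K[Y]}}.
Hypothesis f_prec : forall a b, f (bprec T (a ⊗ b)) = bprec U (f a ⊗ f b).
Hypothesis f_succ : forall a b, f (bsucc T (a ⊗ b)) = bsucc U (f a ⊗ f b).

Lemma morph_mul a b : f (lbmul T a b) = lbmul U (f a) (f b).
Proof. by rewrite !lbmulE linearD /= f_prec f_succ. Qed.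

Definition cop_compatible (a : {malg K[X]}) : Prop :=
  dprec U (f a) = ltmap f f (dprec T a) /\ dsucc U (f a) = ltmap f f (dsucc T a).

Lemma dred_compatible a : cop_compatible a -> ldred U (f a) = ltmap f f (ldred T a).
Proof. by case=> h1 h2; rewrite !ldredE h1 h2 !ltmapE swDl. Qed.

Let bT : bilinear_map (fun x y => f x ⊗ f y).
Proof. by bilin. Qed.

Lemma sw_tmap2 (W : lmodType K) t s
    (E : {malg K[Y]} -> {malg K[Y]} -> {malg K[Y]} -> {malg K[Y]} -> W) :
  (forall x y, bilinear_map (E x y)) ->
  (forall a b, bilinear_map (fun x y => E x y a b)) ->
  \sw_(x, y <- ltmap f f t) \sw_(z, w <- ltmap f f s) E x y z w =
  \sw_(x, y <- t) \sw_(z, w <- s) E (f x) (f y) (f z) (f w).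
Proof.
move=> bE1 bE2; rewrite sw_tmap.
  by apply: eq_sw => x y; rewrite sw_tmap.
by split=> z; apply: lin_sw_fun => x y; case: (bE2 x y).
Qed.

Section CompatTerms.

Variables a b : {malg K[X]}.
Hypotheses (ca : cop_compatible a) (cb : cop_compatible b).

Let morph_terms (oT : {linear {malg K[(X * X)%type]} -> {malg K[X]}})
    (oU : {linear {malg K[(Y * Y)%type]} -> {malg K[Y]}})
    (DT : {linear {malg K[X]} -> {malg K[(X * X)%type]}})
    (DU : {linear {malg K[Y]} -> {malg K[(Y * Y)%type]}}) :
  (forall x y, f (oT (x ⊗ y)) = oU (f x ⊗ f y)) ->
  DU (f b) = ltmap f f (DT b) ->
  [/\ \sw_(a1, a2 <- ldred U (f a)) \sw_(b1, b2 <- DU (f b)) (lbmul U a1 b1 ⊗ oU (a2 ⊗ b2))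
      = ltmap f f (\sw_(a1, a2 <- ldred T a) \sw_(b1, b2 <- DT b) (lbmul T a1 b1 ⊗ oT (a2 ⊗ b2))),
      \sw_(a1, a2 <- ldred U (f a)) (a1 ⊗ oU (a2 ⊗ f b))
      = ltmap f f (\sw_(a1, a2 <- ldred T a) (a1 ⊗ oT (a2 ⊗ b))),
      \sw_(b1, b2 <- DU (f b)) (b1 ⊗ oU (f a ⊗ b2))
      = ltmap f f (\sw_(b1, b2 <- DT b) (b1 ⊗ oT (a ⊗ b2))),
      \sw_(b1, b2 <- DU (f b)) (lbmul U (f a) b1 ⊗ b2)
      = ltmap f f (\sw_(b1, b2 <- DT b) (lbmul T a b1 ⊗ b2))
    & \sw_(a1, a2 <- ldred U (f a)) (lbmul U a1 (f b) ⊗ a2)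
      = ltmap f f (\sw_(a1, a2 <- ldred T a) (lbmul T a1 b ⊗ a2))].
Proof.
move=> fo Db; rewrite Db dred_compatible //; split; rewrite [RHS]ltmapE.
- rewrite sw_sw_tens2 // sw_tmap2 => [|x y|x y]; [|by bilin|by bilin].
  by apply: eq_sw => x y; apply: eq_sw => z w; rewrite morph_mul fo.
- rewrite sw_sw_tens // sw_tmap; last by bilin.
  by apply: eq_sw => x y; rewrite fo.
- rewrite sw_sw_tens // sw_tmap; last by bilin.
  by apply: eq_sw => x y; rewrite fo.
- rewrite sw_sw_tens // sw_tmap; last by bilin.
  by apply: eq_sw => x y; rewrite morph_mul.
- rewrite sw_sw_tens // sw_tmap; last by bilin.
  by apply: eq_sw => x y; rewrite morph_mul.
Qed.

Let ltmapD s t : ltmap f f (s + t) = ltmap f f s + ltmap f f t.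
Proof. by rewrite !ltmapE swDl. Qed.

Let ltmap_tens x y : ltmap f f (x ⊗ y) = f x ⊗ f y.
Proof. by rewrite ltmapE sw_tens. Qed.

Let terms_ss := morph_terms f_succ cb.2.
Let terms_sp := morph_terms f_prec cb.2.
Let terms_ps := morph_terms f_succ cb.1.
Let terms_pp := morph_terms f_prec cb.1.

(** The compatibility formulas have the same shape in T and U and involve only products and the
    coproducts of a and b, so f carries each term to the corresponding one. *)
Lemma compatible_prec_succ : bidendriform_compat T -> bidendriform_compat U ->
  cop_compatible (bprec T (a ⊗ b)) /\ cop_compatible (bsucc T (a ⊗ b)).
Proof.
move=> TM UM; have [hT1 hT2 hT3 hT4] := compat_locked TM a b.
have [hU1 hU2 hU3 hU4] := compat_locked UM (f a) (f b).
have [m1 m2 m3 m4 m5] := terms_ss; have [n1 n2 n3 n4 n5] := terms_sp.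
have [k1 k2 k3 k4 k5] := terms_ps; have [l1 l2 l3 l4 l5] := terms_pp.
split; split.
- by rewrite f_prec hU4 hT4 !ltmapD ltmap_tens l1 l5 l3.
- by rewrite f_prec hU2 hT2 !ltmapD n1 n2 n3.
- by rewrite f_succ hU3 hT3 !ltmapD k1 k4 k3.
- by rewrite f_succ hU1 hT1 !ltmapD ltmap_tens m1 m2 m3 m4.
Qed.

(** The opposite use of the same terms: when f respects the coproducts everywhere, the formulas for
    T imply those for U on the image of f. *)
Lemma compat_image : bidendriform_compat T -> (forall c, cop_compatible c) ->
  [/\ dsucc U (bsucc U (f a ⊗ f b)) =
          \sw_(a1, a2 <- ldred U (f a)) \sw_(b1, b2 <- dsucc U (f b))
             (lbmul U a1 b1 ⊗ bsucc U (a2 ⊗ b2))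
        + \sw_(a1, a2 <- ldred U (f a)) (a1 ⊗ bsucc U (a2 ⊗ f b))
        + \sw_(b1, b2 <- dsucc U (f b)) (b1 ⊗ bsucc U (f a ⊗ b2))
        + \sw_(b1, b2 <- dsucc U (f b)) (lbmul U (f a) b1 ⊗ b2)
        + f a ⊗ f b,
      dsucc U (bprec U (f a ⊗ f b)) =
          \sw_(a1, a2 <- ldred U (f a)) \sw_(b1, b2 <- dsucc U (f b))
             (lbmul U a1 b1 ⊗ bprec U (a2 ⊗ b2))
        + \sw_(a1, a2 <- ldred U (f a)) (a1 ⊗ bprec U (a2 ⊗ f b))
        + \sw_(b1, b2 <- dsucc U (f b)) (b1 ⊗ bprec U (f a ⊗ b2)),
      dprec U (bsucc U (f a ⊗ f b)) =
          \sw_(a1, a2 <- ldred U (f a)) \sw_(b1, b2 <- dprec U (f b))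
             (lbmul U a1 b1 ⊗ bsucc U (a2 ⊗ b2))
        + \sw_(b1, b2 <- dprec U (f b)) (lbmul U (f a) b1 ⊗ b2)
        + \sw_(b1, b2 <- dprec U (f b)) (b1 ⊗ bsucc U (f a ⊗ b2))
    & dprec U (bprec U (f a ⊗ f b)) =
          \sw_(a1, a2 <- ldred U (f a)) \sw_(b1, b2 <- dprec U (f b))
             (lbmul U a1 b1 ⊗ bprec U (a2 ⊗ b2))
        + \sw_(a1, a2 <- ldred U (f a)) (lbmul U a1 (f b) ⊗ a2)
        + \sw_(b1, b2 <- dprec U (f b)) (b1 ⊗ bprec U (f a ⊗ b2))
        + f b ⊗ f a].
Proof.
move=> TM cop_f; have [hT1 hT2 hT3 hT4] := compat_locked TM a b.
have [m1 m2 m3 m4 m5] := terms_ss; have [n1 n2 n3 n4 n5] := terms_sp.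
have [k1 k2 k3 k4 k5] := terms_ps; have [l1 l2 l3 l4 l5] := terms_pp.
split.
- by rewrite -f_succ (cop_f _).2 hT1 !ltmapD ltmap_tens m1 m2 m3 m4.
- by rewrite -f_prec (cop_f _).2 hT2 !ltmapD n1 n2 n3.
- by rewrite -f_succ (cop_f _).1 hT3 !ltmapD k1 k4 k3.
- by rewrite -f_prec (cop_f _).1 hT4 !ltmapD ltmap_tens l1 l5 l3.
Qed.

End CompatTerms.

Section Transport.

Variable g : {malg K[Y]} -> {malg K[X]}.
Hypothesis fgK : cancel g f.
Hypothesis cop_f : forall a, cop_compatible a.

Lemma transport_compat : bidendriform_compat T -> bidendriform_compat U.
Proof.
move=> TM a b; rewrite !sw_lock !tens_lock !bmul_lock !dred_lock -(fgK a) -(fgK b).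
exact: compat_image.
Qed.

Lemma transport_coalgebra : dendriform_coalgebra T -> dendriform_coalgebra U.
Proof.
move=> TC a; rewrite !sw_lock !tens_lock dred_lock -(fgK a); move: (g a) => {}a.
have triH : trilinear_map (fun x y z => f x ⊗ (f y ⊗ f z)) by trilin.
have fD (DT : {malg K[X]} -> {malg K[(X * X)%type]})
    (DU : {malg K[Y]} -> {malg K[(Y * Y)%type]}) t :
    linear DU -> (forall c, DU (f c) = ltmap f f (DT c)) ->
    \sw_(a1, a2 <- ltmap f f t) \sw_(x, y <- DU a1) (x ⊗ (y ⊗ a2)) =
      \sw_(a1, a2 <- t) \sw_(x, y <- DT a1) (f x ⊗ (f y ⊗ f a2)) /\
    \sw_(a1, a2 <- ltmap f f t) (a1 ⊗ DU a2) =
      \sw_(a1, a2 <- t) \sw_(x, y <- DT a2) (f a1 ⊗ (f x ⊗ f y)).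
  move=> lD Df; split.
    rewrite sw_tmap; last by split=> z; lin.
    by apply: eq_sw => x y; rewrite Df sw_tmap //; bilin.
  rewrite sw_tmap; last by split=> z; lin.
  apply: eq_sw => x y; rewrite Df ltmapE -(sw_app (f := fun t => f x ⊗ t)) //.
  by lin.
have [pl pr] := fD (dprec T) (dprec U) (dprec T a) (@linearP _ _ _ _ _) (fun c => (cop_f c).1).
have [pls prs] := fD (dprec T) (dprec U) (dsucc T a) (@linearP _ _ _ _ _) (fun c => (cop_f c).1).
have [sl sr] := fD (dsucc T) (dsucc U) (dprec T a) (@linearP _ _ _ _ _) (fun c => (cop_f c).2).
have [sls srs] := fD (dsucc T) (dsucc U) (dsucc T a) (@linearP _ _ _ _ _) (fun c => (cop_f c).2).
have lDU : linear (ldred U) by move=> c x y; rewrite (lin_dred U (@lin_id K _)).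
have [tl tr] := fD (ldred T) (ldred U) (dprec T a) lDU (fun c => dred_compatible (cop_f c)).
have [tls trs] := fD (ldred T) (ldred U) (dsucc T a) lDU (fun c => dred_compatible (cop_f c)).
rewrite (cop_f a).1 (cop_f a).2; split.
- by rewrite pl tr; apply: coassoc_prec.
- by rewrite sl prs; apply: coassoc_mid.
- by rewrite tls srs; apply: coassoc_succ.
Qed.

End Transport.

End CoalgebraMorphisms.

(** [phi] commutes with the projections [pr] onto degree n, hence so does its inverse. *)
Lemma hom_inverse (K : fieldType) (X Y : choiceType) (d : X -> nat) (e : Y -> nat)
    (phi : {linear {malg K[Y]} -> {malg K[X]}}) (psi : {linear {malg K[X]} -> {malg K[Y]}}) :
  cancel phi psi -> cancel psi phi ->
  (forall F, homogeneous d (e F) (phi << F >>)) ->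
  forall n x, homogeneous d n x -> homogeneous e n (psi x).
Proof.
move=> phiK psiK hphi n x hx.
pose pr (Z : choiceType) (c : Z -> nat) : {linear {malg K[Z]} -> {malg K[Z]}} :=
  linext (fun z => if c z == n then << z >> else 0).
have prE (Z : choiceType) (c : Z -> nat) m z : homogeneous c m z ->
    pr Z c z = if m == n then z else 0.
  move=> hz; rewrite (eq_linear_on (f := pr Z c) (g := fun z => if m == n then z else 0)) //.
  - exact: linearP.
  - by case: (m == n); [exact: lin_id | exact: lin_const0].
  - by move=> u uz; rewrite [LHS]linextU (hz u uz).
have pr_hom (Z : choiceType) (c : Z -> nat) z : homogeneous c n (pr Z c z).
  apply: hom_bigsum => u _ _; apply: homZ; case: eqP => [<-|_]; first exact: homU.
  exact: hom0.
have comm y : phi (pr Y e y) = pr X d (phi y).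
  move: y; apply: (eq_linear (f := fun y => phi (pr Y e y)) (g := fun y => pr X d (phi y))).
  - by lin.
  - by lin.
  move=> F; rewrite (prE _ _ _ _ (hphi F)) [pr Y e _]linextU.
  by case: eqP => // _; apply: linear0.
have <- : pr Y e (psi x) = psi x.
  by apply: (can_inj phiK); rewrite comm psiK (prE _ _ _ _ hx) eqxx.
exact: pr_hom.
Qed.

Section TreeBidendriform.

Variables (K : fieldType) (D : choiceType).

Local Notation A := {malg K[forest_pos D]}.
Local Notation aug := (@aug_incl K D).

Lemma tree_bidend_dendriform (S : bidend_ops K (forest_pos D)) :
  is_tree_bidend S -> is_tree_dendriform S.
Proof.
case=> [[SD _ _] mulE dotE _ _]; split; first exact: SD.
- by move=> x y; rewrite lbmulE -tens_lock.
- by move=> d x; rewrite -tens_lock.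
Qed.

Variables (X : choiceType) (T : bidend_ops K X).
Hypothesis TB : bidendriform_bialgebra T.
Variables (phi : {linear A -> {malg K[X]}}) (psi : {linear {malg K[X]} -> A}).
Hypotheses (phiK : cancel phi psi) (psiK : cancel psi phi).
Hypothesis prim_phi : forall x, prim_tot T (phi (dot K x)).

(** On dots all coproducts involved vanish, and compatibility spreads from dots to all forests
    through • ≺ x and concatenation. *)
Lemma tree_bidend_compatible (S : bidend_ops K (forest_pos D)) :
  is_tree_dendriform S -> bidendriform_compat S ->
  (forall x, prim_tot S (dot K x)) ->
  (forall a b, phi (bprec S (a ⊗ b)) = bprec T (phi a ⊗ phi b)) ->
  (forall a b, phi (bsucc S (a ⊗ b)) = bsucc T (phi a ⊗ phi b)) ->
  forall a, cop_compatible S T phi a.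
Proof.
move=> ST SM prim_dot phi_prec phi_succ.
have TM : bidendriform_compat T by case: TB.
have step a b : cop_compatible S T phi a -> cop_compatible S T phi b ->
    cop_compatible S T phi (bprec S (a ⊗ b)) /\ cop_compatible S T phi (lbmul S a b).
  move=> ca cb; have [c1 c2] := compatible_prec_succ phi_prec phi_succ ca cb SM TM.
  split=> //; rewrite lbmulE /cop_compatible !linearD /=.
  by case: c1 c2 => -> -> [-> ->]; rewrite !ltmapE !swDl.
have base x : cop_compatible S T phi (dot K x).
  have [h1 h2] := prim_phi x; have [k1 k2] := prim_dot x.
  by rewrite /cop_compatible h1 h2 k1 k2 !ltmapE !sw0l.
have cfA s : cop_compatible S T phi (fA K s).
  elim/forest_ind: s => [|d l s IHl IHs].
    by rewrite fA0 /cop_compatible !linear0 !ltmapE !sw0l.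
  have tE : cop_compatible S T phi (fA K [:: Node d l]).
    have [->|l0] := eqVneq l [::]; first by rewrite fA_dot.
    by rewrite (fA_node ST d l0); case: (step _ _ (base d) IHl).
  have [->|s0] := eqVneq s [::]; first exact: tE.
  by rewrite (fA_cons ST _ s0); case: (step _ _ tE IHs).
move=> a; split; move: a; apply: eq_linear.
- by lin.
- by apply: lin_tmap; lin.
- by move=> F; rewrite fA_basis; case: (cfA (val F)).
- by lin.
- by apply: lin_tmap; lin.
- by move=> F; rewrite fA_basis; case: (cfA (val F)).
Qed.

Lemma inverse_compatible (S : bidend_ops K (forest_pos D)) :
  (forall a, cop_compatible S T phi a) -> forall a, cop_compatible T S psi a.
Proof.
have tK t : ltmap psi psi (ltmap phi phi t) = t.
  rewrite ltmapE sw_tmap; last by bilin.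
  by rewrite -[RHS]sw_id; apply: eq_sw => x y; rewrite !phiK.
move=> cS a; have [h1 h2] := cS (psi a).
by split; rewrite -[in RHS](psiK a) ?h1 ?h2 tK.
Qed.

Lemma inverse_morph (oS : {linear {malg K[(forest_pos D * forest_pos D)%type]} -> A})
    (oT : {linear {malg K[(X * X)%type]} -> {malg K[X]}}) :
  (forall a b, phi (oS (a ⊗ b)) = oT (phi a ⊗ phi b)) ->
  forall a b, psi (oT (a ⊗ b)) = oS (psi a ⊗ psi b).
Proof. by move=> h a b; rewrite -{1}(psiK a) -{1}(psiK b) -h phiK. Qed.

Lemma full_cop_tree (S : bidend_ops K (forest_pos D)) :
  is_tree_dendriform S -> bidendriform_compat S ->
  (forall x, prim_tot S (dot K x)) -> forall x,
  ltmap aug aug (dprec S x + dsucc S x) = forest_cop (aug x) - aug x ⊗ 1 - 1 ⊗ aug x.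
Proof.
move=> ST SM prim_dot x; rewrite -(full_copE ST SM prim_dot) /full_cop ldredE.
by abel.
Qed.

(** The products of S, with the coproducts of T pulled back through [phi] and [psi]. *)
Definition transported_ops (S : bidend_ops K (forest_pos D)) : bidend_ops K (forest_pos D) :=
  BidendOps (bprec S) (bsucc S)
    (linext (fun F => ltmap psi psi (dprec T (phi << F >>))))
    (linext (fun F => ltmap psi psi (dsucc T (phi << F >>)))).

(** The axioms pass along [psi], dots are totally primitive because their images in T are, and
    [full_cop_tree] then gives the coproduct by admissible cuts. *)
Lemma transported_tree_bidend (S : bidend_ops K (forest_pos D)) :
  is_tree_dendriform S ->
  (forall a b, phi (bprec S (a ⊗ b)) = bprec T (phi a ⊗ phi b)) ->
  (forall a b, phi (bsucc S (a ⊗ b)) = bsucc T (phi a ⊗ phi b)) ->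
  is_tree_bidend (transported_ops S).
Proof.
move=> ST phi_prec phi_succ; set S0 := transported_ops S.
have dprecE a : dprec S0 a = ltmap psi psi (dprec T (phi a)).
  move: a; apply: eq_linear; first exact: linearP.
    by apply: lin_tmap; lin.
  by move=> F; rewrite [LHS]linextU.
have dsuccE a : dsucc S0 a = ltmap psi psi (dsucc T (phi a)).
  move: a; apply: eq_linear; first exact: linearP.
    by apply: lin_tmap; lin.
  by move=> F; rewrite [LHS]linextU.
have ST0 : is_tree_dendriform S0.
  case: ST => SD mulE dotE; split; [exact: SD| |exact: dotE].
  by move=> x y; rewrite lbmulE -[bprec S0]/(bprec S) -[bsucc S0]/(bsucc S) -lbmulE.
have psi_prec : forall a b, psi (bprec T (a ⊗ b)) = bprec S0 (psi a ⊗ psi b).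
  exact: inverse_morph phi_prec.
have psi_succ : forall a b, psi (bsucc T (a ⊗ b)) = bsucc S0 (psi a ⊗ psi b).
  exact: inverse_morph phi_succ.
have cT a : cop_compatible T S0 psi a by rewrite /cop_compatible dprecE dsuccE psiK.
have [TD TC TM] := TB; have [SD0 mulE0 dotE0] := ST0.
have SM0 := transport_compat psi_prec psi_succ phiK cT TM.
have prim0 x : prim_tot S0 (dot K x).
  have [h1 h2] := prim_phi x.
  by split; [rewrite dprecE h1 ltmapE sw0l|rewrite dsuccE h2 ltmapE sw0l].
split.
- by split; [exact: SD0|exact: (transport_coalgebra phiK cT TC)|exact: SM0].
- by move=> x y; rewrite tens_lock -lbmulE; apply: mulE0.
- by move=> d x; rewrite tens_lock; apply: dotE0.
- by move=> x; rewrite tmap_lock !tens_lock; apply: (full_cop_tree ST0 SM0 prim0).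
- exact: prim0.
Qed.

End TreeBidendriform.

(** * FQSym as (FQSym)_+ with a unit *)

Section FQSymHopf.

Variable K : fieldType.

Local Notation fq := (fqsym_bidend K).
Local Notation A := {malg K[perm_word_pos]}.
Local Notation B := {malg K[perm_word]}.
Local Notation wd := (@wd K).

Definition wf (w : seq nat) : B := @F_ K is_perm_word w.

Definition fq_incl : {linear A -> B} := linext (fun V : perm_word_pos => wf (val V)).

Lemma wf_basis (U : perm_word) : << U >> = wf (val U).
Proof. by rewrite /wf /F_ valK. Qed.

Lemma fq_inclU (V : perm_word_pos) : fq_incl << V >> = wf (val V).
Proof. exact: linextU. Qed.

Lemma fq_incl_wd w : uniq w -> w != [::] -> fq_incl (wd w) = wf (std w).
Proof. by move=> uw w0; have [V -> <-] := wdU K uw w0; apply: fq_inclU. Qed.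

(** FQSym is spanned by the unit and (FQSym)_+. *)
Lemma eq_linear_fq (W : lmodType K) (f g : B -> W) :
  linear f -> linear g -> f (wf [::]) = g (wf [::]) ->
  (forall a, f (fq_incl a) = g (fq_incl a)) -> forall x, f x = g x.
Proof.
move=> lf lg fg0 fg; apply: eq_linear => // U; rewrite wf_basis.
have [->|u0] := eqVneq (val U) [::]; first exact: fg0.
have pU : is_perm_word (val U) && (val U != [::]) by rewrite (valP U).
by rewrite -[val U]/(val (Sub (val U) pU : perm_word_pos)) -fq_inclU.
Qed.

Lemma shuffles_perm_word u v w : is_perm_word u -> is_perm_word v ->
  w \in shuffles u (shift (size u) v) -> is_perm_word w.
Proof.
rewrite /is_perm_word => pu pv /perm_shuffles pw; have := perm_size pw.
rewrite size_cat size_map => ->; rewrite iotaD; apply: perm_trans pw _.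
apply: perm_cat => //; rewrite (perm_trans (perm_map _ pv)) //.
by rewrite addnC iotaDl.
Qed.

Lemma lin_fqsym_mull (U : lmodType K) (f : U -> B) y :
  linear f -> linear (fun x => fqsym_mul (f x) y).
Proof. by move=> lf; rewrite /fqsym_mul tens_lock; apply: lin_app; lin. Qed.

Lemma lin_fqsym_mulr (U : lmodType K) (f : U -> B) x :
  linear f -> linear (fun y => fqsym_mul x (f y)).
Proof. by move=> lf; rewrite /fqsym_mul tens_lock; apply: lin_app; lin. Qed.

Lemma fqsym_mul_basis (U V : perm_word) : fqsym_mul << U >> << V >> =
  \sum_(w <- shuffles (val U) (shift (size (val U)) (val V))) wf w.
Proof. by rewrite /fqsym_mul tens_lock tensUU linextU. Qed.

Lemma wf0U : exists2 U : perm_word, wf [::] = << U >> & val U = [::].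
Proof.
have p0 : is_perm_word [::] by [].
by exists (Sub [::] p0); rewrite ?wf_basis SubK.
Qed.

Lemma fqsym_mul1 x : fqsym_mul (wf [::]) x = x.
Proof.
move: x; apply: eq_linear; [by apply: lin_fqsym_mulr; lin|by lin|] => V.
have [U -> U0] := wf0U; rewrite fqsym_mul_basis U0 shuffles0l big_seq1.
by rewrite /shift map_id wf_basis.
Qed.

Lemma fqsym_mulr1 x : fqsym_mul x (wf [::]) = x.
Proof.
move: x; apply: eq_linear; [by apply: lin_fqsym_mull; lin|by lin|] => V.
have [U -> U0] := wf0U; rewrite fqsym_mul_basis U0 shuffles0r big_seq1.
by rewrite wf_basis.
Qed.

Lemma fq_incl_mul a b :
  fqsym_mul (fq_incl a) (fq_incl b) = fq_incl (lbmul fq a b).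
Proof.
apply: (eq_bilinear (f := fun a b => fqsym_mul (fq_incl a) (fq_incl b))
                    (g := fun a b => fq_incl (lbmul fq a b))).
- by split=> ?; [apply: lin_fqsym_mull|apply: lin_fqsym_mulr]; lin.
- by bilin.
move=> U V; have /andP[pu u0] := valP U; have /andP[pv v0] := valP V.
set u := val U in pu u0 *; set v := shift (size u) (val V).
have suv : separated u v.
  apply: separatedI; first exact: perm_word_uniq.
    by rewrite map_inj_uniq ?perm_word_uniq // => x y; apply: addnI.
  move=> x y /letters_perm_word xu /mapP[z /letters_perm_word zv ->].
  case/andP: xu => _ /leq_ltn_trans; apply; case/andP: zv => z_gt0 _.
  by rewrite -[X in (X < _)%N]addn0 ltn_add2l.
have v0' : v != [::] by rewrite -size_eq0 size_map size_eq0.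
have eV : << V >> = wd v by rewrite wd_shift wd_basis.
rewrite eV [in RHS]wd_basis (bmul_wd K suv u0 v0') /shuffle_sum linear_sum -eV !fq_inclU.
have sU : wf (val U) = << (Sub u pu : perm_word) >> by rewrite wf_basis.
have sV : wf (val V) = << (Sub (val V) pv : perm_word) >> by rewrite wf_basis.
rewrite sU sV fqsym_mul_basis /= big_seq [RHS]big_seq; apply: eq_bigr => w hw.
have pw := shuffles_perm_word pu pv hw.
by rewrite fq_incl_wd ?std_id ?perm_word_uniq //; apply: shuffles_neq0 hw u0.
Qed.

Lemma fqsym_cop_basis (U : perm_word) : fqsym_cop << U >> =
  \sum_(p <- splits (val U)) wf (std p.1) ⊗ wf (std p.2).
Proof.
rewrite [LHS]linextU tens_lock.
by rewrite (big_splitsE (fun x y => wf (std x) ⊗ wf (std y))).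
Qed.

Lemma lin_fqsym_cop (U : lmodType K) (f : U -> B) :
  linear f -> linear (fun x => fqsym_cop (f x)).
Proof. exact: lin_app. Qed.

Lemma fqsym_cop1 : fqsym_cop (wf [::]) = wf [::] ⊗ wf [::].
Proof. by have [U e U0] := wf0U; rewrite {1}e fqsym_cop_basis U0 big_seq1. Qed.

(** The two cuts with an empty part give the terms with the unit, the proper cuts give the reduced
    coproduct. *)
Lemma fqsym_cop_incl a : fqsym_cop (fq_incl a) =
  ltmap fq_incl fq_incl (ldred fq a) + fq_incl a ⊗ wf [::] + wf [::] ⊗ fq_incl a.
Proof.
move: a; apply: eq_linear.
- by apply: lin_fqsym_cop; lin.
- by apply: lin_sum; [apply: lin_sum; [apply: lin_tmap; lin|lin]|lin].
move=> V; have /andP[pv v0] := valP V; rewrite fq_inclU.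
have uv := perm_word_uniq pv.
have sV : wf (val V) = << (Sub (val V) pv : perm_word) >> by rewrite wf_basis.
rewrite {1}sV fqsym_cop_basis /=.
rewrite (big_proper_splits (fun x y => wf (std x) ⊗ wf (std y)) v0) (std_id pv).
rewrite ltmapE wd_basis sw_dred_proper; [|by bilin|exact: uv|exact: v0].
have rot (x y z : {malg K[(perm_word * perm_word)%type]}) : x + y + z = z + y + x by abel.
rewrite [LHS]rot; apply: (congr1 (fun z => z + _ + _)).
rewrite big_seq [RHS]big_seq; apply: eq_bigr => p /mem_proper_splits[pV p1 p2].
move: uv; rewrite -pV cat_uniq => /and3P[u1 _ u2].
by rewrite !fq_incl_wd.
Qed.

End FQSymHopf.

(** * From the augmentation ideals to the Hopf algebras *)

Section HopfIsomorphism.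

Variables (K : fieldType) (D : choiceType) (deg : D -> nat).

Local Notation fq := (fqsym_bidend K).
Local Notation A := {malg K[forest_pos D]}.
Local Notation H := {malg K[forest D]}.
Local Notation B := {malg K[perm_word]}.
Local Notation aug := (@aug_incl K D).
Local Notation incl := (fq_incl K).
Local Notation one := (wf K [::]).

Variable S : bidend_ops K (forest_pos D).
Hypothesis ST : is_tree_dendriform S.
Hypothesis SM : bidendriform_compat S.
Hypothesis prim_dot : forall x, prim_tot S (dot K x).
Variables (phi : {linear A -> {malg K[perm_word_pos]}})
          (psi : {linear {malg K[perm_word_pos]} -> A}).
Hypotheses (phiK : cancel phi psi) (psiK : cancel psi phi).
Hypothesis psi_prec : forall a b, psi (bprec fq (a ⊗ b)) = bprec S (psi a ⊗ psi b).
Hypothesis psi_succ : forall a b, psi (bsucc fq (a ⊗ b)) = bsucc S (psi a ⊗ psi b).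
Hypothesis psi_cop : forall a, cop_compatible fq S psi a.
Hypothesis psi_hom : forall n x, homogeneous perm_pos_deg n x ->
  homogeneous (forest_pos_deg deg) n (psi x).

Definition unital_ext : {linear B -> H} :=
  linext (fun U : perm_word =>
    if insub (val U) is Some V then aug (psi << (V : perm_word_pos) >>) else 1).

Definition unital_inv : {linear H -> B} :=
  linext (fun F : forest D =>
    if insub F is Some G then incl (phi << (G : forest_pos D) >>) else one).

Lemma unital_ext1 : unital_ext one = 1.
Proof. by have [U -> U0] := wf0U K; rewrite [LHS]linextU U0 insubF. Qed.

Lemma unital_ext_incl a : unital_ext (incl a) = aug (psi a).
Proof.
move: a; apply: eq_linear; [by lin|by apply: lin_aug; lin|] => V.
have /andP[pv v0] := valP V; rewrite fq_inclU.
have sV : wf K (val V) = << (Sub (val V) pv : perm_word) >> by rewrite wf_basis.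
by rewrite sV [LHS]linextU SubK valK.
Qed.

Lemma unital_inv1 : unital_inv 1 = one.
Proof. by rewrite -[1]/(<< mone >> : H) [LHS]linextU insubF ?eqxx. Qed.

Lemma unital_inv_aug x : unital_inv (aug x) = incl (phi x).
Proof.
move: x; apply: eq_linear; [by apply: lin_app; apply: lin_aug; lin|by lin|] => G.
by rewrite aug_basis [LHS]linextU valK.
Qed.

Lemma eq_linear_aug (W : lmodType K) (f g : H -> W) :
  linear f -> linear g -> f 1 = g 1 -> (forall a, f (aug a) = g (aug a)) ->
  forall x, f x = g x.
Proof.
move=> lf lg fg1 fg; apply: eq_linear => // F.
have [->|F1] := eqVneq F mone; first exact: fg1.
by rewrite -[F]/(val (Sub F F1 : forest_pos D)) -aug_basis.
Qed.

Lemma unital_extK : cancel unital_ext unital_inv.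
Proof.
apply: (eq_linear_fq (f := fun x => unital_inv (unital_ext x)) (g := fun x => x)).
- by lin.
- by lin.
- by rewrite unital_ext1 unital_inv1.
- by move=> a; rewrite unital_ext_incl unital_inv_aug psiK.
Qed.

Lemma unital_invK : cancel unital_inv unital_ext.
Proof.
apply: (eq_linear_aug (f := fun x => unital_ext (unital_inv x)) (g := fun x => x)).
- by lin.
- by lin.
- by rewrite unital_inv1 unital_ext1.
- by move=> a; rewrite unital_inv_aug unital_ext_incl phiK.
Qed.

Lemma unital_ext_mul a b : unital_ext (fqsym_mul a b) = unital_ext a * unital_ext b.
Proof.
have mulE : forall x y, aug (lbmul S x y) = aug x * aug y by case: ST.
move: a; apply: (eq_linear_fq (f := fun a => unital_ext (fqsym_mul a b))
                              (g := fun a => unital_ext a * unital_ext b)).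
- by apply: lin_app; apply: lin_fqsym_mull; lin.
- by lin.
- by rewrite fqsym_mul1 unital_ext1 mul1r.
move=> a; move: b; apply: (eq_linear_fq (f := fun b => unital_ext (fqsym_mul (incl a) b))
                              (g := fun b => unital_ext (incl a) * unital_ext b)).
- by apply: lin_app; apply: lin_fqsym_mulr; lin.
- by lin.
- by rewrite fqsym_mulr1 unital_ext1 mulr1.
move=> b; rewrite fq_incl_mul !unital_ext_incl -mulE; congr aug.
exact: (morph_mul psi_prec psi_succ).
Qed.

(** On (FQSym)_+ both coproducts are the reduced one plus the two terms with the unit, by
    [fqsym_cop_incl] and [full_copE], and [psi] respects the reduced ones. *)
Lemma unital_ext_cop a :
  forest_cop (unital_ext a) = ltmap unital_ext unital_ext (fqsym_cop a).
Proof.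
move: a; apply: (eq_linear_fq (f := fun a => forest_cop (unital_ext a))
                   (g := fun a => ltmap unital_ext unital_ext (fqsym_cop a))).
- by apply: lin_cop; lin.
- by apply: lin_tmap; apply: lin_fqsym_cop; lin.
- rewrite unital_ext1 cop_one fqsym_cop1 ltmapE sw_tens; last by bilin.
  by rewrite unital_ext1.
move=> a; have bT : bilinear_map (fun x y => unital_ext x ⊗ unital_ext y) by bilin.
rewrite unital_ext_incl -(full_copE ST SM prim_dot) /full_cop fqsym_cop_incl.
rewrite [RHS]ltmapE !swDl !sw_tens // unital_ext1 unital_ext_incl.
rewrite (dred_compatible (psi_cop a)) sw_tmap // ltmapE sw_tmap; last exact: aug_bilinear.
apply: (congr1 (fun z => z + _ + _)); apply: eq_sw => x y.
by rewrite !unital_ext_incl.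
Qed.

Lemma unital_ext_counit a :
  forest_counit (unital_ext a) = hcounit (fqsym_hopf K) a.
Proof.
move: a; apply: (eq_linear_fq (W := (K^o : lmodType K))
  (f := fun a => forest_counit (unital_ext a)) (g := hcounit (fqsym_hopf K))).
- by apply: lin_app; lin.
- exact: linearP.
- have [U e U0] := wf0U K; rewrite unital_ext1 {1}e [RHS]linextU U0 eqxx.
  by rewrite -[1 : H]/(<< mone >> : H) [LHS]linextU eqxx.
move=> a; rewrite unital_ext_incl; have /forest_counit_kernel -> : exists y, aug (psi a) = aug y.
  by exists (psi a).
apply/esym; move: a; apply: (eq_linear (W := (K^o : lmodType K))
  (f := fun a => hcounit (fqsym_hopf K) (incl a)) (g := fun _ => 0)).
- by apply: lin_app; lin.
- exact: lin_const0.
move=> V; have /andP[pv v0] := valP V; rewrite fq_inclU.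
have sV : wf K (val V) = << (Sub (val V) pv : perm_word) >> by rewrite wf_basis.
by rewrite sV [LHS]linextU SubK (negbTE v0).
Qed.

Lemma hom_aug n x : homogeneous (forest_pos_deg deg) n x ->
  homogeneous (forest_deg deg) n (aug x).
Proof.
move=> hx; apply: (hom_linear _ hx); first by apply: lin_aug; apply: lin_id.
by move=> G <-; rewrite aug_basis; apply: homU.
Qed.

Lemma hom_unital_ext n x : homogeneous perm_deg n x ->
  homogeneous (forest_deg deg) n (unital_ext x).
Proof.
move=> hx; apply: (hom_linear _ hx); first exact: linearP.
move=> U <-; rewrite wf_basis /perm_deg.
have [->|u0] := eqVneq (val U) [::].
  rewrite unital_ext1 -[1]/(<< mone >> : H).
  by have -> : size [::] = forest_deg deg mone; [rewrite /forest_deg fm1|apply: homU].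
have pU : is_perm_word (val U) && (val U != [::]) by rewrite (valP U).
rewrite -[val U]/(val (Sub (val U) pU : perm_word_pos)) -fq_inclU unital_ext_incl.
by apply: hom_aug; apply: psi_hom; apply: homU.
Qed.

Lemma hopf_iso : graded_hopf_iso perm_deg (forest_deg deg) (fqsym_hopf K) (forest_hopf K D).
Proof.
exists unital_ext; split.
- by exists unital_inv; [apply: unital_extK|apply: unital_invK].
- exact: hom_unital_ext.
- by split; [exact: unital_ext_mul|exact: unital_ext1].
split; last exact: unital_ext_counit.
by move=> a; rewrite tmap_lock; apply: unital_ext_cop.
Qed.

End HopfIsomorphism.

Theorem theorem39 (K : fieldType) (p : nat -> nat)
  (hp : forall n, (1 <= n)%N ->
     has_dim (fun a : {malg K[perm_word_pos]} =>
                prim_tot (fqsym_bidend K) a /\ homogeneous perm_pos_deg n a)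
             (p n))
  (D : choiceType) (deg : D -> nat)
  (hD0 : forall d, deg d <> 0%N)
  (hD : forall n, (1 <= n)%N -> has_card (fun d => deg d = n) (p n)) :
  [/\ exists S : bidend_ops K (forest_pos D), is_tree_bidend S,
      forall S : bidend_ops K (forest_pos D), is_tree_bidend S ->
        graded_bidend_iso perm_pos_deg (forest_pos_deg deg)
          (fqsym_bidend K) S
    & graded_hopf_iso perm_deg (forest_deg deg)
        (fqsym_hopf K) (forest_hopf K D)].
Proof.
have TB := fqsym_bidendriform K.
have iso := exists_dendriform_iso TB (fqsym_graded K) perm_pos_deg_gt0 hp hD0 hD.
have [S1 S1P] : exists S : bidend_ops K (forest_pos D), is_tree_bidend S.
  (* The zero coproducts are placeholders, replaced by the transported ones. *)
  have ST := tree_dendriform (K := K) (D := D) (linext (fun=> 0)) (linext (fun=> 0)).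
  have [phi [psi [phiK psiK phi_prec phi_succ [prim_phi _]]]] := iso _ ST.
  by eexists; apply: (transported_tree_bidend TB phiK psiK prim_phi ST phi_prec phi_succ).
have morphisms S : is_tree_bidend S -> exists (phi : {linear {malg K[forest_pos D]} -> {malg K[perm_word_pos]}})
      (psi : {linear {malg K[perm_word_pos]} -> {malg K[forest_pos D]}}),
    [/\ cancel phi psi /\ cancel psi phi,
      forall a b, psi (bprec (fqsym_bidend K) (a ⊗ b)) = bprec S (psi a ⊗ psi b),
      forall a b, psi (bsucc (fqsym_bidend K) (a ⊗ b)) = bsucc S (psi a ⊗ psi b),
      forall a, cop_compatible (fqsym_bidend K) S psi a
    & forall n x, homogeneous perm_pos_deg n x ->
        homogeneous (forest_pos_deg deg) n (psi x)].
  move=> SP; have ST := tree_bidend_dendriform SP.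
  have [phi [psi [phiK psiK phi_prec phi_succ [prim_phi hom_phi]]]] := iso _ ST.
  exists phi, psi; split=> //.
  - exact: (inverse_morph phiK psiK phi_prec).
  - exact: (inverse_morph phiK psiK phi_succ).
  - case: SP => [[_ _ SM] _ _ _ prim_dot].
    exact: (inverse_compatible phiK psiK
      (tree_bidend_compatible TB prim_phi ST SM prim_dot phi_prec phi_succ)).
  - exact: (hom_inverse phiK psiK hom_phi).
split; first by exists S1.
- move=> S SP; have [phi [psi [[phiK psiK] psi_prec psi_succ psi_cop psi_hom]]] := morphisms S SP.
  exists psi; split; first by exists phi.
  + exact: psi_hom.
  + by rewrite !tens_lock; split; [exact: psi_prec|exact: psi_succ].
  + by rewrite tmap_lock; split=> a; have [h1 h2] := psi_cop a; [exact: h1|exact: h2].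
(* The Hopf statement involves no half products; the structure [S1] found above serves as
   intermediary. *)
have [phi [psi [[phiK psiK] psi_prec psi_succ psi_cop psi_hom]]] := morphisms S1 S1P.
have ST := tree_bidend_dendriform S1P; case: S1P => [[_ _ SM] _ _ _ prim_dot].
exact: (hopf_iso ST SM prim_dot phiK psiK psi_prec psi_succ psi_cop psi_hom).
Qed.
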